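(* Let $\mathcal{G}$ be the étale groupoid associated with a partial action of a discrete group $\Gamma$ on a locally compact Hausdorff space $X$. Then, for every $x\in\mathcal{G}^{(0)}=X$, we have $\lVert\cdot\rVert_e=\lVert\cdot\rVert_r$ on $\mathbb{C}\mathcal{G}^x_x$.
   Context: Partial action: a partial action of a discrete group $\Gamma$ on a locally compact Hausdorff space $X$ consists of, for every $\gamma\in\Gamma$, open subsets $X_{\gamma^{-1}}$ and $X_\gamma$ of $X$ and a homeomorphism $X_{\gamma^{-1}}\to X_\gamma$, denoted simply by $\gamma$, such that $X_e=X$ and, for all $\gamma_1,\gamma_2\in\Gamma$, $(\gamma_1\gamma_2)x=\gamma_1(\gamma_2x)$ whenever the right-hand side is well-defined (that is, the homeomorphism $\gamma_1\gamma_2$ extends the composition of $\gamma_1$ and $\gamma_2$). The associated groupoid is $\mathcal{G}=\{(y,\gamma,x)\in X\times\Gamma\times X: x\in X_{\gamma^{-1}},\ y=\gamma x\}$ with product $(z,\gamma_2,y)(y,\gamma_1,x)=(z,\gamma_2\gamma_1,x)$ and the topology inherited from the product topology on $X\times\Gamma\times X$; it is a locally compact Hausdorff étale groupoid with unit space identified with $X$, $r(y,\gamma,x)=y$, $s(y,\gamma,x)=x$. For a locally compact Hausdorff étale groupoid $\mathcal{G}$ put $\mathcal{G}_x=s^{-1}(x)$, $\mathcal{G}^x=r^{-1}(x)$, $\mathcal{G}^x_x=\mathcal{G}^x\cap\mathcal{G}_x$ (the isotropy group, discrete). $C_c(\mathcal{G})$ is the space of continuous compactly supported functions, a $*$-algebra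 with $(f_1*f_2)(g)=\sum_{h\in\mathcal{G}^{r(g)}}f_1(h)f_2(h^{-1}g)$ and $f^*(g)=\overline{f(g^{-1})}$. $C^*(\mathcal{G})$ is its completion in the norm $\sup_\rho\lVert\rho(f)\rVert$ over all representations by bounded operators on Hilbert spaces. $C^*_r(\mathcal{G})$ is its completion in the reduced norm $\lVert f\rVert_r=\sup_{y\in\mathcal{G}^{(0)}}\lVert\rho_y(f)\rVert$, where $\rho_y(f)\delta_g=\sum_{h\in\mathcal{G}_{r(g)}}f(h)\delta_{hg}$ on $\ell^2(\mathcal{G}_y)$. A representation of $C^*(\mathcal{G})$ factors through $C^*_r(\mathcal{G})$ if it vanishes on the kernel of the canonical surjection $C^*(\mathcal{G})\to C^*_r(\mathcal{G})$. Induction: let $\rho\colon C^*(\mathcal{G}^x_x)\to B(H)$ be a representation of the full group C$^*$-algebra with canonical unitaries $u_g$. Let $L$ be the Hilbert space of functions $\xi\colon\mathcal{G}_x\to H$ with $\xi(gh)=\rho(u_h^* )\xi(g)$ for $g\in\mathcal{G}_x$, $h\in\mathcal{G}^x_x$, and $\sum_{g\in\mathcal{G}_x/\mathcal{G}^x_x}\lVert\xi(g)\rVert^2<\infty$. Then $\operatorname{Ind}\rho\colon C^*(\mathcal{G})\to B(L)$ is given by $((\operatorname{Ind}\rho)(f)\xi)(g)=\sum_{h\in\mathcal{G}^{r(g)}}f(h)\xi(h^{-1}g)$ for $f\in C_c(\mathcal{G})$. Norms on the group algebra $\mathbb{C}\mathcal{G}^x_x=C_c(\mathcal{G}^x_x)$: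 $\lVert h\rVert_e=\sup_\rho\lVert\rho(h)\rVert$, the supremum over all representations $\rho$ of $C^*(\mathcal{G}^x_x)$ such that $\operatorname{Ind}\rho$ factors through $C^*_r(\mathcal{G})$ (this is a C$^*$-norm); $\lVert\cdot\rVert_r$ on $\mathbb{C}\mathcal{G}^x_x$ is the norm of the reduced group C$^*$-algebra $C^*_r(\mathcal{G}^x_x)$. *)

(* Defs.v *)
(* The complex numbers are R[i] for R : realType. *)
From HB Require Import structures.
From mathcomp Require Import all_boot all_order all_algebra.
From mathcomp Require Import all_classical all_reals all_analysis.
From mathcomp Require Import complex.

Set Implicit Arguments.
Unset Strict Implicit.
Unset Printing Implicit Defensive.

Import Order.TTheory GRing.Theory Num.Theory.
Import numFieldNormedType.Exports.

Local Open Scope classical_set_scope.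
Local Open Scope ring_scope.

(* [mul] is total, but is only meaningful on the composable pairs, i.e. when
   [src g = tgt h].  The unit space is [obj], embedded in the arrows by [idg].
   The topology on arrows is only used through [Cc] below: compatibility with
   the operations, and the étale property, are not part of the record. *)
Record groupoid : Type := Groupoid {
  arr : topologicalType;
  obj : Type;
  src : arr -> obj;
  tgt : arr -> obj;
  idg : obj -> arr;
  inv : arr -> arr;
  mul : arr -> arr -> arr;
  src_idg : forall x, src (idg x) = x;
  tgt_idg : forall x, tgt (idg x) = x;
  src_inv : forall g, src (inv g) = tgt g;
  tgt_inv : forall g, tgt (inv g) = src g;
  src_mul : forall g h, src g = tgt h -> src (mul g h) = src h;
  tgt_mul : forall g h, src g = tgt h -> tgt (mul g h) = tgt g;
  mul_assoc : forall g h k, src g = tgt h -> src h = tgt k ->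
    mul g (mul h k) = mul (mul g h) k;
  mul_idl : forall g, mul (idg (tgt g)) g = g;
  mul_idr : forall g, mul g (idg (src g)) = g;
  mul_invl : forall g, mul (inv g) g = idg (src g);
  mul_invr : forall g, mul g (inv g) = idg (tgt g) }.

Definition src_fiber (G : groupoid) (x : obj G) : set (arr G) :=
  [set g | src g = x].

Definition tgt_fiber (G : groupoid) (x : obj G) : set (arr G) :=
  [set g | tgt g = x].

Section isotropy.
Context (G : groupoid) (x : obj G).

Definition isotropy_set : set (arr G) := src_fiber x `&` tgt_fiber x.

Lemma isotropy_src (g : isotropy_set) : src (val g) = x.
Proof. by case: g => g /= /set_mem[]. Qed.

Lemma isotropy_tgt (g : isotropy_set) : tgt (val g) = x.
Proof. by case: g => g /= /set_mem[]. Qed.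

Lemma isotropy_id_subproof : idg x \in isotropy_set.
Proof.
by apply/mem_set; split; rewrite /src_fiber/tgt_fiber/= ?src_idg ?tgt_idg.
Qed.

Lemma isotropy_inv_subproof (g : isotropy_set) : inv (val g) \in isotropy_set.
Proof.
apply/mem_set; split; rewrite /src_fiber/tgt_fiber/= ?src_inv ?tgt_inv.
- exact: isotropy_tgt.
- exact: isotropy_src.
Qed.

Lemma isotropy_comp (g h : isotropy_set) : src (val g) = tgt (val h).
Proof. by rewrite isotropy_src isotropy_tgt. Qed.

Lemma isotropy_mul_subproof (g h : isotropy_set) :
  mul (val g) (val h) \in isotropy_set.
Proof.
have gh := isotropy_comp g h.
apply/mem_set; split; rewrite /src_fiber/tgt_fiber/= ?src_mul ?tgt_mul//.
- exact: isotropy_src.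
- exact: isotropy_tgt.
Qed.

Definition isotropy_id : isotropy_set := exist (fun g => g \in isotropy_set) _ isotropy_id_subproof.

Definition isotropy_inv (g : isotropy_set) : isotropy_set :=
  exist (fun g => g \in isotropy_set) _ (isotropy_inv_subproof g).

Definition isotropy_mul (g h : isotropy_set) : isotropy_set :=
  exist (fun g => g \in isotropy_set) _ (isotropy_mul_subproof g h).

Program Definition isotropy : groupoid :=
  @Groupoid (discrete_topology isotropy_set) unit
    (fun=> tt) (fun=> tt) (fun=> isotropy_id) isotropy_inv isotropy_mul
    _ _ _ _ _ _ _ _ _ _ _.
Next Obligation. by case. Qed.
Next Obligation. by case. Qed.
Next Obligation. by []. Qed.
Next Obligation. by []. Qed.
Next Obligation. by []. Qed.
Next Obligation. by []. Qed.
Next Obligation.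
by move=> g h k _ _; apply/val_inj; apply: mul_assoc; exact: isotropy_comp.
Qed.
Next Obligation.
by move=> g; apply/val_inj; rewrite /= -[RHS]mul_idl (isotropy_tgt g).
Qed.
Next Obligation.
by move=> g; apply/val_inj; rewrite /= -[RHS]mul_idr (isotropy_src g).
Qed.
Next Obligation.
by move=> g; apply/val_inj; rewrite /= (mul_invl (val g)) (isotropy_src g).
Qed.
Next Obligation.
by move=> g; apply/val_inj; rewrite /= (mul_invr (val g)) (isotropy_tgt g).
Qed.

Definition isotropy_val (g : arr isotropy) : arr G := val (g : isotropy_set).

End isotropy.

Section hilbert.
Context (R : realType).

Record hilbert : Type := Hilbert {
  hspace :> completeNormedModType R[i];
  hdot : {dot hspace for Num.conj};
  hdot_norm : forall v, hdot v v = `|v| ^+ 2 }.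

(* The norms of the library take values in R[i]. *)
Definition hnorm (H : hilbert) (v : H) : \bar R := (complex.Re `|v|)%:E.

(* Norm of an operator on the normed space with underlying set [D] and
   norm [N]. *)
Definition opnorm (V : Type) (D : set V) (N : V -> \bar R) (T : V -> V) :
    \bar R :=
  ereal_sup [set N (T v) | v in D `&` [set v | (N v <= 1)%E]].

End hilbert.

Section convolution_algebra.
Context (R : realType) (G : groupoid).
Implicit Types (f : arr G -> R[i]) (g h k : arr G).

Definition Cc f : Prop :=
  continuous (f : arr G -> (R[i] : numClosedFieldType)) /\
  compact (closure [set g | f g != 0]).

(* For an étale groupoid and f1 in Cc, only finitely many terms are nonzero. *)
Definition convol f1 f2 : arr G -> R[i] :=
  fun g => \sum_(h \in tgt_fiber (tgt g)) f1 h * f2 (mul (inv h) g).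

Definition star f : arr G -> R[i] := fun g => (f (inv g))^*.

Definition delta g : arr G -> R[i] := fun k => (g == k)%:R.

(* The values of a representation outside Cc are irrelevant. By definition of
   the full norm it extends uniquely to the completion C*(G), and every
   representation of C*(G) arises in this way. *)
Record representation (H : hilbert R) : Type := Representation {
  rep :> (arr G -> R[i]) -> {linear H -> H};
  rep_bounded : forall f, Cc f -> continuous (rep f);
  rep_linear : forall (a : R[i]) f1 f2, Cc f1 -> Cc f2 ->
    forall v, rep (fun g => a * f1 g + f2 g) v = a *: rep f1 v + rep f2 v;
  rep_convol : forall f1 f2, Cc f1 -> Cc f2 ->
    forall v, rep (convol f1 f2) v = rep f1 (rep f2 v);
  rep_star : forall f, Cc f ->
    forall u v, hdot H (rep f u) v = hdot H u (rep (star f) v) }.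

Definition rep_norm (H : hilbert R) (rho : representation H) f : \bar R :=
  opnorm setT (@hnorm R H) (rho f).

Definition full_norm f : \bar R :=
  ereal_sup [set t | exists (H : hilbert R) (rho : representation H),
    t = rep_norm rho f].

(* l^2(G_y), as a space of functions on G vanishing outside G_y. *)
Definition ell2_norm (y : obj G) (xi : arr G -> R[i]) : \bar R :=
  sqrte (\esum_(g in src_fiber y) ((complex.Re `|xi g|) ^+ 2)%:E).

Definition ell2 (y : obj G) : set (arr G -> R[i]) :=
  [set xi | (forall g, src g <> y -> xi g = 0) /\
            (ell2_norm y xi < +oo)%E].

(* The operator rho_y(f) applied to xi = sum_(g in G_y) xi(g) delta_g, where
   rho_y(f) delta_g = sum_(h in G_{r(g)}) f(h) delta_{hg}. *)
Definition regular (y : obj G) f (xi : arr G -> R[i]) : arr G -> R[i] :=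
  fun k => \sum_(g \in src_fiber y)
    xi g * \sum_(h \in src_fiber (tgt g)) f h * delta (mul h g) k.

Definition reduced_norm f : \bar R :=
  ereal_sup [set opnorm (ell2 y) (ell2_norm y) (regular y f) | y in setT].

(* An element of the completion C*(G) of Cc for the full norm, given by a
   Cauchy sequence that represents it. *)
Record cstar : Type := Cstar {
  cstar_seq :> nat -> arr G -> R[i];
  cstar_Cc : forall n, Cc (cstar_seq n);
  cstar_cauchy : forall e : R, 0 < e -> exists N : nat,
    forall m n, (N <= m)%N -> (N <= n)%N ->
      (full_norm (cstar_seq m \- cstar_seq n)%R <= e%:E)%E }.

(* The canonical surjection C*(G) -> C*_r(G) is the identity on Cc, hence maps
   the class of a sequence to the class of the same sequence. *)
Definition ker_reduced (a : cstar) : Prop :=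
  reduced_norm (a n) @[n --> \oo] --> 0%E.

End convolution_algebra.

Section induction.
Context (R : realType) (G : groupoid) (x : obj G) (H : hilbert R).
Context (rho : representation (isotropy x) H).

Definition coset (g : arr G) : set (arr G) :=
  [set mul g (isotropy_val h) | h in [set: arr (isotropy x)]].

Definition cosets : set (set (arr G)) := [set coset g | g in src_fiber x].

(* On the space below |xi| is constant on each coset, so that the choice of a
   representative by [xget] does not matter. *)
Definition ind_norm (xi : arr G -> H) : \bar R :=
  sqrte (\esum_(c in cosets)
    ((complex.Re `|xi (xget (idg x) c)|) ^+ 2)%:E).

(* Functions on G_x are extended by 0 to G. *)
Definition ind_space : set (arr G -> H) :=
  [set xi | [/\ forall g, src g <> x -> xi g = 0,
      forall g (h : arr (isotropy x)), src g = x ->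
        xi (mul g (isotropy_val h)) = rho (star (delta R h)) (xi g) &
      (ind_norm xi < +oo)%E]].

Definition ind (f : arr G -> R[i]) (xi : arr G -> H) : arr G -> H :=
  fun g => \sum_(h \in tgt_fiber (tgt g)) f h *: xi (mul (inv h) g).

(* The operator (Ind rho)(a) is the norm limit of the (Ind rho)(a n). *)
Definition ind_vanishes (a : cstar R G) : Prop :=
  opnorm ind_space ind_norm (ind (a n)) @[n --> \oo] --> 0%E.

Definition ind_factors_reduced : Prop :=
  forall a : cstar R G, ker_reduced a -> ind_vanishes a.

End induction.

Definition norm_e (R : realType) (G : groupoid) (x : obj G)
    (f : arr (isotropy x) -> R[i]) : \bar R :=
  ereal_sup [set t | exists (H : hilbert R)
    (rho : representation (isotropy x) H),
    ind_factors_reduced rho /\ t = rep_norm rho f].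

Definition homeo_on (X : topologicalType) (A B : set X) (f : X -> X) : Prop :=
  [/\ set_bij A B f, {within A, continuous f} &
      exists2 f' : X -> X, {in A, cancel f f'} & {within B, continuous f'}].

(* [pdom c] is the open set X_c, and [pact c] is only meaningful on
   X_{c^-1}. *)
Record partial_action (Gam : groupType) (X : topologicalType) : Type :=
  PartialAction {
  pdom : Gam -> set X;
  pact : Gam -> X -> X;
  pdom_open : forall c, open (pdom c);
  pact_homeo : forall c, homeo_on (pdom c^-1%g) (pdom c) (pact c);
  pdom1 : pdom 1%g = setT;
  pactM : forall c1 c2 x, pdom c2^-1%g x -> pdom c1^-1%g (pact c2 x) ->
    pdom (c1 * c2)^-1%g x /\ pact (c1 * c2)%g x = pact c1 (pact c2 x) }.

Section action_groupoid.
Context (Gam : groupType) (X : topologicalType) (a : partial_action Gam X).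

Definition ag_set : set (X * discrete_topology Gam * X) :=
  [set p | pdom a (p.1.2 : Gam)^-1%g p.2 /\
           p.1.1 = pact a (p.1.2 : Gam) p.2].

Definition ag_src (p : ag_set) : X := (val p).2.
Definition ag_tgt (p : ag_set) : X := (val p).1.1.
Definition ag_elt (p : ag_set) : Gam := (val p).1.2.

Lemma agP (p : ag_set) :
  pdom a (ag_elt p)^-1%g (ag_src p) /\ ag_tgt p = pact a (ag_elt p) (ag_src p).
Proof. exact: set_mem (valP p). Qed.

Lemma ag_eq (p q : ag_set) : ag_tgt p = ag_tgt q -> ag_elt p = ag_elt q ->
  ag_src p = ag_src q -> p = q.
Proof.
case: p q => [[[y c] x] hp] [[[y' c'] x'] hq]; rewrite /ag_tgt/ag_elt/ag_src/=.
by move=> yy cc xx; apply/val_inj => /=; rewrite yy cc xx.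
Qed.

Lemma pact1 x : pact a 1%g x = x.
Proof.
have d1 y : pdom a (1 : Gam)^-1%g y by rewrite invg1 pdom1.
have [_ e1] := pactM (d1 x) (d1 (pact a 1%g x)).
rewrite mul1g in e1.
have [[_ inj _] _ _] := pact_homeo a 1%g.
by apply: inj; [exact/mem_set/d1|exact/mem_set/d1|rewrite -e1].
Qed.

Lemma pdom_act c x : pdom a c^-1%g x -> pdom a c (pact a c x).
Proof. by have [[h _ _] _ _] := pact_homeo a c => /h. Qed.

Lemma pactK c x : pdom a c^-1%g x -> pact a c^-1%g (pact a c x) = x.
Proof.
move=> cx; have cx' : pdom a (c^-1)^-1%g (pact a c x).
  by rewrite invgK; exact: pdom_act.
by have [_ <-] := pactM cx cx'; rewrite mulVg pact1.
Qed.

Lemma ag_id_subproof x : ((x, 1%g, x) : X * discrete_topology Gam * X) \in ag_set.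
Proof. by apply/mem_set; split; rewrite /= ?pact1// invg1 pdom1. Qed.

Definition ag_id (x : X) : ag_set := exist (fun p => p \in ag_set) _ (ag_id_subproof x).

Lemma ag_inv_subproof (p : ag_set) :
  ((ag_src p, (ag_elt p)^-1%g, ag_tgt p) : X * discrete_topology Gam * X)
    \in ag_set.
Proof.
have [px py] := agP p; apply/mem_set; split; rewrite /= py ?pactK//.
by rewrite invgK; exact: pdom_act.
Qed.

Definition ag_inv (p : ag_set) : ag_set := exist (fun p => p \in ag_set) _ (ag_inv_subproof p).

Lemma ag_mul_subproof (p q : ag_set) : ag_src p = ag_tgt q ->
  ((ag_tgt p, (ag_elt p * ag_elt q)%g, ag_src q)
    : X * discrete_topology Gam * X) \in ag_set.
Proof.
have [px py] := agP p; have [qx qy] := agP q => pq.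
rewrite pq qy in px py.
by have [h1 h2] := pactM qx px; apply/mem_set; split; rewrite //= h2.
Qed.

Definition ag_mul (p q : ag_set) : ag_set :=
  match pselect (ag_src p = ag_tgt q) with
  | left pq => exist (fun p => p \in ag_set) _ (ag_mul_subproof pq)
  | right _ => p
  end.

Lemma ag_mulE (p q : ag_set) : ag_src p = ag_tgt q ->
  [/\ ag_tgt (ag_mul p q) = ag_tgt p, ag_elt (ag_mul p q) = (ag_elt p * ag_elt q)%g
    & ag_src (ag_mul p q) = ag_src q].
Proof. by move=> pq; rewrite /ag_mul; case: pselect. Qed.

Program Definition action_groupoid : groupoid :=
  @Groupoid ag_set X ag_src ag_tgt ag_id ag_inv ag_mul
    _ _ _ _ _ _ _ _ _ _ _.
Next Obligation. by []. Qed.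
Next Obligation. by []. Qed.
Next Obligation. by []. Qed.
Next Obligation. by []. Qed.
Next Obligation. by move=> p q /ag_mulE[]. Qed.
Next Obligation. by move=> p q /ag_mulE[]. Qed.
Next Obligation.
move=> g h k gh hk.
have [hk1 hk2 hk3] := ag_mulE hk; have [gh1 gh2 gh3] := ag_mulE gh.
have [] := @ag_mulE g (ag_mul h k); first by rewrite hk1.
have [] := @ag_mulE (ag_mul g h) k; first by rewrite gh3.
by move=> e1 e2 e3 e4 e5 e6; apply: ag_eq; congruence || rewrite e5 hk2 e2 gh2 mulgA.
Qed.
Next Obligation.
move=> g; have [|e1 e2 e3] := @ag_mulE (ag_id (ag_tgt g)) g; first by [].
by apply: ag_eq; rewrite ?e1 ?e3// e2 /= mul1g.
Qed.
Next Obligation.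
move=> g; have [|e1 e2 e3] := @ag_mulE g (ag_id (ag_src g)); first by [].
by apply: ag_eq; rewrite ?e1 ?e3// e2 /= mulg1.
Qed.
Next Obligation.
move=> g; have [|e1 e2 e3] := @ag_mulE (ag_inv g) g; first by [].
by apply: ag_eq; rewrite ?e1 ?e3// e2 /= mulVg.
Qed.
Next Obligation.
move=> g; have [|e1 e2 e3] := @ag_mulE g (ag_inv g); first by [].
by apply: ag_eq; rewrite ?e1 ?e3// e2 /= mulgV.
Qed.

End action_groupoid.

(* Main.v *)
(* One inequality: the left regular representation of the isotropy group S at x
   induces the regular representation at x, through xi |-> (g |-> xi(g)(e)), so
   it factors through the reduced C*-algebra.

   The other: let f be finitely supported on S with reduced norm < 1, and let
   phi be a bump function equal to 1 at x.  The function
     F (y, c, z) = f(c) phi(y) phi(z)   (c in the stabilizer of x)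
   restricts to f on S.  On each fiber of the source map, convolution by F is
   left convolution by f along the orbits of S in Gamma, cut down by phi, so F
   also has reduced norm < 1.  Hence (T - 1)_+ T^2, for T = F^* F, is killed in
   the reduced C*-algebra.  Restriction to S is multiplicative on functions
   supported over the stabilizer, and (Ind rho)(a) contains rho(a restricted to
   S) as the compression to the trivial coset.  So if Ind rho factors through
   the reduced C*-algebra, then (T - 1)_+ T^2 = 0 for T = rho(f)^* rho(f), that
   is rho(f) is a contraction.  The positive part is the norm limit of explicit
   polynomials, given by the Riesz-Nagy square root iteration, which gives an
   element of the full C*-algebra with no spectral theory. *)
From HB Require Import structures.
From mathcomp Require Import all_boot all_order all_algebra.
From mathcomp Require Import all_classical all_reals all_analysis.
From mathcomp Require Import complex.
From mathcomp Require Import finmap ring lra.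

Require Import Defs.

Set Implicit Arguments.
Unset Strict Implicit.
Unset Printing Implicit Defensive.

Import Order.TTheory GRing.Theory Num.Theory.
Import numFieldNormedType.Exports.

Local Open Scope classical_set_scope.
Local Open Scope ring_scope.

Local Notation "x %:C" := (real_complex _ x) (format "x %:C") : ring_scope.

(** * Riesz-Nagy iteration *)

(** The polynomials that approximate the positive part have in general a constant term, so they do
    not lie in the convolution algebra, which need not have a unit. They are therefore applied to
    [T^2]. As they commute with [T], one factor [T] moves to each side of the inner product and
    leaves their quadratic form at [T v].

    A Cauchy sequence for the full norm needs an estimate uniform over all representations. It comes
    from domination: the increments of the iteration are polynomials with nonnegative coefficients
    in an operator of norm at most 1, so they are bounded by the increments of one scalar sequence.
    The input is a bound on [F] valid in every representation, obtained slice by slice: for a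
    function on one slice, [F^* F] lives on the units, where [1 - F^* F] has a pointwise square
    root.

    Elements of the stabilizer act only on parts of [X]. The function phi vanishes outside a compact
    set contained in all the domains involved, so a vector cut down by phi and extended by 0 to
    [Gam * X] can be moved by left multiplication. This action of [S] is global and free, and the
    estimate reduces to one copy of [l^2(S)] at a time. *)

Section riesz_nagy.
Context (R : realType).

(** The iteration of [rn_iter] at the scalar 1. Its increments dominate those of the operator
    iteration. *)
Fixpoint rn_real (n : nat) : R :=
  if n is m.+1 then (1 + rn_real m ^+ 2) / 2 else 0.

Lemma rn_real_itv n : 0 <= rn_real n <= 1.
Proof. by elim: n => [|n /andP[h0 h1]] /=; [lra|nra]. Qed.

Lemma rn_real_leS n : rn_real n <= rn_real n.+1.
Proof.
have := rn_real_itv n; elim: n => [|n ih] /=; first by nra.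
have /ih := rn_real_itv n; rewrite /=.
set y := rn_real n; have := rn_real_itv n; rewrite -/y => hy h1 h2; nra.
Qed.

Lemma rn_real_cvg : cvgn rn_real.
Proof.
apply: nondecreasing_is_cvgn; first by apply/nondecreasing_seqP/rn_real_leS.
by exists 1 => _ [n _ <-]; have /andP[] := rn_real_itv n.
Qed.

Lemma rn_realS_sub_cvg : (rn_real n.+1 - rn_real n) @[n --> \oo] --> (0 : R).
Proof.
rewrite -(subrr (limn rn_real)); apply: cvgB; last exact: rn_real_cvg.
by have := rn_real_cvg; rewrite -(cvg_shiftS rn_real).
Qed.

Context (V : lmodType R[i]) (s : R) (T : V -> V).

Definition rn_comp (v : V) := v - T v.
(** With [X] this operator, a solution of [Y = (X + Y^2) / 2] satisfies
    [(1 - Y)^2 = 1 - X = (1 - T)^2 / s^2], so [s (1 - Y)] is a square root of [(1 - T)^2]. *)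
Definition rn_base (v : V) := v - (s ^- 2)%:C *: rn_comp (rn_comp v).

(* The Riesz-Nagy iteration for 1 - |1 - T| / s, applied to vectors so that T
   may be convolution by an element of a non-unital algebra. *)
Fixpoint rn_iter (n : nat) (v : V) : V :=
  if n is m.+1 then 2^-1%:C *: (rn_base v + rn_iter m (rn_iter m v)) else 0.

Definition rn_abs n v := s%:C *: (v - rn_iter n v).
(* Tends to |1 - T| - (1 - T) = 2 (T - 1)_+ applied to v. *)
Definition rn_cut n v := rn_abs n v - rn_comp v.

End riesz_nagy.

Section intertwining.
Context (R : realType) (U V : lmodType R[i]) (s : R).
Context (D : set U) (TU : U -> U) (TV : V -> V) (J : U -> V).
Hypothesis D_lin : forall (a : R[i]) u w, D u -> D w -> D (a *: u + w).
Hypothesis D0 : D 0.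
Hypothesis D_TU : forall u, D u -> D (TU u).

Let DB u w : D u -> D w -> D (u - w).
Proof. by move=> Du Dw; rewrite addrC -scaleN1r; exact: D_lin. Qed.

Let DZ a u : D u -> D (a *: u).
Proof. by move=> Du; rewrite -[_ *: _]addr0; exact: D_lin. Qed.

Let DD u w : D u -> D w -> D (u + w).
Proof. by move=> Du Dw; rewrite -[u]scale1r; exact: D_lin. Qed.

Let D_comp u : D u -> D (rn_comp TU u).
Proof. by move=> Du; apply: DB => //; exact: D_TU. Qed.

Let D_base u : D u -> D (rn_base s TU u).
Proof. by move=> Du; apply: DB => //; apply: DZ; do 2 apply: D_comp. Qed.

Let D_iter n u : D u -> D (rn_iter s TU n u).
Proof.
elim: n u => [//|n ih] u Du /=.
by apply/DZ/DD; [exact: D_base|exact/ih/ih].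
Qed.

Lemma rn_cut_closed n u : D u -> D (rn_cut s TU n u).
Proof.
by move=> Du; apply: DB; [apply/DZ/DB => //; exact: D_iter|exact: D_comp].
Qed.

Hypothesis J_lin : forall (a : R[i]) u w, D u -> D w ->
  J (a *: u + w) = a *: J u + J w.
Hypothesis J_TU : forall u, D u -> J (TU u) = TV (J u).

Let J0 : J 0 = 0.
Proof. by have := J_lin (-1) D0 D0; rewrite scaleN1r oppr0 addr0 scaleN1r addNr. Qed.

Let JB u w : D u -> D w -> J (u - w) = J u - J w.
Proof. by move=> Du Dw; rewrite addrC -scaleN1r J_lin// scaleN1r addrC. Qed.

Let JZ a u : D u -> J (a *: u) = a *: J u.
Proof. by move=> Du; rewrite -[_ *: _]addr0 J_lin// J0 addr0. Qed.

Let JD u w : D u -> D w -> J (u + w) = J u + J w.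
Proof. by move=> Du Dw; rewrite -[u]scale1r J_lin// !scale1r. Qed.

Let J_comp u : D u -> J (rn_comp TU u) = rn_comp TV (J u).
Proof. by move=> Du; rewrite JB// ?J_TU//; exact: D_TU. Qed.

Let J_base u : D u -> J (rn_base s TU u) = rn_base s TV (J u).
Proof.
move=> Du; have Dc := D_comp Du; have Dcc := D_comp Dc.
by rewrite /rn_base JB ?JZ ?J_comp//; exact: DZ.
Qed.

Let J_iter n u : D u -> J (rn_iter s TU n u) = rn_iter s TV n (J u).
Proof.
elim: n u => [|n ih] u Du /=; first exact: J0.
have Db := D_base Du; have Di := D_iter n Du; have Dii := D_iter n Di.
have Ds := DD Db Dii.
by rewrite JZ ?(JD Db Dii) ?J_base ?(ih _ Di) ?(ih _ Du).
Qed.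

(** The cut is a polynomial in its operator. This is applied with [TU] convolution by an element of
    the algebra and [J] the map [w |-> rho w v] or [w |-> fconv w u]. The set [D] is there because
    such a [J] is known to be linear and multiplicative only on [Cc] or a subspace of it. *)
Lemma rn_cut_morph n u : D u -> J (rn_cut s TU n u) = rn_cut s TV n (J u).
Proof.
move=> Du; have Dc := D_comp Du; have Di := D_iter n Du.
have Db := DB Du Di.
have Ds := DZ s%:C Db.
by rewrite /rn_cut /rn_abs (JB Ds Dc) JZ ?(JB Du Di) ?J_comp ?J_iter.
Qed.

End intertwining.

(** * Real semi-inner products *)

Section semi_inner_product.
Context (R : realType) (V : lmodType R[i]) (r : V -> V -> R).
Hypothesis rD : forall u v w, r (u + v) w = r u w + r v w.
Hypothesis rZ : forall (a : R) u w, r (a%:C *: u) w = a * r u w.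
Hypothesis rC : forall u v, r u v = r v u.
Hypothesis r_ge0 : forall v, 0 <= r v v.

Definition sip_norm v := Num.sqrt (r v v).
Local Notation nn := sip_norm.

Lemma sip0 w : r 0 w = 0.
Proof. by have := rZ 0 0 w; rewrite scaler0 mul0r. Qed.

Lemma sipN u w : r (- u) w = - r u w.
Proof. by have /eqP := rD u (- u) w; rewrite subrr sip0 eq_sym addrC addr_eq0 => /eqP. Qed.

Lemma sipB u v w : r (u - v) w = r u w - r v w.
Proof. by rewrite rD sipN. Qed.

Lemma sipDr u v w : r w (u + v) = r w u + r w v.
Proof. by rewrite rC rD !(rC w). Qed.

Lemma sipBr u v w : r w (u - v) = r w u - r w v.
Proof. by rewrite rC sipB !(rC w). Qed.

Lemma sipZr a u w : r w (a%:C *: u) = a * r w u.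
Proof. by rewrite rC rZ rC. Qed.

Lemma sip_norm_ge0 v : 0 <= nn v. Proof. exact: sqrtr_ge0. Qed.

Lemma sip_norm_sq v : nn v ^+ 2 = r v v. Proof. exact: sqr_sqrtr. Qed.

Lemma sip_normZ a v : nn (a%:C *: v) = `|a| * nn v.
Proof.
by rewrite /nn rZ sipZr mulrA -expr2 sqrtrM ?sqr_ge0// sqrtr_sqr.
Qed.

Lemma sip_norm_le a v : 0 <= a -> (nn v <= a) = (r v v <= a ^+ 2).
Proof.
by move=> a0; rewrite -sip_norm_sq ler_pXn2r// nnegrE// sip_norm_ge0.
Qed.

(** The form at [a u - b v] is nonnegative; [a = |v|] and [b = |u|] settle the case where neither
    seminorm vanishes. A vanishing seminorm does not give a zero vector here, so that case is
    separate. *)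
Lemma sip_CS u v : r u v <= nn u * nn v.
Proof.
have key (a b : R) : 0 <= a ^+ 2 * r u u - 2 * (a * b) * r u v + b ^+ 2 * r v v.
  have := r_ge0 (a%:C *: u - b%:C *: v).
  by rewrite sipB !sipBr !rZ !sipZr (rC v u); lra.
rewrite leNgt; apply/negP => lt_uv.
have u0 := sip_norm_ge0 u; have v0 := sip_norm_ge0 v.
have := key (nn v ^+ 2 + r u v) (nn u ^+ 2 + r u v); rewrite -!sip_norm_sq.
have := key (nn v) (nn u); rewrite -!sip_norm_sq => k1 k2.
have [uv0|uv0] := eqVneq (nn u * nn v) 0; last first.
  have uv1 : 0 < nn u * nn v by rewrite lt_neqAle eq_sym uv0 mulr_ge0.
  by move: k1; nra.
(* If [r v v = 0], the form is affine in [b], and [a = 1] with this [b] makes it [- r u u - 2 < 0].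
   The second choice treats [r u u = 0] in the same way. *)
have {k1 k2} := key 1 ((r u u + 1) / r u v) ; have := key ((r v v + 1) / r u v) 1.
have ruv : 0 < r u v by rewrite -uv0.
move/eqP: uv0; rewrite mulf_eq0 => /orP[/eqP z|/eqP z].
  rewrite -!sip_norm_sq z expr0n /= => h _; move: h.
  have -> : 2 * ((nn v ^+ 2 + 1) / r u v * 1) * r u v = 2 * (nn v ^+ 2 + 1).
    by field; rewrite gt_eqF.
  by have := sqr_ge0 (nn v); nra.
rewrite -!sip_norm_sq z expr0n /= => _.
have -> : 2 * (1 * ((nn u ^+ 2 + 1) / r u v)) * r u v = 2 * (nn u ^+ 2 + 1).
  by field; rewrite gt_eqF.
by have := sqr_ge0 (nn u); nra.
Qed.

Lemma sip_normN v : nn (- v) = nn v.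
Proof. by rewrite /nn sipN rC sipN opprK. Qed.

Lemma sip_normD u v : nn (u + v) <= nn u + nn v.
Proof.
rewrite sip_norm_le ?addr_ge0 ?sip_norm_ge0// rD !sipDr (rC v u).
by have := sip_CS u v; rewrite -!sip_norm_sq; lra.
Qed.

Lemma sip_normB u v : nn (u - v) = nn (v - u).
Proof. by rewrite -sip_normN opprB. Qed.

End semi_inner_product.

Section contraction.
Context (R : realType) (V : lmodType R[i]) (r : V -> V -> R).
Hypothesis rD : forall u v w, r (u + v) w = r u w + r v w.
Hypothesis rZ : forall (a : R) u w, r (a%:C *: u) w = a * r u w.
Hypothesis rC : forall u v, r u v = r v u.
Hypothesis r_ge0 : forall v, 0 <= r v v.
Context (S S' : {linear V -> V}) (T : V -> V) (M s : R).
Hypothesis adj : forall u v, r (S u) v = r u (S' v).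
Hypothesis TE : forall v, T v = S' (S v).
Hypothesis M_ge0 : 0 <= M.
Hypothesis S_le : forall v, r (S v) (S v) <= M * r v v.
Hypothesis s_ge : 1 + M <= s.

Local Notation nn := (sip_norm r).
Local Notation Q := (rn_comp T).
Local Notation X := (rn_base s T).
Local Notation Y := (rn_iter s T).
Local Notation y := (@rn_real R).

Let rB := sipB rD rZ.
Let rBr := sipBr rD rZ rC.
Let rZr := sipZr rZ rC.
Let CS := sip_CS rD rZ rC r_ge0.
Let nnD := sip_normD rD rZ rC r_ge0.
Let nnB := sip_normB rD rZ rC.
Let nnZ := sip_normZ rZ rC.
Let nn2 := sip_norm_sq r_ge0.
Let nn0 := sip_norm_ge0 r.
Let nnle := sip_norm_le r_ge0.

Let s_ge1 : 1 <= s. Proof. by move: s_ge M_ge0; lra. Qed.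
Let s_gt0 : 0 < s. Proof. exact: lt_le_trans s_ge1. Qed.

Let TB u v : T (u - v) = T u - T v. Proof. by rewrite !TE !linearB. Qed.
Let TD u v : T (u + v) = T u + T v. Proof. by rewrite !TE !linearD. Qed.
Let TZ a v : T (a *: v) = a *: T v. Proof. by rewrite !TE !linearZ. Qed.

Let QB u v : Q (u - v) = Q u - Q v.
Proof. by rewrite /rn_comp TB !opprD !opprK addrACA. Qed.
Let QD u v : Q (u + v) = Q u + Q v.
Proof. by rewrite /rn_comp TD opprD addrACA. Qed.
Let QZ a v : Q (a *: v) = a *: Q v.
Proof. by rewrite /rn_comp TZ [RHS]scalerBr. Qed.

Let XD u v : X (u + v) = X u + X v.
Proof. by rewrite /rn_base !QD scalerDr opprD addrACA. Qed.
Let XZ a v : X (a *: v) = a *: X v.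
Proof. by rewrite /rn_base !QZ [RHS]scalerBr !scalerA mulrC. Qed.

Let YD n u v : Y n (u + v) = Y n u + Y n v.
Proof.
elim: n u v => [|n ih] u v /=; first by rewrite addr0.
by rewrite XD !ih -scalerDr addrACA.
Qed.
Let YZ n a v : Y n (a *: v) = a *: Y n v.
Proof.
elim: n v => [|n ih] v /=; first by rewrite scaler0.
by rewrite XZ !ih -scalerDr !scalerA mulrC.
Qed.
Let YN n v : Y n (- v) = - Y n v.
Proof. by rewrite -scaleN1r YZ scaleN1r. Qed.
Let YB n u v : Y n (u - v) = Y n u - Y n v.
Proof. by rewrite YD YN. Qed.

Let TQ v : T (Q v) = Q (T v). Proof. by rewrite /rn_comp TB. Qed.
Let TX v : T (X v) = X (T v). Proof. by rewrite /rn_base TB TZ !TQ. Qed.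
Let TY n v : T (Y n v) = Y n (T v).
Proof.
elim: n v => [|n ih] v /=; first by rewrite TE !linear0.
by rewrite TZ TD TX !ih.
Qed.
Let QY n v : Q (Y n v) = Y n (Q v). Proof. by rewrite /rn_comp YB TY. Qed.
Let XY n v : X (Y n v) = Y n (X v). Proof. by rewrite /rn_base YB YZ !QY. Qed.
Let YY m n v : Y m (Y n v) = Y n (Y m v).
Proof.
elim: m v => [|m ih] v /=; first by rewrite -[0](scale0r 0) YZ !scale0r.
by rewrite XY !ih YZ YD.
Qed.

Let adj' u v : r (S' u) v = r u (S v). Proof. by rewrite rC -adj rC. Qed.
Let T_adj u v : r (T u) v = r u (T v).
Proof. by rewrite !TE adj' adj. Qed.
Let T_ge0 v : r (T v) v = r (S v) (S v). Proof. by rewrite TE adj'. Qed.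

Let Q_adj u v : r (Q u) v = r u (Q v).
Proof. by rewrite /rn_comp rB rBr T_adj. Qed.

(** [|S' w|^2 = r w (S (S' w)) <= |w| |S (S' w)|], and the bound on [S] turns the last factor into a
    multiple of [|S' w|], which cancels. *)
Let S'_le w : r (S' w) (S' w) <= M * r w w.
Proof.
have h1 : r (S' w) (S' w) <= nn w * nn (S (S' w)) by rewrite adj'; exact: CS.
have h2 : r (S (S' w)) (S (S' w)) <= M * r (S' w) (S' w) by exact: S_le.
have h3 := r_ge0 (S' w); have h4 := nn0 w; have h5 := nn0 (S (S' w)).
rewrite -!nn2 in h1 h2 h3 *.
have [->|z0] := eqVneq (nn (S' w)) 0; first by rewrite expr0n mulr_ge0 ?sqr_ge0.
have zp : 0 < nn (S' w) by rewrite lt_neqAle eq_sym z0 nn0.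
have h6 : (nn (S' w) ^+ 2) ^+ 2 <= (nn w * nn (S (S' w))) ^+ 2.
  by rewrite ler_pXn2r// nnegrE ?mulr_ge0.
have h7 : nn w ^+ 2 * nn (S (S' w)) ^+ 2 <= nn w ^+ 2 * (M * nn (S' w) ^+ 2).
  by rewrite ler_wpM2l// sqr_ge0.
rewrite -(ler_pM2r (exprn_gt0 2 zp)); move: h6 h7; rewrite exprMn; nra.
Qed.

Lemma gram_norm_le v : nn (T v) <= M * nn v.
Proof.
rewrite nnle ?mulr_ge0// exprMn nn2 TE (le_trans (S'_le _))// expr2 -mulrA.
by rewrite ler_wpM2l.
Qed.

Let Q_le v : r (Q v) (Q v) <= s ^+ 2 * r v v.
Proof.
have s0 := ltW s_gt0; rewrite -nn2 -[r v v]nn2 -exprMn ler_pXn2r// ?nnegrE ?mulr_ge0//.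
rewrite /rn_comp (le_trans (nnD _ _))// (sip_normN rD rZ rC).
by rewrite (le_trans (lerD (lexx _) (gram_norm_le v)))// -{1}[nn v]mul1r -mulrDl ler_wpM2r.
Qed.

Let Q_ge v : (1 - M) * r v v <= r (Q v) v.
Proof. by rewrite /rn_comp rB T_ge0 mulrBl mul1r lerB. Qed.

(** [|X v|^2 = |v|^2 - 2 |Q v|^2 / s^2 + |Q (Q v)|^2 / s^4], and the last term is at most
    [|Q v|^2 / s^2] because [Q] has norm at most [s]. *)
Let X_le v : nn (X v) <= nn v.
Proof.
rewrite nnle// nn2 /rn_base rB !rBr !rZ !rZr (rC (Q (Q v))) -[r v (Q (Q v))]Q_adj.
have := Q_le (Q v); have := r_ge0 (Q v).
set b := r (Q v) (Q v); set c := r (Q (Q v)) _ => b0 cb.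
have s2 : 0 < s ^- 2 by rewrite invr_gt0 exprn_gt0.
have : s ^- 2 * (s ^- 2 * c) <= s ^- 2 * b.
  rewrite ler_pM2l// ler_pdivrMl// exprn_gt0//.
by have := mulr_ge0 (ltW s2) b0; lra.
Qed.

Let Y_le n v : nn (Y n v) <= y n * nn v.
Proof.
elim: n v => [|n ih] v /=; first by rewrite /sip_norm (sip0 rZ) sqrtr0 mul0r.
have /andP[y0 y1] := rn_real_itv R n.
rewrite nnZ ger0_norm ?invr_ge0// mulrAC [leRHS]mulrC ler_pM2l ?invr_gt0//.
rewrite mulrDl mul1r (le_trans (nnD _ _))// lerD// expr2 -mulrA.
by rewrite (le_trans (ih _))// ler_wpM2l.
Qed.

(** The factorization of [Y_{n+1}^2 - Y_n^2], valid because the iterates commute. The scalar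
    sequence satisfies the same recursion, so the bound [YS_le] propagates from each increment to
    the next. *)
Let YS_sub n v : Y n.+2 v - Y n.+1 v =
  2^-1%:C *: (Y n.+1 (Y n.+1 v - Y n v) + Y n (Y n.+1 v - Y n v)).
Proof.
rewrite [Y n.+2 v]/(_ *: (_ + Y n.+1 (Y n.+1 v))).
rewrite [X in _ - X = _]/(_ *: (_ + Y n (Y n v))) -scalerBr; congr (_ *: _).
by rewrite opprD addrACA subrr add0r !YB (YY n.+1 n) addrA subrK.
Qed.

Let YS_le n v : nn (Y n.+1 v - Y n v) <= (y n.+1 - y n) * nn v.
Proof.
elim: n v => [|n ih] v.
  have := Y_le 1 v; rewrite [Y 0 v]/(0 : V) [y 0]/(0 : R) !subr0; exact.
have /andP[y0 y1] := rn_real_itv R n.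
have /andP[z0 z1] := rn_real_itv R n.+1.
rewrite YS_sub nnZ ger0_norm ?invr_ge0// [y n.+2]/((1 + y n.+1 ^+ 2) / 2).
apply: (@le_trans _ _ (2^-1 * ((y n.+1 + y n) * ((y n.+1 - y n) * nn v)))).
  rewrite ler_pM2l ?invr_gt0// (le_trans (nnD _ _))// mulrDl.
  by apply: lerD; rewrite (le_trans (Y_le _ _))// ler_wpM2l.
have h : y n.+1 = (1 + y n ^+ 2) / 2 by [].
have -> : (1 + y n.+1 ^+ 2) / 2 - y n.+1 = 2^-1 * (y n.+1 ^+ 2 - y n ^+ 2) by lra.
by rewrite le_eqVlt; apply/orP; left; apply/eqP; ring.
Qed.

Let Y_sub_le m n v : (m <= n)%N -> nn (Y n v - Y m v) <= (y n - y m) * nn v.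
Proof.
move=> /subnK <-; elim: (n - m)%N => [|k ih].
  by rewrite add0n !subrr /sip_norm (sip0 rZ) sqrtr0 mul0r.
rewrite addSn -(subrK (Y (k + m) v) (Y _.+1 v)) -addrA (le_trans (nnD _ _))//.
by rewrite (le_trans (lerD (YS_le _ _) ih))// -mulrDl addrA subrK.
Qed.

Lemma rn_cut_sub_le m n v :
  nn (rn_cut s T m v - rn_cut s T n v) <= s * `|y m - y n| * nn v.
Proof.
have -> : rn_cut s T m v - rn_cut s T n v = s%:C *: (Y n v - Y m v).
  rewrite /rn_cut /rn_abs; move: (Q v) (Y m v) (Y n v) => q a b.
  by rewrite opprB addrA subrK -scalerBr opprB addrC addrA subrK.
rewrite nnZ gtr0_norm// -mulrA ler_pM2l//.
have [nm|mn] := leqP n m.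
  by rewrite nnB (le_trans (Y_sub_le _ nm))// ler_wpM2r// ler_norm.
by rewrite (le_trans (Y_sub_le _ (ltnW mn)))// ler_wpM2r// distrC ler_norm.
Qed.

Let abs_ge0 n v : 0 <= r (rn_abs s T n v) v.
Proof.
rewrite rZ; apply: mulr_ge0; first exact: ltW.
rewrite rB subr_ge0 (le_trans (CS _ _))//.
have /andP[y0 y1] := rn_real_itv R n.
rewrite -nn2 expr2 ler_wpM2r// (le_trans (Y_le _ _))//.
by rewrite -[leRHS]mul1r ler_wpM2r.
Qed.

(** The recursion gives [Y_n^2 = 2 Y_{n+1} - X]. Substituting it in [s^2 (1 - Y_n)^2] cancels all
    but [Q^2] and an increment: the error of the approximate square root is exactly an increment of
    the iteration. *)
Let abs_sq n v : rn_abs s T n (rn_abs s T n v) - Q (Q v) =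
  (2 * s ^+ 2)%:C *: (Y n.+1 v - Y n v).
Proof.
have s2 : s ^+ 2 != 0 by rewrite expf_neq0// gt_eqF.
rewrite /rn_abs /= YZ -scalerBr scalerA YB /rn_base.
move: (Q (Q v)) (Y n v) (Y n (Y n v)) => q a b.
have -> : v - a - (a - b) = v - a *+ 2 + b.
  by rewrite opprB mulr2n opprD !addrA addrAC.
have -> : s%:C * s%:C = (s ^+ 2)%:C by rewrite -rmorphM.
have -> : (2 * s ^+ 2)%:C = (s ^+ 2)%:C * 2 by rewrite mulrC rmorphM/= rmorph_nat.
have -> : 2^-1%:C = 2^-1 :> R[i] by rewrite fmorphV/= rmorph_nat.
rewrite -scalerA scalerBr [2 *: (2^-1 *: _)]scalerA divff ?pnatr_eq0// scale1r.
have q' : q = (s ^+ 2)%:C *: ((s ^- 2)%:C *: q).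
  by rewrite scalerA -rmorphM/= divff// scale1r.
rewrite scaler_nat {1}q' -scalerBr; congr (_ *: _).
by rewrite [LHS]addrAC [X in X + _]addrAC [LHS]addrAC.
Qed.

(** Let [A] be [rn_abs n]. Then [(A + Q)(A - Q) = A^2 - Q^2] is a multiple of an increment by
    [abs_sq], while [A >= 0] and [Q >= 1 - M > 0] bound [A + Q] below by [1 - M]. Hence [A - Q]
    itself is small. *)
Lemma rn_cut_le n v : M < 1 ->
  nn (rn_cut s T n v) <= 2 * s ^+ 2 / (1 - M) * (y n.+1 - y n) * nn v.
Proof.
move=> M1; set w := rn_cut s T n v; have d0 : 0 < 1 - M by rewrite subr_gt0.
have [w0|w0] := eqVneq (nn w) 0.
  have c0 : 0 <= 2 * s ^+ 2 / (1 - M).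
    by apply: divr_ge0; [rewrite mulr_ge0// sqr_ge0|exact: ltW].
  by rewrite w0; do 2 apply: mulr_ge0 => //; rewrite subr_ge0 rn_real_leS.
have wp : 0 < nn w by rewrite lt_neqAle eq_sym w0 nn0.
have Qw : (1 - M) * r w w <= r (Q w) w by exact: Q_ge.
have wE : rn_abs s T n w + Q w = (2 * s ^+ 2)%:C *: (Y n.+1 v - Y n v).
  rewrite -abs_sq /w /rn_cut QB.
  have -> : rn_abs s T n (rn_abs s T n v - Q v) =
      rn_abs s T n (rn_abs s T n v) - rn_abs s T n (Q v).
    rewrite {1 2 4}/rn_abs -scalerBr YB; congr (_ *: _).
    by rewrite !opprD !opprK addrACA.
  have -> : Q (rn_abs s T n v) = rn_abs s T n (Q v) by rewrite /rn_abs QZ QB QY.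
  by rewrite addrA subrK.
have : r (rn_abs s T n w + Q w) w <= nn (rn_abs s T n w + Q w) * nn w by exact: CS.
have := abs_ge0 n w; rewrite rD wE nnZ.
have : nn (Y n.+1 v - Y n v) <= (y n.+1 - y n) * nn v by exact: YS_le.
have s2 : 0 <= 2 * s ^+ 2 by rewrite mulr_ge0// sqr_ge0.
rewrite (ger0_norm s2); move: Qw; rewrite -nn2.
set q := r (Q w) w; set A := nn (Y n.+1 v - Y n v) => h1 h2 h3 h4.
have h5 : (1 - M) * nn w ^+ 2 <= 2 * s ^+ 2 * A * nn w by lra.
have h6 : (1 - M) * nn w <= 2 * s ^+ 2 * A.
  by rewrite -(ler_pM2r wp) (le_trans _ h5)// expr2 mulrA.
have h7 : (1 - M) * nn w <= 2 * s ^+ 2 * ((y n.+1 - y n) * nn v).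
  by rewrite (le_trans h6)// ler_wpM2l.
rewrite -(ler_pM2l d0) (le_trans h7)// le_eqVlt; apply/orP; left; apply/eqP.
by field; rewrite gt_eqF.
Qed.

Lemma rn_cut_TT_sub_le m n v :
  nn (rn_cut s T m (T (T v)) - rn_cut s T n (T (T v))) <=
    s * M ^+ 2 * `|y m - y n| * nn v.
Proof.
apply: (le_trans (rn_cut_sub_le _ _ _)).
have h : nn (T (T v)) <= M ^+ 2 * nn v.
  by rewrite (le_trans (gram_norm_le _))// expr2 -mulrA ler_wpM2l// gram_norm_le.
have -> : s * M ^+ 2 * `|y m - y n| * nn v = s * `|y m - y n| * (M ^+ 2 * nn v).
  by ring.
by apply: ler_wpM2l h; rewrite mulr_ge0// ltW.
Qed.

(** Pairing the cut of [T (T v)] with [v] gives [r (A (T v)) (T v) - r (Q (T v)) (T v)] with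
    [A >= 0]. In the limit [Q >= 0] on the range of [T], that is [|S (T v)| <= |T v|]. Then
    [|T v|^2 = r (S v) (S (T v))] yields [|T v| <= |S v|], and [|S v|^2 = r (T v) v] yields the
    claim. *)
Lemma contraction_of_rn_cut_cvg0 :
  (forall v, nn (rn_cut s T n (T (T v))) @[n --> \oo] --> (0 : R)) ->
  forall v, nn (S v) <= nn v.
Proof.
move=> cvg0.
have TQT v : 0 <= r (Q (T v)) (T v).
  rewrite leNgt; apply/negP => neg.
  (* The [+ 1] keeps the denominator positive when [|v| = 0]. *)
  have e0 : 0 < - r (Q (T v)) (T v) / (nn v + 1).
    by rewrite divr_gt0 ?oppr_gt0// ltr_wpDl.
  have /cvgr0Pnorm_lt /(_ _ e0) [n _ /(_ n (leqnn n))] := cvg0 v.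
  rewrite ger0_norm// ltr_pdivlMr ?ltr_wpDl// => lt.
  have := CS (rn_cut s T n (T (T v))) v.
  have -> : r (rn_cut s T n (T (T v))) v =
      r (rn_abs s T n (T v)) (T v) - r (Q (T v)) (T v).
    rewrite /rn_cut rB -TQ T_adj; congr (_ - _).
    by rewrite -T_adj /rn_abs TZ TB TY.
  by have := abs_ge0 n (T v); have := nn0 (rn_cut s T n (T (T v))); nra.
move=> v.
have h1 : r (S (T v)) (S (T v)) <= r (T v) (T v).
  by have := TQT v; rewrite /rn_comp rB T_ge0 subr_ge0.
have h2 : r (T v) (T v) <= nn (S v) * nn (T v).
  rewrite {1}TE adj' (le_trans (CS _ _))// ler_wpM2l//.
  by rewrite nnle// nn2.
have h3 : r (S v) (S v) <= nn (T v) * nn v by rewrite -T_ge0.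
have {h1}h2 : nn (T v) <= nn (S v).
  have [->//|z] := eqVneq (nn (T v)) 0.
  have zp : 0 < nn (T v) by rewrite lt_neqAle eq_sym z nn0.
  by rewrite -(ler_pM2r zp) -expr2 nn2.
have [->//|z] := eqVneq (nn (S v)) 0.
have zp : 0 < nn (S v) by rewrite lt_neqAle eq_sym z nn0.
rewrite -(ler_pM2l zp) -expr2 nn2 (le_trans h3)// ler_wpM2r//.
Qed.

End contraction.

(** * Square-summable families *)

Section modulus.
Context (R : realType).
Implicit Types z w : R[i].

Definition cabs z : R := complex.Re `|z|.

Lemma normcE z : `|z| = (cabs z)%:C.
Proof. by rewrite /cabs RRe_real// ger0_real. Qed.

Lemma cabs_ge0 z : 0 <= cabs z.
Proof. by rewrite -ler0c -normcE. Qed.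

Lemma cabsM z w : cabs (z * w) = cabs z * cabs w.
Proof. by apply: complexI; rewrite -normcE normrM !normcE -rmorphM. Qed.

Lemma cabs0 : cabs 0 = 0.
Proof. by rewrite /cabs normr0. Qed.

Lemma cabs0_eq0 z : cabs z = 0 -> z = 0.
Proof. by move=> z0; apply/normr0_eq0; rewrite normcE z0. Qed.

Lemma cabs_real (a : R) : cabs a%:C = `|a|.
Proof. by rewrite /cabs normc_def/= expr0n addr0 sqrtr_sqr. Qed.

Lemma cabs_conj z : cabs z^* = cabs z.
Proof. by rewrite /cabs norm_conjC. Qed.

Lemma cabs_sq z : cabs z ^+ 2 = complex.Re z ^+ 2 + complex.Im z ^+ 2.
Proof. by apply: complexI; rewrite rmorphXn/= -normcE add_Re2_Im2. Qed.

Lemma mulcc_conj z : z * z^* = (cabs z ^+ 2)%:C.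
Proof. by rewrite -normCK normcE rmorphXn. Qed.

Lemma ReD z w : complex.Re (z + w) = complex.Re z + complex.Re w.
Proof. by case: z; case: w. Qed.
Lemma ImD z w : complex.Im (z + w) = complex.Im z + complex.Im w.
Proof. by case: z; case: w. Qed.
Lemma ReM z w : complex.Re (z * w) =
  complex.Re z * complex.Re w - complex.Im z * complex.Im w.
Proof. by case: z; case: w. Qed.
Lemma ImM z w : complex.Im (z * w) =
  complex.Re z * complex.Im w + complex.Im z * complex.Re w.
Proof. by case: z; case: w. Qed.
Lemma ReN z : complex.Re (- z) = - complex.Re z.
Proof. by case: z. Qed.
Lemma ImN z : complex.Im (- z) = - complex.Im z.
Proof. by case: z. Qed.
Lemma Re_conj z : complex.Re z^* = complex.Re z.
Proof. by case: z. Qed.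
Lemma Im_conj z : complex.Im z^* = - complex.Im z.
Proof. by case: z. Qed.
Lemma ReZ (a : R) z : complex.Re (a%:C * z) = a * complex.Re z.
Proof. by rewrite ReM/= mul0r subr0. Qed.
Lemma complex_eq z w :
  complex.Re z = complex.Re w -> complex.Im z = complex.Im w -> z = w.
Proof. by case: z w => [a b] [c d] /= -> ->. Qed.

Lemma cabs2D_le z w : cabs (z + w) ^+ 2 <= 2 * cabs z ^+ 2 + 2 * cabs w ^+ 2.
Proof.
rewrite !cabs_sq ReD ImD.
have := sqr_ge0 (complex.Re z - complex.Re w).
have := sqr_ge0 (complex.Im z - complex.Im w); nra.
Qed.

Lemma Re_le_cabs z : `|complex.Re z| <= cabs z.
Proof. by rewrite -lecR -normcE normc_ge_Re. Qed.
Lemma Im_le_cabs z : `|complex.Im z| <= cabs z.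
Proof.
rewrite -(@ler_pXn2r _ 2)// ?nnegrE ?cabs_ge0// cabs_sq real_normK ?num_real//.
by rewrite lerDr sqr_ge0.
Qed.

End modulus.

Section unordered_sum.
Context (R : realType) (I : choiceType).
Implicit Types (g h p q : I -> R) (a : I -> \bar R) (D : set I).

(** One inequality, proved for all scalars, gives the other when applied to [c^-1]. *)
Lemma esumZl D (c : R) a : 0 <= c -> (forall i, 0 <= a i)%E ->
  (\esum_(i in D) (c%:E * a i) = c%:E * \esum_(i in D) a i)%E.
Proof.
move=> c0 a0.
have le (d : R) (b : I -> \bar R) : 0 <= d -> (forall i, 0 <= b i)%E ->
    (\esum_(i in D) (d%:E * b i) <= d%:E * \esum_(i in D) b i)%E.
  move=> d0 b0; apply: ge_ereal_sup => _ [F [fF FD] <-].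
  rewrite -ge0_mule_fsumr// lee_wpmul2l ?lee_fin//.
  by apply: ereal_sup_ubound; exists F.
apply/eqP; rewrite eq_le le//=.
have [->|cn0] := eqVneq c 0; first by rewrite mul0e esum_ge0// => i _; rewrite mul0e.
have cp : 0 < c by rewrite lt_neqAle eq_sym cn0.
have e : (\esum_(i in D) a i = \esum_(i in D) (c^-1%:E * (c%:E * a i)))%E.
  by apply: eq_esum => i _; rewrite muleA -EFinM mulVf// mul1e.
rewrite -lee_pdivlMl// e; apply: le; first by rewrite invr_ge0.
by move=> i; rewrite mule_ge0.
Qed.

Lemma esum_term_le D a i : D i -> (forall j, 0 <= a j)%E ->
  (a i <= \esum_(j in D) a j)%E.
Proof.
move=> Di a0; rewrite -(@esum_set1 _ _ i a)//.
apply: le_ereal_sup => _ [F [fF Fi] <-]; exists F => //; split => // j /Fi ->.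
by [].
Qed.

Definition usum g : \bar R := \esum_(i in [set: I]) (g i)%:E.

Lemma usum_ge0 g : (forall i, 0 <= g i) -> (0 <= usum g)%E.
Proof. by move=> g0; apply: esum_ge0 => i _; rewrite lee_fin. Qed.

Lemma usumD p q : (forall i, 0 <= p i) -> (forall i, 0 <= q i) ->
  usum (p \+ q) = (usum p + usum q)%E.
Proof.
by move=> p0 q0; rewrite /usum -esumD// => i _; rewrite lee_fin.
Qed.

Lemma usumZ c p : 0 <= c -> (forall i, 0 <= p i) ->
  usum (fun i => c * p i) = (c%:E * usum p)%E.
Proof.
by move=> c0 p0; rewrite /usum -esumZl.
Qed.

Lemma le_usum p q : (forall i, p i <= q i) -> (usum p <= usum q)%E.
Proof. by move=> pq; apply: le_esum => i _; rewrite lee_fin. Qed.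

Definition usummable g := (usum (fun i => `|g i|%R) < +oo)%E.

Lemma usummable_le g p : (forall i, `|g i| <= p i) -> (usum p < +oo)%E ->
  usummable g.
Proof. by move=> gp; apply: le_lt_trans; exact: le_usum. Qed.

Lemma usum_fin g : (forall i, 0 <= g i) -> (usum g < +oo)%E ->
  usum g = (fine (usum g))%:E.
Proof. by move=> g0 goo; rewrite fineK// ge0_fin_numE// usum_ge0. Qed.

(** Meaningful for [usummable] families: [fine] replaces an infinite positive or negative part by
    0. *)
Definition rsum g : R := fine (usum (fun i => Num.max (g i) 0)) -
  fine (usum (fun i => Num.max (- g i) 0)).

(** The sum does not depend on the decomposition: if [u] and [v] are the positive and negative parts
    of [p - q], then [u + q = v + p], and sums of nonnegative families are additive. Linearity of
    [rsum] follows from this freedom. *)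
Lemma rsum_sub p q : (forall i, 0 <= p i) -> (forall i, 0 <= q i) ->
  (usum p < +oo)%E -> (usum q < +oo)%E ->
  rsum (p \- q) = fine (usum p) - fine (usum q).
Proof.
move=> p0 q0 poo qoo; rewrite /rsum.
set u := fun i => Num.max ((p \- q) i) 0.
set v := fun i => Num.max (- ((p \- q) i)) 0.
have u0 i : 0 <= u i by rewrite le_max lexx orbT.
have v0 i : 0 <= v i by rewrite le_max lexx orbT.
have uoo : (usum u < +oo)%E.
  apply: le_lt_trans poo; apply: le_usum => i.
  by rewrite ge_max p0 andbT lerBlDr lerDl.
have voo : (usum v < +oo)%E.
  apply: le_lt_trans qoo; apply: le_usum => i.
  by rewrite ge_max q0 andbT /= opprB lerBlDr lerDl.
have : usum (u \+ q) = usum (v \+ p).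
  congr usum; apply/funext => i; rewrite /u /v /= opprB.
  by have [] := ltP (p i - q i) 0; have [] := ltP (q i - p i) 0; lra.
rewrite !usumD// (usum_fin u0)// (usum_fin v0)// (usum_fin p0)// (usum_fin q0)//.
move: (fine (usum u)) (fine (usum v)) (fine (usum p)) (fine (usum q)) => a b c d.
by rewrite -!EFinD => -[abcd] /=; lra.
Qed.

Lemma rsumE g : usummable g ->
  exists p q, [/\ g = p \- q, forall i, 0 <= p i, forall i, 0 <= q i,
    (usum p < +oo)%E & (usum q < +oo)%E].
Proof.
move=> goo; exists (fun i => Num.max (g i) 0), (fun i => Num.max (- g i) 0).
split=> [|i|i||]; rewrite ?le_max ?lexx ?orbT//.
- by apply/funext => i /=; have [] := ltP (g i) 0; have [] := ltP (- g i) 0; lra.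
- apply: le_lt_trans goo; apply: le_usum => i.
  by rewrite ge_max normr_ge0 ler_norm.
- apply: le_lt_trans goo; apply: le_usum => i.
  by rewrite ge_max normr_ge0 -normrN ler_norm.
Qed.

Lemma rsum_ge0E g : (forall i, 0 <= g i) -> (usum g < +oo)%E ->
  rsum g = fine (usum g).
Proof.
move=> g0 goo; have z0 : usum (fun=> 0 : R) = 0%E by apply: esum1.
have := @rsum_sub g (fun=> 0) g0; rewrite z0 => /(_ (fun=> lexx _) goo).
rewrite (_ : g \- _ = g) ?subr0; last by apply/funext => i /=; rewrite subr0.
by apply; exact: ltry.
Qed.

Lemma rsumD g h : usummable g -> usummable h ->
  rsum (g \+ h) = rsum g + rsum h.
Proof.
move=> /rsumE[p [q [-> p0 q0 poo qoo]]] /rsumE[p' [q' [-> p'0 q'0 p'oo q'oo]]].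
rewrite (_ : _ \+ _ = (p \+ p') \- (q \+ q')); last first.
  by apply/funext => i /=; rewrite opprD addrACA.
have D0 (f f' : I -> R) : (forall i, 0 <= f i) -> (forall i, 0 <= f' i) ->
  forall i, 0 <= (f \+ f') i by move=> ? ? i; exact: addr_ge0.
rewrite !rsum_sub//; do ?exact: D0; rewrite ?usumD// ?lte_add_pinfty//.
rewrite (usum_fin p0)// (usum_fin p'0)// (usum_fin q0)// (usum_fin q'0)//=.
by rewrite opprD addrACA.
Qed.

Lemma rsumN g : usummable g -> rsum (\- g) = - rsum g.
Proof.
move=> /rsumE[p [q [-> p0 q0 poo qoo]]].
rewrite (_ : \- _ = q \- p); last by apply/funext => i /=; rewrite opprB.
by rewrite !rsum_sub// opprB.
Qed.

Lemma usummableZ c g : usummable g -> usummable (fun i => c * g i).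
Proof.
move=> goo; rewrite /usummable.
under [X in usum X]eq_fun do rewrite normrM.
rewrite usumZ//.
rewrite (usum_fin (fun i => normr_ge0 (g i)))// -EFinM; exact: ltry.
Qed.

Lemma usummableD g h : usummable g -> usummable h -> usummable (g \+ h).
Proof.
move=> goo hoo; apply: (@usummable_le _ (fun i => `|g i| + `|h i|)) => [i|].
  exact: ler_normD.
by rewrite (usumD (fun i => normr_ge0 (g i)) (fun i => normr_ge0 (h i))) lte_add_pinfty.
Qed.

Lemma rsumZ c g : usummable g -> rsum (fun i => c * g i) = c * rsum g.
Proof.
have pos d h : 0 <= d -> usummable h -> rsum (fun i => d * h i) = d * rsum h.
  move=> d0 /rsumE[p [q [-> p0 q0 poo qoo]]].
  have dp i : 0 <= d * p i by exact: mulr_ge0.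
  have dq i : 0 <= d * q i by exact: mulr_ge0.
  have oo f : (forall i, 0 <= f i) -> (usum f < +oo)%E -> (d%:E * usum f < +oo)%E.
    by move=> f0 foo; rewrite usum_fin// -EFinM ltry.
  rewrite (_ : (fun i => _) = (fun i => d * p i) \- (fun i => d * q i)).
    rewrite !rsum_sub// ?usumZ// ?oo//.
    by rewrite (usum_fin p0)// (usum_fin q0)//= mulrBr.
  by apply/funext => i /=; rewrite mulrBr.
move=> goo; have [c0|c0] := leP 0 c; first exact: pos.
have -> : (fun i => c * g i) = \- (fun i => - c * g i).
  by apply/funext => i /=; rewrite mulNr opprK.
rewrite rsumN ?pos ?oppr_ge0 ?ltW// ?mulNr ?opprK//.
exact: usummableZ.
Qed.

End unordered_sum.

Section ell2_space.
Context (R : realType) (I : choiceType).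
Implicit Types (u v w : I -> R[i]).

Definition sqsum u : \bar R := usum (fun i => cabs (u i) ^+ 2).

Lemma sqsum_ge0 u : (0 <= sqsum u)%E.
Proof. by apply: usum_ge0 => i; exact: sqr_ge0. Qed.

Definition sqsummable : {pred I -> R[i]} := fun u => `[< (sqsum u < +oo)%E >].

Lemma sqsummableP u : reflect (sqsum u < +oo)%E (u \in sqsummable).
Proof. exact: asboolP. Qed.

Lemma sqsumZ (a : R[i]) u :
  sqsum (fun i => a * u i) = ((cabs a ^+ 2)%:E * sqsum u)%E.
Proof.
rewrite /sqsum -usumZ ?sqr_ge0// => [|i]; last exact: sqr_ge0.
by congr usum; apply/funext => i; rewrite cabsM exprMn.
Qed.

Lemma sqsumD_le u v :
  (sqsum (fun i => (u i + v i)%R) <= 2%:E * sqsum u + 2%:E * sqsum v)%E.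
Proof.
have sq w i : 0 <= cabs (w i) ^+ 2 by exact: sqr_ge0.
have sq2 w i : 0 <= 2 * cabs (w i) ^+ 2 by exact: mulr_ge0.
rewrite /sqsum -(usumZ _ (sq u))// -(usumZ _ (sq v))// -(usumD (sq2 u) (sq2 v)).
by apply: le_usum => i; exact: cabs2D_le.
Qed.

Lemma sqsummable_submod : submod_closed sqsummable.
Proof.
have fin a u : u \in sqsummable -> (a%:E * sqsum u < +oo)%E.
  move=> /sqsummableP uoo; rewrite -[sqsum u]fineK ?ge0_fin_numE ?sqsum_ge0//.
  by rewrite -EFinM ltry.
split=> [|a u v uoo voo]; apply/sqsummableP.
  rewrite [X in (X < _)%E](_ : _ = 0%E) ?ltry//.
  by apply: esum1 => i _; rewrite cabs0 expr0n.
apply: le_lt_trans (sqsumD_le _ _) _.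
by rewrite sqsumZ lte_add_pinfty// ?fin// muleA -EFinM fin.
Qed.

HB.instance Definition _ :=
  GRing.isSubmodClosed.Build _ _ sqsummable sqsummable_submod.

Record ell2_of : Type := Ell2 {
  ell2_val :> I -> R[i];
  ell2_valP : ell2_val \in sqsummable }.

HB.instance Definition _ := [isSub for ell2_val].
HB.instance Definition _ := [Choice of ell2_of by <:].
HB.instance Definition _ := [SubChoice_isSubLmodule of ell2_of by <:].

Implicit Types (x y z : ell2_of).

Lemma ell2_addE x y i : (x + y) i = x i + y i. Proof. by []. Qed.
Lemma ell2_scaleE a x i : (a *: x) i = a * x i. Proof. by []. Qed.

Lemma ell2_eq x y : (forall i, x i = y i) -> x = y.
Proof. by move=> xy; apply/val_inj/funext. Qed.

Lemma ell2_fin x : (sqsum x < +oo)%E.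
Proof. exact/sqsummableP/ell2_valP. Qed.

Definition ell2_sq x : R := fine (sqsum x).

Lemma ell2_sqE x : sqsum x = (ell2_sq x)%:E.
Proof. by rewrite fineK// ge0_fin_numE ?ell2_fin// sqsum_ge0. Qed.

Lemma ell2_sq_ge0 x : 0 <= ell2_sq x.
Proof. by rewrite fine_ge0// sqsum_ge0. Qed.

Lemma ell2_sq_ge x i : cabs (x i) ^+ 2 <= ell2_sq x.
Proof.
rewrite -lee_fin -ell2_sqE; apply: (esum_term_le (a := fun i => (cabs (x i) ^+ 2)%:E)) => //.
by move=> j; rewrite lee_fin sqr_ge0.
Qed.

Lemma ell2_sqZ a x : ell2_sq (a *: x) = cabs a ^+ 2 * ell2_sq x.
Proof.
apply: EFin_inj; rewrite EFinM -!ell2_sqE -sqsumZ.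
by congr sqsum.
Qed.

Lemma ell2_sq0 x : ell2_sq x = 0 -> x = 0.
Proof.
move=> x0; apply: ell2_eq => i; apply: cabs0_eq0; apply/eqP.
by rewrite -sqrf_eq0 eq_le sqr_ge0 andbT -x0 ell2_sq_ge.
Qed.

Definition ell2_dot_re x y : R := rsum (fun i => complex.Re (x i * (y i)^*)).
Definition ell2_dot_im x y : R := rsum (fun i => complex.Im (x i * (y i)^*)).
Definition ell2_dot x y : R[i] := Complex (ell2_dot_re x y) (ell2_dot_im x y).

Let prod_oo x y : (usum (fun i => cabs (x i) ^+ 2 + cabs (y i) ^+ 2)%R < +oo)%E.
Proof.
rewrite (@usumD _ _ (fun i => cabs (x i) ^+ 2) (fun i => cabs (y i) ^+ 2)).
- by rewrite lte_add_pinfty// ell2_fin.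
- by move=> i; exact: sqr_ge0.
- by move=> i; exact: sqr_ge0.
Qed.

Let cabs_prod x y i : cabs (x i * (y i)^*) <= cabs (x i) ^+ 2 + cabs (y i) ^+ 2.
Proof.
rewrite cabsM cabs_conj.
by have := cabs_ge0 (x i); have := cabs_ge0 (y i); nra.
Qed.

Lemma ell2_usummable_re x y : usummable (fun i => complex.Re (x i * (y i)^*)).
Proof.
apply: usummable_le (prod_oo x y) => i.
exact: le_trans (Re_le_cabs _) (cabs_prod _ _ _).
Qed.

Lemma ell2_usummable_im x y : usummable (fun i => complex.Im (x i * (y i)^*)).
Proof.
apply: usummable_le (prod_oo x y) => i.
exact: le_trans (Im_le_cabs _) (cabs_prod _ _ _).
Qed.

Let hre := ell2_usummable_re.
Let him := ell2_usummable_im.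

Lemma ell2_dot_linearl y a x x' :
  ell2_dot (a *: x + x') y = a * ell2_dot x y + ell2_dot x' y.
Proof.
have N1 := usummableZ (complex.Re a) (hre x y).
have N2 := usummableZ (- complex.Im a) (him x y).
have N3 := usummableZ (complex.Re a) (him x y).
have N4 := usummableZ (complex.Im a) (hre x y).
apply: complex_eq; rewrite ?ReD ?ImD ?ReM ?ImM/= /ell2_dot_re /ell2_dot_im.
  rewrite -mulNr -(rsumZ _ (hre x y)) -(rsumZ _ (him x y)).
  rewrite -(rsumD N1 N2) -(rsumD (usummableD N1 N2) (hre x' y)).
  congr rsum; apply/funext => i.
  by rewrite ell2_addE ell2_scaleE mulrDl -mulrA ReD ReM /= mulNr.
rewrite -(rsumZ _ (hre x y)) -(rsumZ _ (him x y)).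
rewrite -(rsumD N3 N4) -(rsumD (usummableD N3 N4) (him x' y)).
congr rsum; apply/funext => i.
by rewrite ell2_addE ell2_scaleE mulrDl -mulrA ImD ImM.
Qed.

Lemma ell2_dotC x y : ell2_dot x y = (ell2_dot y x)^*.
Proof.
have e i : x i * (y i)^* = (y i * (x i)^*)^* by rewrite rmorphM/= conjCK mulrC.
apply: complex_eq; rewrite ?Re_conj ?Im_conj/=.
  by congr rsum; apply/funext => i; rewrite e Re_conj.
by rewrite -rsumN//; congr rsum; apply/funext => i /=; rewrite e Im_conj.
Qed.

Lemma ell2_dot_self x : ell2_dot x x = (ell2_sq x)%:C.
Proof.
apply: complex_eq => /=.
  have sq i : 0 <= cabs (x i) ^+ 2 by exact: sqr_ge0.
  rewrite /ell2_dot_re /ell2_sq /sqsum -(rsum_ge0E sq (ell2_fin x)).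
  by congr rsum; apply/funext => i; rewrite mulcc_conj.
rewrite /ell2_dot_im (_ : (fun _ => _) = (fun=> 0)); last first.
  by apply/funext => i; rewrite mulcc_conj.
by rewrite rsum_ge0E// /usum esum1//.
Qed.

End ell2_space.

Section ell2_normed.
Context (R : realType) (I : choiceType).
Implicit Types (x y z : ell2_of R I).

Let r x y := complex.Re (ell2_dot x y).

Let rD u v w : r (u + v) w = r u w + r v w.
Proof. by rewrite /r -[u]scale1r ell2_dot_linearl mul1r ReD scale1r. Qed.
Let dot0 w : ell2_dot (0 : ell2_of R I) w = 0.
Proof.
have := ell2_dot_linearl w 1 0 0; rewrite scale1r mul1r addr0 => h.
by apply: (addrI (ell2_dot 0 w)); rewrite -h addr0.
Qed.
Let rZ (a : R) u w : r (a%:C *: u) w = a * r u w.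
Proof. by rewrite /r -[_ *: u]addr0 ell2_dot_linearl ReD ReZ dot0 addr0. Qed.
Let rC u v : r u v = r v u.
Proof. by rewrite /r ell2_dotC Re_conj. Qed.
Let rr v : r v v = ell2_sq v. Proof. by rewrite /r ell2_dot_self. Qed.
Let r_ge0 v : 0 <= r v v. Proof. by rewrite rr ell2_sq_ge0. Qed.

Definition ell2_normr x : R := Num.sqrt (ell2_sq x).

Let norm_sip x : ell2_normr x = sip_norm r x.
Proof. by rewrite /sip_norm rr. Qed.

Let normD x y : (ell2_normr (x + y))%:C <= (ell2_normr x)%:C + (ell2_normr y)%:C.
Proof. by rewrite -rmorphD/= lecR !norm_sip sip_normD. Qed.

Let normZ (a : R[i]) x : (ell2_normr (a *: x))%:C = `|a| * (ell2_normr x)%:C.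
Proof.
by rewrite normcE -rmorphM/= /ell2_normr ell2_sqZ sqrtrM ?sqr_ge0// sqrtr_sqr ger0_norm ?cabs_ge0.
Qed.

Let norm0 x : (ell2_normr x)%:C = 0 -> x = 0.
Proof.
move/complexI/eqP; rewrite sqrtr_eq0 => x0; apply: ell2_sq0; apply/eqP.
by rewrite eq_le x0 ell2_sq_ge0.
Qed.

HB.instance Definition _ :=
  Lmodule_isNormed.Build R[i] (ell2_of R I) normD normZ norm0.

Lemma ell2_normE x : `|x| = (ell2_normr x)%:C. Proof. by []. Qed.

Lemma ell2_normr_sq x : ell2_normr x ^+ 2 = ell2_sq x.
Proof. by rewrite sqr_sqrtr ?ell2_sq_ge0. Qed.

Lemma ell2_coord_le x i : cabs (x i) <= ell2_normr x.
Proof.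
rewrite -(@ler_pXn2r _ 2) ?nnegrE ?cabs_ge0 ?sqrtr_ge0//.
by rewrite ell2_normr_sq ell2_sq_ge.
Qed.

(** The limit [w] is taken coordinatewise, the coordinates being 1-Lipschitz. The estimate [key]
    then serves twice: it shows that [w] is square-summable, as a difference of two square-summable
    families, and that the filter converges to [w] in norm. *)
Lemma ell2_complete (F : set_system (ell2_of R I)) :
  ProperFilter F -> cauchy F -> cvg F.
Proof.
move=> PF /cauchyP cF.
have {}cF (e : R) : 0 < e -> exists x0, \forall x \near F, ell2_normr (x0 - x) < e.
  rewrite -ltcR => /cF[x0 h]; exists x0; apply: filterS h => x.
  by rewrite -ball_normE /= ell2_normE ltcR.
have cvgi (h : R[i] -> R) (i : I) : (forall a b, h (a - b) = h a - h b) ->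
    (forall a, `|h a| <= cabs a) ->
    cvg ((fun x : ell2_of R I => h (x i)) @ F).
  move=> hB hle; apply: cauchy_cvg; apply: cauchy_exP => e e0.
  have [x0 hx0] := cF e e0; exists (h (x0 i)).
  apply: filterS hx0 => x hx; rewrite -ball_normE /= -hB.
  apply: le_lt_trans hx; apply: le_trans (hle _) _.
  exact: (ell2_coord_le (x0 - x)).
pose wr i := lim ((fun x : ell2_of R I => complex.Re (x i)) @ F).
pose wi i := lim ((fun x : ell2_of R I => complex.Im (x i)) @ F).
have cr i : (fun x : ell2_of R I => complex.Re (x i)) @ F --> wr i.
  by apply: cvgi (@Re_le_cabs R) => a b; rewrite ReD ReN.
have ci i : (fun x : ell2_of R I => complex.Im (x i)) @ F --> wi i.
  by apply: cvgi (@Im_le_cabs R) => a b; rewrite ImD ImN.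
pose w i : R[i] := Complex (wr i : R) (wi i : R).
have cvg_sq (f : ell2_of R I -> R) (l : R) : f @ F --> l ->
    (fun x => f x ^+ 2) @ F --> l ^+ 2.
  by move=> fl; rewrite expr2; under eq_fun do rewrite expr2; exact: cvgM.
(* Finite partial sums pass to the limit along the filter; the supremum over them is taken
   afterwards. *)
have key (e : R) x0 : 0 < e -> (\forall x \near F, ell2_normr (x0 - x) < e) ->
    (sqsum (fun i => x0 i - w i)%R <= (e ^+ 2)%:E)%E.
  move=> e0 hx0; apply: ge_ereal_sup => _ [A [fA _] <-].
  have AE (g : I -> R) : (\sum_(i \in A) (g i)%:E)%E = (\sum_(i <- fset_set A) g i)%:E.
    by rewrite fsbig_finite// sumEFin.
  rewrite AE lee_fin.
  have : (fun x : ell2_of R I => \sum_(i <- fset_set A) cabs (x0 i - x i) ^+ 2) @ F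
      --> \sum_(i <- fset_set A) cabs (x0 i - w i) ^+ 2.
    apply: cvg_big => [|i _]; first exact: add_continuous.
    under [X in X @ _]eq_fun do rewrite cabs_sq ReD ReN ImD ImN.
    rewrite cabs_sq ReD ReN ImD ImN.
    apply: cvgD; apply: cvg_sq; apply: cvgB; do ?exact: cvg_cst.
      exact: cr.
    exact: ci.
  move=> /cvgr_to_le; apply; apply: filterS hx0 => x hx.
  have : ell2_normr (x0 - x) ^+ 2 <= e ^+ 2.
    by rewrite ler_pXn2r ?nnegrE ?sqrtr_ge0 ?ltW.
  apply: le_trans; rewrite ell2_normr_sq -lee_fin -ell2_sqE -AE.
  by apply: ereal_sup_ubound; exists A.
have wP : w \in @sqsummable R I.
  have [x1 hx1] := cF 1 ltr01.
  have -> : w = (x1 : I -> R[i]) - (fun i => x1 i - w i).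
    by apply/funext => i; rewrite -[RHS]/(x1 i - (x1 i - w i)) opprB addrC subrK.
  apply: rpredB; first exact: ell2_valP.
  by apply/sqsummableP; apply: le_lt_trans (key _ _ ltr01 hx1) _; exact: ltry.
apply/cvg_ex; exists (Ell2 wP); apply/cvgrPdist_lt => eps eps0.
have epsE : (complex.Re eps)%:C = eps by rewrite RRe_real// gtr0_real.
have e0 : 0 < complex.Re eps by rewrite -ltcR epsE.
have e20 : 0 < complex.Re eps / 2 by rewrite divr_gt0.
have [x0 hx0] := cF _ e20; apply: filterS (hx0) => x hx.
rewrite ell2_normE -epsE ltcR norm_sip -(subrKA x0).
apply: le_lt_trans (sip_normD rD rZ rC r_ge0 _ _) _.
rewrite [ltRHS](splitr (complex.Re eps)) -!norm_sip ler_ltD//.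
rewrite norm_sip (sip_normB rD rZ rC) -norm_sip.
rewrite -(@ler_pXn2r _ 2) ?nnegrE ?sqrtr_ge0 ?(ltW e20)//.
rewrite ell2_normr_sq -lee_fin -ell2_sqE.
exact: key e20 hx0.
Qed.

HB.instance Definition _ := Uniform_isComplete.Build (ell2_of R I) ell2_complete.

Let dotP : bilinear_for *%R (Num.conj \; *%R) (@ell2_dot R I).
Proof.
split=> [u' a u v|u a v w]; first exact: ell2_dot_linearl.
rewrite ell2_dotC ell2_dot_linearl rmorphD rmorphM /=.
by congr (_ * _ + _); rewrite -ell2_dotC.
Qed.

HB.instance Definition _ := bilinear_isBilinear.Build R[i] (ell2_of R I)
  (ell2_of R I) R[i] _ _ (@ell2_dot R I) dotP.

Let dot_herm x y : ell2_dot x y = (-1) ^+ false * (ell2_dot y x)^*.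
Proof. by rewrite expr0 mul1r ell2_dotC. Qed.

HB.instance Definition _ := isHermitianSesquilinear.Build R[i] (ell2_of R I)
  false Num.conj (@ell2_dot R I) dot_herm.

Let dot_gt0 x : x != 0 -> 0 < ell2_dot x x.
Proof.
move=> x0; rewrite ell2_dot_self ltcR lt_neqAle ell2_sq_ge0 andbT eq_sym.
by apply: contra x0 => /eqP/ell2_sq0/eqP.
Qed.

HB.instance Definition _ := isDotProduct.Build R[i] (ell2_of R I)
  (@ell2_dot R I) dot_gt0.

Let dot_norm x : ell2_dot x x = `|x| ^+ 2.
Proof. by rewrite ell2_dot_self ell2_normE -ell2_normr_sq rmorphXn. Qed.

Definition ell2_hilbert : hilbert R :=
  @Hilbert R (ell2_of R I : completeNormedModType R[i])
    (@ell2_dot R I : {dot (ell2_of R I) for Num.conj}) dot_norm.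

End ell2_normed.

Lemma mem_fset_set (I : choiceType) (A : set I) (i : I) :
  finite_set A -> i \in fset_set A -> A i.
Proof. by move=> fA; rewrite in_fset_set// => /set_mem. Qed.

(** A sum over an arbitrary set takes a default value when its support is infinite. Replacing the
    index set by a finite one makes exchanges of sums and distributivity available. *)
Lemma fsum_finE (V : nmodType) (I : choiceType) (P A : set I) (F : I -> V) :
  finite_set A -> A `<=` P -> (forall i, P i -> ~ A i -> F i = 0) ->
  \sum_(i \in P) F i = \sum_(i <- fset_set A) F i.
Proof.
move=> fA AP F0; rewrite -(fsbig_widen A P)//; last first.
  by move=> i [Pi nAi]; exact: F0.
exact: fsbig_finite.
Qed.

(** * Convolution on a groupoid *)

Section groupoid_theory.
Context (G : groupoid).
Implicit Types (g h k : arr G).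

Lemma gmulKV h m : tgt h = tgt m -> mul h (mul (inv h) m) = m.
Proof.
move=> hm; rewrite mul_assoc ?tgt_inv ?src_inv//.
by rewrite mul_invr hm mul_idl.
Qed.

Lemma gmulK h m : src h = tgt m -> mul (inv h) (mul h m) = m.
Proof.
move=> hm; rewrite mul_assoc ?tgt_inv ?src_inv//.
by rewrite mul_invl hm mul_idl.
Qed.

Lemma gmul_inj h k m : src h = tgt k -> src h = tgt m -> mul h k = mul h m ->
  k = m.
Proof. by move=> hk hm e; rewrite -(gmulK hk) e gmulK. Qed.

Lemma ginv_uniq h k : src h = tgt k -> mul h k = idg (tgt h) -> k = inv h.
Proof.
by move=> hk e; apply: (gmul_inj hk); rewrite ?tgt_inv// e mul_invr.
Qed.

Lemma ginvK h : inv (inv h) = h.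
Proof.
by apply/esym/ginv_uniq; rewrite ?src_inv ?tgt_inv// mul_invl.
Qed.

Lemma ginvM h k : src h = tgt k -> inv (mul h k) = mul (inv k) (inv h).
Proof.
move=> hk; apply/esym/ginv_uniq.
  by rewrite src_mul// tgt_mul ?tgt_inv ?src_inv.
rewrite tgt_mul// -mul_assoc// ?tgt_mul ?tgt_inv ?src_inv// (mul_assoc (g := k));
  rewrite ?tgt_inv ?src_inv//.
by rewrite mul_invr -hk -{1}(tgt_inv h) mul_idl mul_invr.
Qed.

Lemma ginv_idg x : inv (idg x) = idg x :> arr G.
Proof.
apply/esym/ginv_uniq; rewrite ?src_idg ?tgt_idg//.
by have := mul_idr (idg x : arr G); rewrite src_idg.
Qed.

Lemma gmulVV h m g : tgt h = tgt m -> tgt m = tgt g ->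
  mul (inv (mul (inv h) m)) (mul (inv h) g) = mul (inv m) g.
Proof.
move=> hm mg; rewrite ginvM ?src_inv// ginvK -mul_assoc ?src_inv//.
  by rewrite gmulKV// hm.
by rewrite tgt_mul ?tgt_inv// src_inv hm.
Qed.

Lemma gmulVr h k : src h = tgt k -> mul (mul h k) (inv k) = h.
Proof.
by move=> hk; rewrite -mul_assoc ?tgt_inv// mul_invr -hk mul_idr.
Qed.

Lemma gmulVl h k : src h = src k -> mul (mul h (inv k)) k = h.
Proof.
by move=> hk; rewrite -mul_assoc ?tgt_inv ?src_inv// mul_invl -hk mul_idr.
Qed.

Lemma lmul_bij h : set_bij (tgt_fiber (tgt h)) (tgt_fiber (src h)) (mul (inv h)).
Proof.
split=> [m|m n|m] /=; rewrite /tgt_fiber/=.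
- by move=> mh; rewrite tgt_mul ?tgt_inv// src_inv.
- by move=> /set_mem/= mh /set_mem/= nh; apply: gmul_inj; rewrite ?src_inv.
- move=> mh; exists (mul h m); first by rewrite /= tgt_mul.
  by rewrite gmulK.
Qed.

End groupoid_theory.

Section action_by_convolution.
Context (R : realType) (G : groupoid).
Implicit Types (f : arr G -> R[i]) (g h k : arr G).

Definition tgt_finite f :=
  forall y, finite_set (tgt_fiber y `&` [set h | f h != 0]).

Context (V : lmodType R[i]).
Implicit Types (xi : arr G -> V).

(** The common form of [convol], with [V] the scalars, and of [ind], with [V] a Hilbert space; both
    are convertible to it. *)
Definition cact f xi : arr G -> V :=
  fun g => \sum_(h \in tgt_fiber (tgt g)) f h *: xi (mul (inv h) g).

Lemma cactE f xi g (A : set (arr G)) : finite_set A -> A `<=` tgt_fiber (tgt g) ->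
  (forall h, tgt h = tgt g -> f h != 0 -> A h) ->
  cact f xi g = \sum_(h <- fset_set A) f h *: xi (mul (inv h) g).
Proof.
move=> fA sA fsA; apply: fsum_finE => // h hg nA.
have [->|fh0] := eqVneq (f h) 0; first by rewrite scale0r.
by exfalso; apply: nA; exact: fsA.
Qed.

Lemma cact_linl (a : R[i]) f1 f2 xi : tgt_finite f1 -> tgt_finite f2 ->
  cact (fun g => a * f1 g + f2 g) xi = a *: cact f1 xi + cact f2 xi.
Proof.
move=> F1 F2; apply/funext => g.
pose A := (tgt_fiber (tgt g) `&` [set h | f1 h != 0]) `|`
          (tgt_fiber (tgt g) `&` [set h | f2 h != 0]).
have fA : finite_set A by rewrite finite_setU; split; [exact: F1|exact: F2].
have sA : A `<=` tgt_fiber (tgt g) by move=> h [[]|[]].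
rewrite (@cactE _ _ _ A)//; last first.
  move=> h hg fh; rewrite /A /=; have [f10|f10] := eqVneq (f1 h) 0.
    by right; split => //; apply: contra fh => /eqP ->; rewrite f10 mulr0 addr0.
  by left.
rewrite -[RHS]/(a *: cact f1 xi g + cact f2 xi g).
rewrite !(@cactE _ _ _ A)//; do ?[by move=> h ? ?; left|by move=> h ? ?; right].
rewrite scaler_sumr -big_split; apply: eq_bigr => h _ /=.
by rewrite scalerDl scalerA.
Qed.

Lemma cact_linr (a : R[i]) f xi eta : tgt_finite f ->
  cact f (a *: xi + eta) = a *: cact f xi + cact f eta.
Proof.
move=> Ff; apply/funext => g.
pose A := tgt_fiber (tgt g) `&` [set h | f h != 0].
have fA : finite_set A by exact: Ff.
rewrite -[RHS]/(a *: cact f xi g + cact f eta g).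
rewrite !(@cactE _ _ _ A)//; do ?by move=> h [].
rewrite scaler_sumr -big_split; apply: eq_bigr => h _ /=.
by rewrite scalerDr !scalerA mulrC.
Qed.

End action_by_convolution.

Section convolution_associativity.
Context (R : realType) (G : groupoid).
Implicit Types (f : arr G -> R[i]) (g h k : arr G).

Lemma convolE f1 f2 : convol f1 f2 = cact (V := R[i]^o) f1 f2.
Proof. by []. Qed.

(** Both sides are the double sum of [f1 h * f2 (h^-1 m)] times [xi (m^-1 g)], where on the right
    the inner variable [k] is replaced by [h^-1 m]. The set [B] contains every [m] that contributes
    for some [h] in [A]. *)
Lemma cact_convol (V : lmodType R[i]) f1 f2 (xi : arr G -> V) :
  tgt_finite f1 -> tgt_finite f2 ->
  cact (convol f1 f2) xi = cact f1 (cact f2 xi).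
Proof.
move=> F1 F2; apply/funext => g.
pose A := tgt_fiber (tgt g) `&` [set h | f1 h != 0].
pose B := \bigcup_(h in A)
  (tgt_fiber (tgt g) `&` [set m | f2 (mul (inv h) m) != 0]).
have fA : finite_set A by exact: F1.
have fB : finite_set B.
  apply: bigcup_finite => // h [/= + _]; rewrite /tgt_fiber/= => hg.
  apply: (@sub_finite_set _ _ (mul h @` (tgt_fiber (src h) `&` [set k | f2 k != 0]))).
    move=> m [/= + fm]; rewrite /tgt_fiber/= => mg; exists (mul (inv h) m); last by rewrite gmulKV// hg mg.
    by split => //=; rewrite /tgt_fiber/= tgt_mul ?tgt_inv// src_inv mg.
  exact/finite_image/F2.
have sB : B `<=` tgt_fiber (tgt g) by move=> m [h _ []].
have sA : A `<=` tgt_fiber (tgt g) by move=> h [].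
rewrite [RHS](cactE _ fA sA); last by move=> h hg fh; split.
rewrite (cactE _ fB sB); last first.
  move=> m mg; apply: contraNP => nBm; apply/eqP.
  apply: fsbig1 => h; rewrite /tgt_fiber/= mg => hg.
  have [->|f1h] := eqVneq (f1 h) 0; first by rewrite mul0r.
  have [->|f2h] := eqVneq (f2 (mul (inv h) m)) 0; first by rewrite mulr0.
  by exfalso; apply: nBm; exists h.
transitivity (\sum_(m <- fset_set B) \sum_(h <- fset_set A)
    (f1 h * f2 (mul (inv h) m)) *: xi (mul (inv m) g)).
  apply: eq_big_seq => m; move=> /(mem_fset_set fB)/sB; rewrite /tgt_fiber/= => mg.
  have sAm : A `<=` tgt_fiber (tgt m) by rewrite mg.
  rewrite convolE (cactE _ fA sAm) ?scaler_suml//.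
  by move=> h hm fh; split => //; rewrite /tgt_fiber/= hm.
rewrite exchange_big; apply: eq_big_seq => h; move=> /(mem_fset_set fA) Ah.
have [/= + fh] := Ah; rewrite /tgt_fiber/= => hg.
rewrite {1}/cact tgt_mul ?src_inv// tgt_inv.
rewrite (reindex_fsbig (mul (inv h)) _ _ _ (lmul_bij h)).
rewrite (@fsum_finE _ _ _ B)//.
- rewrite scaler_sumr; apply: eq_big_seq => m; move=> /(mem_fset_set fB)/sB; rewrite /tgt_fiber/= => mg.
  by rewrite scalerA gmulVV// hg.
- by rewrite hg.
- move=> m; rewrite /tgt_fiber/= hg => mg nBm.
  have [->|f2h] := eqVneq (f2 (mul (inv h) m)) 0; first by rewrite scale0r.
  by exfalso; apply: nBm; exists h.
Qed.

Lemma convolA f1 f2 f3 : tgt_finite f1 -> tgt_finite f2 ->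
  convol (convol f1 f2) f3 = convol f1 (convol f2 f3).
Proof. exact: (@cact_convol R[i]^o). Qed.

Lemma convol_neq0 f1 f2 g : convol f1 f2 g != 0 ->
  exists2 h, tgt h = tgt g & f1 h != 0 /\ f2 (mul (inv h) g) != 0.
Proof.
apply: contraNP => no; apply/eqP; apply: fsbig1 => h hg.
have [->|f1h] := eqVneq (f1 h) 0; first by rewrite mul0r.
have [->|f2h] := eqVneq (f2 (mul (inv h) g)) 0; first by rewrite mulr0.
by exfalso; apply: no; exists h.
Qed.

End convolution_associativity.

(** If [A] is infinite, the sets containing all but finitely many points of [A] form a proper
    filter. It contains the complement of each point, so it has no cluster point in a discrete
    space. *)
Lemma compact_discrete_finite (T : discreteTopologicalType) (A : set T) :
  compact A -> finite_set A.
Proof.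
move=> cA; apply: contrapT => infA.
pose F : set_system T := [set B | finite_set (A `\` B)].
have FF : ProperFilter F.
  apply: Build_ProperFilter => [|].
    by rewrite /F /= setD0.
  split.
  - by rewrite /F /= setDT.
  - by move=> B C FB FC; rewrite /F /= setDIr finite_setU.
  - by move=> B C BC; apply: sub_finite_set; exact: setDS.
have [p [_ clp]] : A `&` cluster F !=set0.
  by apply: cA; rewrite /F /= setDv.
have Fp : F (~` [set p]).
  by apply: (@sub_finite_set _ _ [set p]) => // y [_ /contrapT].
by have [y [/= ny yp]] := clp _ _ Fp (discrete_set1 p).
Qed.

Lemma bump_function (R : realType) (X : topologicalType) (x : X) (U : set X) :
  hausdorff_space X -> locally_compact [set: X] -> open U -> U x ->
  exists phi : X -> R, exists K : set X,
    [/\ continuous phi, (forall z, 0 <= phi z <= 1), phi x = 1,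
        compact K /\ K `<=` U & forall z, phi z != 0 -> K z].
Proof.
move=> hX lX oU Ux.
have [B xB [cB clB]] := lX x I.
rewrite withinET in xB.
have Unx : nbhs x U by exact: open_nbhs_nbhs.
have [C Cx CUB] : exists2 C, nbhs x C & closure C `<=` U `&` B.
  by have := compact_regular hX cB xB (filterI Unx xB) => -[C Cx CUB]; exists C.
have crs : completely_regular_space X by exact: locally_compact_completely_regular.
have clO : closed (~` C°) by apply: open_closedC; exact: open_interior.
have nx : ~ (~` C°) x by move=> /(_ Cx).
(* The separating function is 0 at [x] and 1 outside the interior of [C], so [1 - f] vanishes
   outside the closure of [C]. *)
have /(@uniform_separatorP _ R) [f [cf f01 fx f1]] := crs _ _ clO nx.
have fb z : 0 <= f z <= 1.
  by have /f01 : range f (f z) by exists z.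
exists (fun z => 1 - f z), (closure C); split.
- by move=> z; apply: cvgB; [exact: cvg_cst|exact: cf].
- by move=> z; have := fb z; lra.
- by have -> : f x = 0; [apply: fx; exists x|rewrite subr0].
- split; last by move=> z /CUB[].
  by apply: (subclosed_compact _ cB) => [|z /CUB[]]; first exact: closed_closure.
- move=> z; apply: contraNP => nz; apply/eqP.
  have -> : f z = 1; last by rewrite subrr.
  apply: f1; exists z => // /interior_subset Cz.
  by apply: nz; exact: subset_closure.
Qed.

Lemma CcP (R : realType) (G : groupoid) (f : arr G -> R[i]) (K : set (arr G)) :
  hausdorff_space (arr G) ->
  continuous (f : arr G -> (R[i] : numClosedFieldType)) -> compact K ->
  (forall g, f g != 0 -> K g) -> Cc f.
Proof.
move=> hG cf cK fK; split => //.
have clK : closed K by exact: compact_closed.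
apply: (subclosed_compact _ cK); first exact: closed_closure.
by move/closure_id: clK => ->; exact: closureS.
Qed.

(** * The groupoid of a partial action *)

Section arrow_topology.
Context (Gam : groupType) (X : topologicalType) (a : partial_action Gam X).
Hypothesis hX : hausdorff_space X.
Let A : topologicalType := arr (action_groupoid a).
Let src (g : A) : X := ag_src (g : ag_set a).
Let tgt (g : A) : X := ag_tgt (g : ag_set a).
Let elt (g : A) : discrete_topology Gam := ag_elt (g : ag_set a).

Lemma ag_val_continuous : continuous (fun g : A => set_val (g : ag_set a)).
Proof. exact: initial_continuous. Qed.

Lemma ag_src_continuous : continuous src.
Proof.
move=> g; apply: (continuous_comp (g := snd) (@ag_val_continuous g)).
exact: cvg_snd.
Qed.

Lemma ag_tgt_continuous : continuous tgt.
Proof.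
move=> g; apply: (continuous_comp (g := fst \o fst) (@ag_val_continuous g)).
by apply: continuous_comp; exact: cvg_fst.
Qed.

Lemma ag_elt_continuous : continuous elt.
Proof.
move=> g; apply: (continuous_comp (g := snd \o fst) (@ag_val_continuous g)).
by apply: continuous_comp; [exact: cvg_fst|exact: cvg_snd].
Qed.

Lemma ag_elt_near (g : A) : \forall h \near g, elt h = elt g.
Proof.
exact: (ag_elt_continuous (discrete_set1 (elt g))).
Qed.

(** The arrows carry the topology induced by the product, so convergence can be tested on the three
    components. *)
Lemma ag_cvg (T : Type) (F : set_system T) (FF : Filter F) (f : T -> A) (g : A) :
  tgt \o f @ F --> tgt g -> elt \o f @ F --> elt g -> src \o f @ F --> src g ->
  f @ F --> g.
Proof.
move=> ft fe fs U [_ [/= [W oW <-]] Wg sub].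
have vf : (fun t => set_val (f t : ag_set a)) @ F --> set_val (g : ag_set a).
  have -> : (fun t => set_val (f t : ag_set a)) =
      (fun t => ((tgt (f t), elt (f t)), src (f t))).
    by apply/funext => t; rewrite /tgt /elt /src /ag_tgt /ag_elt /ag_src -!surjective_pairing.
  have -> : set_val (g : ag_set a) = ((tgt g, elt g), src g).
    by rewrite /tgt /elt /src /ag_tgt /ag_elt /ag_src -!surjective_pairing.
  exact: (cvg_pair (cvg_pair ft fe) fs).
have Wn : nbhs (set_val (g : ag_set a)) W by exact: open_nbhs_nbhs.
have : F ((fun t => set_val (f t : ag_set a)) @^-1` W) by exact: vf.
by apply: (@filterS _ F) => t /= Wt; exact: sub.
Qed.

Lemma ag_hausdorff : hausdorff_space A.
Proof.
move=> p q pq; apply: ag_eq.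
- apply: hX => U V Up Vq.
  by have [g [Ug Vg]] := pq _ _ (ag_tgt_continuous Up) (ag_tgt_continuous Vq);
    exists (tgt g).
- have [g [gp gq]] := pq _ _ (ag_elt_near p) (ag_elt_near q).
  exact: etrans (esym gp) gq.
- apply: hX => U V Up Vq.
  by have [g [Ug Vg]] := pq _ _ (ag_src_continuous Up) (ag_src_continuous Vq);
    exists (src g).
Qed.

End arrow_topology.

Lemma finite_set_inj_image (T U : Type) (A : set T) (e : T -> U) :
  {in A &, injective e} -> finite_set (e @` A) -> finite_set A.
Proof. by move=> einj; rewrite (eq_finite_set (inj_card_eq einj)). Qed.

Lemma continuous_lin (K : numClosedFieldType) (T : topologicalType) (b : K)
    (f1 f2 : T -> K) :
  continuous f1 -> continuous f2 -> continuous (fun t => b * f1 t + f2 t).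
Proof.
move=> c1 c2 t; apply: cvgD; last exact: c2.
by apply: cvgM; [exact: cvg_cst|exact: c1].
Qed.

Lemma conjC_continuous (K : numClosedFieldType) : continuous (Num.conj : K -> K).
Proof.
move=> z; apply/(@cvgrPdist_lt K K K (nbhs z) (nbhs_filter z)) => e e0.
have /(@cvgrPdist_lt K K K (nbhs z) (nbhs_filter z)) /(_ e e0) := @cvg_id K (nbhs z).
by apply: (@filterS K (nbhs z) (nbhs_filter z)) => w; rewrite -rmorphB norm_conjC.
Qed.

Section action_groupoid_Cc.
Context (R : realType) (Gam : groupType) (X : topologicalType)
  (a : partial_action Gam X).
Hypothesis hX : hausdorff_space X.
Local Notation G := (action_groupoid a).
Local Notation C := (R[i] : numClosedFieldType).
Implicit Types (f : arr G -> R[i]) (g h : arr G) (c : Gam) (x y z : X).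

Definition elt g : Gam := ag_elt (g : ag_set a).

Lemma elt_mul g h : src g = tgt h -> elt (mul g h) = (elt g * elt h)%g.
Proof. by move=> gh; have [] := ag_mulE (a := a) gh. Qed.

Lemma elt_inv g : elt (inv g) = (elt g)^-1%g.
Proof. by []. Qed.

Lemma elt_idg x : elt (idg (x : obj G)) = 1%g.
Proof. by []. Qed.

Lemma src_dom g : pdom a (elt g)^-1%g (src g).
Proof. by have [] := agP (g : ag_set a). Qed.

Lemma tgtE g : tgt g = pact a (elt g) (src g).
Proof. by have [] := agP (g : ag_set a). Qed.

Lemma tgt_dom g : pdom a (elt g) (tgt g).
Proof. by rewrite tgtE; apply: pdom_act; exact: src_dom. Qed.

Lemma srcE g : src g = pact a (elt g)^-1%g (tgt g).
Proof. by rewrite tgtE pactK//; exact: src_dom. Qed.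

Lemma arr_eq_src g h : src g = src h -> elt g = elt h -> g = h.
Proof.
move=> sgh egh; apply: (@ag_eq _ _ a) => //.
rewrite -[ag_tgt _]/(tgt g) -[ag_tgt _]/(tgt h).
by rewrite !tgtE sgh egh.
Qed.

Lemma arr_eq_tgt g h : tgt g = tgt h -> elt g = elt h -> g = h.
Proof. by move=> tgh egh; apply: arr_eq_src => //; rewrite !srcE tgh egh. Qed.

Lemma larr_subproof c z : pdom a c^-1%g z ->
  ((pact a c z, c, z) : X * discrete_topology Gam * X) \in ag_set a.
Proof. by move=> cz; apply/mem_set. Qed.

(* Outside of the domain of c the value is a junk unit. *)
Definition larr c z : arr G :=
  match pselect (pdom a c^-1%g z) with
  | left cz => exist (fun p => p \in ag_set a) _ (larr_subproof cz)
  | right _ => idg (z : obj G)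
  end.

Lemma src_larr c z : src (larr c z) = z.
Proof. by rewrite /larr; case: pselect. Qed.

Lemma elt_larr c z : pdom a c^-1%g z -> elt (larr c z) = c.
Proof. by rewrite /larr; case: pselect. Qed.

Lemma tgt_larr c z : pdom a c^-1%g z -> tgt (larr c z) = pact a c z.
Proof. by move=> cz; rewrite tgtE elt_larr// src_larr. Qed.

Lemma larrE g : larr (elt g) (src g) = g.
Proof.
by apply: arr_eq_src; rewrite ?src_larr// elt_larr//; exact: src_dom.
Qed.

Lemma larr_continuous c z : pdom a c^-1%g z -> {for z, continuous (larr c)}.
Proof.
move=> cz; have oc : open (pdom a c^-1%g) by exact: pdom_open.
have nc : \forall w \near z, pdom a c^-1%g w by exact: open_nbhs_nbhs.
apply: (@ag_cvg _ _ a).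
- have [_ + _] := pact_homeo a c.
  rewrite continuous_open_subspace// => /(_ z (mem_set cz)) cpact.
  rewrite -[ag_tgt _]/(tgt (larr c z)) tgt_larr//; apply: cvg_trans cpact.
  apply: near_eq_cvg; apply: filterS nc => w cw.
  by rewrite /= -[ag_tgt _]/(tgt (larr c w)) tgt_larr.
- apply: cvg_near_cst; apply: filterS nc => w cw.
  by rewrite /= -[ag_elt _]/(elt (larr c w)) -[RHS]/(elt (larr c z)) !elt_larr.
- rewrite -[ag_src _]/(src (larr c z)) src_larr.
  by rewrite (_ : _ \o _ = id); [exact: cvg_id|apply/funext => w; exact: src_larr].
Qed.

(** The image of a compact set in the discrete group is finite. All finiteness of convolution sums
    on the action groupoid rests on this. *)
Lemma Cc_finite_elt f : Cc f -> finite_set (elt @` [set g | f g != 0]).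
Proof.
move=> [_ cK]; have := continuous_compact
  (continuous_subspaceT (@ag_elt_continuous _ _ a)) cK.
move=> /compact_discrete_finite; apply: sub_finite_set.
by apply: image_subset; exact: subset_closure.
Qed.

Definition finite_elt f := finite_set (elt @` [set g | f g != 0]).

Lemma finite_elt_tgt f : finite_elt f -> tgt_finite f.
Proof.
move=> ff y; apply: (@finite_set_inj_image _ _ _ elt).
  by move=> g h /set_mem[+ _] /set_mem[+ _]; rewrite /tgt_fiber/= => gy hy;
    apply: arr_eq_tgt; exact: etrans gy (esym hy).
by apply: sub_finite_set ff; apply: image_subset => g [].
Qed.

Lemma finite_elt_src f : finite_elt f ->
  forall y : obj G, finite_set (src_fiber y `&` [set h | f h != 0]).
Proof.
move=> ff y; apply: (@finite_set_inj_image _ _ _ elt).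
  by move=> g h /set_mem[+ _] /set_mem[+ _]; rewrite /src_fiber/= => gy hy;
    apply: arr_eq_src; exact: etrans gy (esym hy).
by apply: sub_finite_set ff; apply: image_subset => g [].
Qed.

Let hG : hausdorff_space (arr G).
Proof. exact: ag_hausdorff. Qed.

Lemma Cc_lin (b : R[i]) f1 f2 : Cc f1 -> Cc f2 ->
  Cc (fun g => b * f1 g + f2 g).
Proof.
move=> [c1 K1] [c2 K2]; apply: (CcP hG _ (compactU K1 K2)).
  exact (@continuous_lin C (arr G) b f1 f2 c1 c2).
move=> g; have [f1g|f1g] := eqVneq (f1 g) 0.
  by rewrite f1g mulr0 add0r => f2g; right; exact: subset_closure.
by move=> _; left; exact: subset_closure.
Qed.

Lemma Cc0 : Cc (fun _ : arr G => 0 : R[i]).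
Proof.
apply: (CcP hG _ (@compact0 _)) => [|g]; last by rewrite eqxx.
exact: (@cst_continuous (arr G) C (0 : R[i])).
Qed.

Lemma ginv_continuous : continuous (@inv G).
Proof.
move=> g; apply: (@ag_cvg _ _ a _ _ (nbhs_filter (g : arr G))).
- exact: (@ag_src_continuous _ _ a g).
- apply: cvg_near_cst; apply: filterS (ag_elt_near g) => h hg.
  by rewrite /= -[ag_elt _]/(elt h)^-1%g -[RHS]/(elt g)^-1%g; congr (_^-1)%g.
- exact: (@ag_tgt_continuous _ _ a g).
Qed.

Lemma Cc_inv f : Cc f -> Cc (f \o @inv G).
Proof.
move=> [cf K]; have := continuous_compact
  (continuous_subspaceT ginv_continuous) K.
move=> K'; apply: (CcP hG _ K').
  by move=> g; apply: continuous_comp; [exact: ginv_continuous|exact: cf].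
move=> g fg; exists (inv g); last exact: ginvK.
exact: subset_closure.
Qed.

Lemma Cc_star f : Cc f -> Cc (star f).
Proof.
move=> /Cc_inv[cf K]; apply: (CcP hG _ K).
  by move=> g; apply: (continuous_comp (cf g)); exact: (@conjC_continuous C).
by move=> g; rewrite conjC_eq0 => fg; exact: subset_closure.
Qed.

(** The part of [f] over the group element [c], parametrized by the source and extended by 0 to all
    of [X]. *)
Definition slice f c z : R[i] := if `[< pdom a c^-1%g z >] then f (larr c z) else 0.

Lemma sliceE f g : slice f (elt g) (src g) = f g.
Proof. by rewrite /slice asboolT ?larrE//; exact: src_dom. Qed.

(** Only the points outside the domain of [c] need an argument. The sources of the arrows over [c]
    in the support of [f] form a compact, hence closed, set inside the domain, so the extension by 0
    vanishes near such a point. *)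
Lemma slice_continuous f c : Cc f -> continuous (slice f c : X -> C).
Proof.
move=> [cf K] z; have oc : open (pdom a c^-1%g) by exact: pdom_open.
have [cz|ncz] := pselect (pdom a c^-1%g z).
  have nc : \forall w \near z, pdom a c^-1%g w by exact: open_nbhs_nbhs.
  have sE w : pdom a c^-1%g w -> slice f c w = f (larr c w).
    by move=> cw; rewrite /slice asboolT.
  rewrite /continuous_at (sE _ cz).
  have h := continuous_comp (larr_continuous cz) (cf (larr c z)).
  apply: cvg_trans h; apply: near_eq_cvg; apply: filterS nc => w cw.
  by rewrite sE.
pose K' := @src G @` (closure [set g | f g != 0] `&` [set g | elt g = c]).
have cK' : compact K'.
  apply: continuous_compact; first exact/continuous_subspaceT/ag_src_continuous.
  apply: compact_closedI => //.
  apply: (@closed_comp (arr G) (discrete_topology Gam) elt [set c]) => [g _|].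
    exact: (@ag_elt_continuous _ _ a g).
  exact: (@discrete_closed (discrete_topology Gam)).
have clK' : closed K' by exact: compact_closed.
have nz : ~ K' z by move=> [g [_ /= gc] gz]; apply: ncz; rewrite -gc -gz; exact: src_dom.
have nK : \forall w \near z, ~ K' w by apply: open_nbhs_nbhs; split => //; exact: closed_openC.
rewrite /continuous_at {2}/slice asboolF//; apply: cvg_near_cst.
apply: filterS nK => w nKw; rewrite /slice; case: asboolP => // cw.
apply: contraPP nKw => /eqP fw nKw; apply: nKw; exists (larr c w).
  by split; [exact: subset_closure|exact: elt_larr].
exact: src_larr.
Qed.

End action_groupoid_Cc.

Lemma continuous_sum_prod (K : numClosedFieldType) (T : topologicalType)
    (I : Type) (s : seq I) (u v : I -> T -> K) (t : T) :
  (forall i, {for t, continuous (u i)}) -> (forall i, {for t, continuous (v i)}) ->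
  {for t, continuous (fun t => \sum_(i <- s) u i t * v i t)}.
Proof.
move=> cu cv; apply: cvg_big => [|i _]; first exact: add_continuous.
by apply: cvgM; [exact: cu|exact: cv].
Qed.

Section action_groupoid_convol.
Context (R : realType) (Gam : groupType) (X : topologicalType)
  (a : partial_action Gam X).
Hypothesis hX : hausdorff_space X.
Local Notation G := (action_groupoid a).
Local Notation C := (R[i] : numClosedFieldType).
Implicit Types (f : arr G -> R[i]) (g h : arr G) (c : Gam) (x y z : X).

(** The arrows [h] in the convolution sum range over a set that depends on [g]. Indexing them by
    their group element gives a fixed finite index set and terms built from the source, the target
    and the group element of [g], from which continuity can be read. The inversion of [f1] appears
    because these arrows share a target while [slice] uses the source. *)
Lemma convol_sliceE f1 f2 g (L : set Gam) : finite_set L ->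
  (forall h, f1 h != 0 -> L (elt h)) ->
  convol f1 f2 g = \sum_(c <- fset_set L)
    slice (f1 \o @inv G) c^-1%g (tgt g) * slice f2 (c^-1 * elt g)%g (src g).
Proof.
move=> fL f1L.
pose D := [set c | L c /\ pdom a c (tgt g)].
have fD : finite_set D by apply: sub_finite_set fL => c [].
pose k c : arr G := inv (larr a c^-1%g (tgt g)).
have dom c : D c -> pdom a (c^-1)^-1%g (tgt g) by rewrite invgK => -[].
have ktgt c : D c -> tgt (k c) = tgt g.
  by move=> Dc; rewrite /k tgt_inv src_larr.
have kelt c : D c -> elt (k c) = c.
  by move=> Dc; rewrite /k elt_inv (elt_larr (dom _ Dc)) invgK.
have kinj : {in D &, injective k}.
  by move=> c d /set_mem Dc /set_mem Dd kcd; rewrite -(kelt c)// kcd kelt.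
rewrite convolE (@cactE _ _ _ _ _ _ (k @` D)).
- rewrite -fsbig_finite; last exact: finite_image.
  rewrite fsbig_image//.
  rewrite -[RHS]fsbig_finite// -(@fsbig_widen _ _ _ _ D L); last 2 first.
    by move=> c [].
    move=> c [Lc nDc] /=; rewrite {1}/slice asboolF ?mul0r// invgK => cd.
    exact: nDc.
  apply: eq_fsbigr => c /set_mem Dc.
  have e1 : slice (f1 \o @inv G) c^-1%g (tgt g) = f1 (k c).
    by rewrite /slice asboolT//; exact: dom.
  have e2 : slice f2 (c^-1 * elt g)%g (src g) = f2 (mul (inv (k c)) g).
    have ikg : src (inv (k c)) = tgt g by rewrite src_inv ktgt.
    rewrite -(sliceE f2 (mul (inv (k c)) g)) elt_mul// elt_inv kelt//.
    by rewrite src_mul.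
  by rewrite e1 e2.
- exact: finite_image.
- by move=> _ [c Dc <-]; exact: ktgt.
- move=> h hg f1h.
  have Dh : D (elt h) by split; [exact: f1L|rewrite -hg; exact: tgt_dom].
  exists (elt h) => //; apply: arr_eq_tgt; last exact: kelt.
  by rewrite ktgt.
Qed.

Let hG : hausdorff_space (arr G).
Proof. exact: ag_hausdorff. Qed.

Let comp : set (arr G * arr G) := [set p | src p.1 = tgt p.2].

Let comp_closed : closed comp.
Proof.
have c1 : continuous (fun p : arr G * arr G => (src p.1 : X)).
  by move=> p; apply: continuous_comp; [exact: cvg_fst|exact: (@ag_src_continuous _ _ a)].
have c2 : continuous (fun p : arr G * arr G => (tgt p.2 : X)).
  by move=> p; apply: continuous_comp; [exact: cvg_snd|exact: (@ag_tgt_continuous _ _ a)].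
move=> p clp; apply: hX => U V Up Vp.
have n1 : nbhs p ((fun p : arr G * arr G => (src p.1 : X)) @^-1` U) by exact: c1.
have n2 : nbhs p ((fun p : arr G * arr G => (tgt p.2 : X)) @^-1` V) by exact: c2.
have [q [cq [Uq Vq]]] := clp _ (filterI n1 n2).
by exists (src q.1); split => //; rewrite cq.
Qed.

Let mul_continuous : {within comp, continuous (fun p => mul p.1 p.2)}.
Proof.
apply/subspace_continuousP => p cp.
have nc : \forall q \near within comp (nbhs p), comp q.
  by rewrite near_withinE; exact: nearW.
(* [mul] has junk values on non-composable pairs, so the limit is taken within [comp], where each
   component of [mul] agrees with a function continuous on all pairs. *)
have wcvg (T : topologicalType) (F : arr G * arr G -> T) (H : arr G * arr G -> T) :
    {for p, continuous F} -> (forall q, comp q -> H q = F q) ->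
    H @ within comp (nbhs p) --> H p.
  move=> cF HF; rewrite HF//.
  apply: (@cvg_trans _ (F @ within comp (nbhs p))).
    by apply: near_eq_cvg; apply: filterS nc => q cq; rewrite HF.
  by apply: cvg_trans cF; apply: cvg_fmap2; exact: cvg_within.
apply: (@ag_cvg _ _ a _ _ (within_filter _ (nbhs_filter p))).
- apply: (wcvg X (fun q => tgt q.1)); last by move=> q cq; exact: (@tgt_mul G).
  by apply: continuous_comp; [exact: cvg_fst|exact: (@ag_tgt_continuous _ _ a)].
- apply: (wcvg (discrete_topology Gam) (fun q => (elt q.1 * elt q.2)%g)).
    apply: cvg_near_cst.
    have n1 : \forall q \near p, elt q.1 = elt p.1.
      exact: (@cvg_fst _ _ (nbhs p.1) (nbhs p.2) _ _ (@ag_elt_near _ _ a p.1)).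
    have n2 : \forall q \near p, elt q.2 = elt p.2.
      exact: (@cvg_snd _ _ (nbhs p.1) (nbhs p.2) _ _ (@ag_elt_near _ _ a p.2)).
    by apply: filterS2 n1 n2 => q -> ->.
  by move=> q cq; exact: elt_mul.
- apply: (wcvg X (fun q => src q.2)); last by move=> q cq; exact: (@src_mul G).
  by apply: continuous_comp; [exact: cvg_snd|exact: (@ag_src_continuous _ _ a)].
Qed.

(** The convolution vanishes outside the image under [mul] of the composable pairs in a product of
    two compact sets. This image is compact since [comp] is closed, which is where the Hausdorff
    property of [X] enters. *)
Lemma Cc_convol f1 f2 : Cc f1 -> Cc f2 -> Cc (convol f1 f2).
Proof.
move=> C1 C2.
have K12 := compact_closedI (compact_setX C1.2 C2.2) comp_closed.
have mK : compact ((fun p => mul p.1 p.2) @`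
    (closure [set g | f1 g != 0] `*` closure [set g | f2 g != 0] `&` comp)).
  apply: continuous_compact K12.
  exact: continuous_subspaceW mul_continuous.
apply: (CcP hG _ mK); last first.
  move=> g /convol_neq0[h hg [f1h f2h]].
  exists (h, mul (inv h) g); last exact: (@gmulKV G).
  split; first by split; exact: subset_closure.
  by apply/esym/(etrans (@tgt_mul G _ _ _)); rewrite ?src_inv ?tgt_inv.
pose L := @elt Gam X a @` [set g | f1 g != 0].
have fL : finite_set L by exact: Cc_finite_elt.
have f1L h : f1 h != 0 -> L (elt h) by move=> f1h; exists h.
have -> : convol f1 f2 = fun g => \sum_(c <- fset_set L)
    slice (f1 \o @inv G) c^-1%g (tgt g) * slice f2 (c^-1 * elt g)%g (src g).
  by apply/funext => g; exact: convol_sliceE.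
move=> g; apply: (@continuous_sum_prod C (arr G)) => c.
  have cs := slice_continuous hX (c := c^-1%g) (Cc_inv hX C1).
  exact: (continuous_comp (@ag_tgt_continuous _ _ a g) (cs (tgt g))).
have cs := slice_continuous hX (c := (c^-1 * elt g)%g) C2.
have h := continuous_comp (@ag_src_continuous _ _ a g) (cs (src g)).
apply: cvg_trans h; apply: (@near_eq_cvg _ _ _ (nbhs_filter (g : arr G))).
have n : \forall k \near g, elt k = elt g by exact: (@ag_elt_near _ _ a g).
apply: filterS n => k kg.
by rewrite /= kg.
Qed.

End action_groupoid_convol.

(** * Representations *)

Section complex_continuity.
Context (R : realType).
Local Notation C := (R[i] : numClosedFieldType).

Lemma real_complex_continuous : continuous (fun t : R => t%:C : C).
Proof.
move=> t; apply/(@cvgrPdist_lt C C R (nbhs t) (nbhs_filter t)) => e e0.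
have eE : (complex.Re e)%:C = e by rewrite RRe_real// gtr0_real.
have e0' : 0 < complex.Re e by rewrite -ltcR eE.
have /(@cvgrPdist_lt R R R (nbhs t) (nbhs_filter t)) /(_ _ e0') := @cvg_id R (nbhs t).
apply: filterS => u; rewrite -ltcR eE; apply: le_lt_trans.
by rewrite -rmorphB/= normcE cabs_real.
Qed.

Lemma Re_continuous : continuous (@complex.Re R : C -> R).
Proof.
move=> z; apply/(@cvgrPdist_lt R R C (nbhs z) (nbhs_filter z)) => e e0.
have e0' : (0 : C) < e%:C by rewrite ltcR.
have /(@cvgrPdist_lt C C C (nbhs z) (nbhs_filter z)) /(_ _ e0') := @cvg_id C (nbhs z).
apply: (@filterS C (nbhs z) (nbhs_filter z)) => u.
rewrite normcE ltcR; apply: le_lt_trans.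
by rewrite -ReN -ReD Re_le_cabs.
Qed.

End complex_continuity.

Section hilbert_theory.
Context (R : realType) (H : hilbert R).
Implicit Types u v w : H.

Definition hre u v : R := complex.Re (hdot H u v).

Lemma hdotC u v : hdot H u v = (hdot H v u)^*.
Proof. by have := @hermitian_subproof _ _ _ _ (hdot H) u v; rewrite expr0 mul1r. Qed.

Lemma hreD u v w : hre (u + v) w = hre u w + hre v w.
Proof. by rewrite /hre linearDl ReD. Qed.

Lemma hreZ (b : R) u w : hre (b%:C *: u) w = b * hre u w.
Proof. by rewrite /hre linearZl_LR/= ReZ. Qed.

Lemma hreC u v : hre u v = hre v u.
Proof. by rewrite /hre hdotC Re_conj. Qed.

Lemma hre_norm v : hre v v = (complex.Re `|v|) ^+ 2.
Proof.
rewrite /hre hdot_norm -{1}(RRe_real (ger0_real (normr_ge0 v))).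
by rewrite -rmorphXn.
Qed.

Lemma hre_ge0 v : 0 <= hre v v.
Proof. by rewrite hre_norm sqr_ge0. Qed.

Lemma Re_norm_ge0 (V : normedZmodType R[i]) (v : V) : 0 <= complex.Re `|v|.
Proof. by rewrite -ler0c RRe_real ?ger0_real. Qed.

Lemma hnormE v : sip_norm hre v = complex.Re `|v|.
Proof. by rewrite /sip_norm hre_norm sqrtr_sqr ger0_norm// Re_norm_ge0. Qed.

End hilbert_theory.

Lemma real_complex_comp_continuous (R : realType) (T : topologicalType)
    (u : T -> R) :
  continuous u -> continuous (fun t => (u t)%:C : (R[i] : numClosedFieldType)).
Proof.
by move=> cu t; apply: (continuous_comp (cu t)); exact: real_complex_continuous.
Qed.

Section rep_theory.
Context (R : realType) (G : groupoid) (H : hilbert R).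
Context (rho : representation G H).
Implicit Types (f : arr G -> R[i]) (v : H).

Lemma rep_adj f u v : Cc f -> hre (rho f u) v = hre u (rho (star f) v).
Proof. by move=> Cf; rewrite /hre rep_star. Qed.

(* [psi] plays the role of 1 - sqrt (1 - F^* F), which lies in the algebra
   although 1 does not. *)
Lemma rep_contraction f psi : Cc f -> Cc (star f) -> Cc (convol (star f) f) ->
  Cc psi -> Cc (convol psi psi) -> star psi = psi ->
  (forall g, psi g + psi g = convol (star f) f g + convol psi psi g) ->
  forall v, hre (rho f v) (rho f v) <= hre v v.
Proof.
move=> Cf Csf Ck Cpsi Cpp spsi fE v.
have e1 : rho (fun g => 1 * psi g + psi g) v = rho psi v + rho psi v.
  by rewrite rep_linear// scale1r.
have e2 : rho (fun g => 1 * convol (star f) f g + convol psi psi g) v =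
    rho (star f) (rho f v) + rho psi (rho psi v).
  by rewrite rep_linear// scale1r !rep_convol.
have e3 : (fun g => 1 * psi g + psi g) =
    (fun g => 1 * convol (star f) f g + convol psi psi g).
  by apply/funext => g; rewrite !mul1r fE.
rewrite e3 e2 in e1.
have e4 : hre v (rho (star f) (rho f v)) + hre v (rho psi (rho psi v)) =
    hre v (rho psi v) + hre v (rho psi v).
  by rewrite !(hreC v) -!hreD e1.
have e5 : hre v (rho psi (rho psi v)) = hre (rho psi v) (rho psi v).
  by rewrite [RHS]rep_adj// spsi.
have := hre_ge0 (v - rho psi v).
rewrite (sipB (@hreD R H) (@hreZ R H)) !(sipBr (@hreD R H) (@hreZ R H) (@hreC R H)).
by rewrite (rep_adj v (rho f v) Cf) (hreC (rho psi v) v); move: e4 e5; lra.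
Qed.

End rep_theory.

Lemma continuous_1B (T : topologicalType) (R : realType) (u : T -> R) :
  continuous u -> continuous (fun t => 1 - u t).
Proof. by move=> cu t; apply: cvgB; [exact: cvg_cst|exact: cu]. Qed.

Lemma continuous_sqrt_comp (T : topologicalType) (R : realType) (u : T -> R) :
  continuous u -> continuous (fun t => Num.sqrt (u t)).
Proof. by move=> cu t; apply: (continuous_comp (cu t)); exact: sqrt_continuous. Qed.

Section slice_bound.
Context (R : realType) (Gam : groupType) (X : topologicalType)
  (a : partial_action Gam X).
Hypothesis hX : hausdorff_space X.
Local Notation G := (action_groupoid a).
Local Notation C := (R[i] : numClosedFieldType).
Implicit Types (f : arr G -> R[i]) (g h : arr G) (c : Gam) (x y z : X).

Let hG : hausdorff_space (arr G).
Proof. exact: ag_hausdorff. Qed.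

Lemma Cc_slice c (u : arr G -> R[i]) (K : set X) :
  compact K -> K `<=` pdom a c^-1%g -> continuous (u : arr G -> C) ->
  (forall g, u g != 0 -> K (src g)) ->
  Cc (fun g => (elt g == c)%:R * u g).
Proof.
move=> cK Kc cu uK.
have cL : compact (larr a c @` K).
  apply: continuous_compact cK; apply: continuous_in_subspaceT => z /set_mem Kz.
  exact/larr_continuous/Kc.
apply: (CcP hG _ cL) => [g|g].
  have n : \forall k \near g, elt k = elt g by exact: (@ag_elt_near _ _ a g).
  have h := @continuous_lin C (arr G) (elt g == c)%:R u (fun=> 0) cu
    (@cst_continuous (arr G) C 0) g.
  rewrite /continuous_at -[(elt g == c)%:R * u g]addr0.
  apply: cvg_trans h; apply: (@near_eq_cvg _ _ _ (nbhs_filter (g : arr G))).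
  by apply: filterS n => k kg; rewrite kg addr0.
have [<-|] := eqVneq (elt g) c; last by rewrite mul0r eqxx.
by rewrite mul1r => /uK Kg; exists (src g) => //; exact: larrE.
Qed.

Lemma Cc_comp f (u : C -> C) : continuous u -> u 0 = 0 -> Cc f -> Cc (u \o f).
Proof.
move=> cu u0 [cf K]; apply: (CcP hG _ K) => [g|g].
  by apply: (continuous_comp (cf g)); exact: cu.
by move=> fg; apply: subset_closure; apply: contra fg => /eqP/= ->; rewrite u0.
Qed.

Lemma convol_units f1 f2 g : (forall h, f1 h != 0 -> elt h = 1%g) ->
  convol f1 f2 g = f1 (idg (tgt g)) * f2 g.
Proof.
move=> f1u; rewrite convolE (@cactE _ _ _ _ _ _ [set idg (tgt g)]).
- rewrite fset_set1 finmap.big_seq_fset1 -[_ *: _]/(_ * _) ginv_idg.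
  by rewrite mul_idl.
- exact: finite_set1.
- by move=> _ ->; exact: (@tgt_idg G).
- move=> h hg /f1u he; apply: arr_eq_tgt; last by rewrite he elt_idg.
  by rewrite tgt_idg.
Qed.

Lemma unit_arr g : elt g = 1%g -> g = idg (tgt g).
Proof.
by move=> ge; apply: arr_eq_tgt; rewrite ?tgt_idg ?elt_idg.
Qed.

(** If both [h^-1] and [h^-1 g] lie over [c], then [g] lies over 1 and is a unit; a single term of
    the sum remains. *)
Lemma convol_star_slice c f g : (forall h, f h != 0 -> elt h = c) ->
  convol (star f) f g =
    if elt g == 1%g then (cabs (slice f c (src g)) ^+ 2)%:C else 0.
Proof.
move=> fc; rewrite (@convol_sliceE _ _ _ _ _ _ _ [set c^-1%g]).
- rewrite fset_set1 finmap.big_seq_fset1 invgK.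
  have -> : slice (star f \o @inv G) c (tgt g) = (slice f c (tgt g))^*.
    rewrite /slice; case: asboolP => _; last by rewrite conjC0.
    by rewrite /= /star ginvK.
  have [ge|ge] := eqVneq (elt g) 1%g.
    rewrite ge mulg1 -mulcc_conj mulrC.
    by rewrite (unit_arr ge) src_idg tgt_idg.
  rewrite [X in _ * X](_ : _ = 0) ?mulr0// /slice; case: asboolP => // cg.
  apply/eqP; apply: contraNT ge => /fc; rewrite elt_larr// => /eqP.
  by rewrite -{2}(mulg1 c) => /eqP/mulgI ->.
- exact: finite_set1.
- by move=> h; rewrite /star conjC_eq0 => /fc /=; rewrite elt_inv => <-; rewrite invgK.
Qed.

(** For [w] real and at most 1, the value [p] solves [2 p = w + p^2], the equation required by
    [rep_contraction]. It vanishes at 0, so composing with it preserves compact support. *)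
Let sqrt_part (w : R[i]) : R[i] := (1 - Num.sqrt (1 - complex.Re w))%:C.

Let sqrt_part_continuous : continuous (sqrt_part : C -> C).
Proof.
have c1 : continuous (fun w : C => 1 - complex.Re w : R).
  exact: (continuous_1B (@Re_continuous R)).
exact: (real_complex_comp_continuous (continuous_1B (continuous_sqrt_comp c1))).
Qed.

(** [f^* f] is supported on the units, where convolution is pointwise multiplication by
    [convol_units], so the function needed in [rep_contraction] is obtained by applying [sqrt_part]
    pointwise. The bound is the same for all representations. *)
Lemma rep_slice_le (H : hilbert R) (rho : representation G H) c f v :
  Cc f -> (forall h, f h != 0 -> elt h = c) -> (forall h, cabs (f h) <= 1) ->
  hre (rho f v) (rho f v) <= hre v v.
Proof.
move=> Cf fc f1.
pose k := convol (star f) f; pose psi := sqrt_part \o k.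
have Ck : Cc k by apply: Cc_convol => //; exact: Cc_star.
have sp0 : sqrt_part 0 = 0 by rewrite /sqrt_part /= subr0 sqrtr1 subrr.
have Cpsi : Cc psi by apply: Cc_comp.
have kE g : k g = if elt g == 1%g then (cabs (slice f c (src g)) ^+ 2)%:C
  else 0 by exact: convol_star_slice.
have psiE g : psi g = sqrt_part (k g) by [].
have psi_unit g : psi g != 0 -> elt g = 1%g.
  have [//|ge] := eqVneq (elt g) 1%g.
  by rewrite psiE kE (negbTE ge) sp0 eqxx.
apply: (@rep_contraction _ _ _ rho f psi) => //.
- exact: Cc_star.
- exact: Cc_convol.
- apply/funext => g; rewrite /star.
  have [ge|ge] := eqVneq (elt g) 1%g.
    have -> : inv g = g by rewrite (unit_arr ge) ginv_idg.
    by rewrite psiE /sqrt_part; apply: complex_eq; rewrite ?Re_conj ?Im_conj//= oppr0.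
  have psi0 h : elt h != 1%g -> psi h = 0.
    by move=> he; apply/eqP; apply: contraNT he => /psi_unit ->.
  rewrite !psi0 ?conjC0// elt_inv; apply: contra ge => /eqP ge.
  by rewrite -(invgK (elt g)) ge invg1.
- move=> g; rewrite (convol_units _ _ psi_unit) -/k.
  have [ge|ge] := eqVneq (elt g) 1%g; last first.
    by rewrite [psi g]psiE kE (negbTE ge) sp0 mulr0 !addr0.
  rewrite -(unit_arr ge) psiE kE ge eqxx /sqrt_part /=.
  set m := cabs _ ^+ 2.
  have m1 : m <= 1.
    rewrite /m expr_le1// ?cabs_ge0// /slice; case: asboolP => // _.
    by rewrite cabs0.
  rewrite -rmorphM -!rmorphD /=; congr (_%:C).
  have : Num.sqrt (1 - m) ^+ 2 = 1 - m by rewrite sqr_sqrtr// subr_ge0.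
  set s := Num.sqrt _; rewrite expr2 => s2; rewrite mulrBr !mulrBl s2; lra.
Qed.

End slice_bound.

(** * Isotropy and induction *)

Section isotropy_theory.
Context (R : realType) (G : groupoid) (x : obj G).
Local Notation S := (isotropy x).
Local Notation iv := (@isotropy_val G x).
Implicit Types (s t : arr S) (f : arr S -> R[i]).

Lemma iv_src s : src (iv s) = x. Proof. exact: isotropy_src. Qed.
Lemma iv_tgt s : tgt (iv s) = x. Proof. exact: isotropy_tgt. Qed.

Lemma iv_inj : injective iv. Proof. by move=> s t /val_inj. Qed.

Lemma iv_mul s t : iv (mul s t) = mul (iv s) (iv t). Proof. by []. Qed.
Lemma iv_inv s : iv (inv s) = inv (iv s). Proof. by []. Qed.
Lemma iv_idg : iv (idg (tt : obj S)) = idg x. Proof. by []. Qed.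

Lemma iso_src_tgt s t : src s = tgt t. Proof. by case: (src s) (tgt t) => -[]. Qed.

Lemma isoVK s t : mul (inv s) (mul s t) = t.
Proof. by apply: gmulK; exact: iso_src_tgt. Qed.
Lemma isoKV s t : mul s (mul (inv s) t) = t.
Proof. by apply: gmulKV; case: (tgt s) (tgt t) => -[]. Qed.

Lemma isotropy_tgt_fiber (u : obj S) : tgt_fiber u = setT.
Proof. by apply/seteqP; split => // s _; case: u. Qed.

Lemma isotropy_Cc f : Cc f <-> finite_set [set s | f s != 0].
Proof.
pose T : discreteTopologicalType := discrete_topology (isotropy_set x).
have cl (A : set (arr S)) : closure A = A.
  by apply/esym/closure_id; exact: (@discrete_closed T A).
split=> [[_]|ff].
  by rewrite cl; exact: (@compact_discrete_finite T).
split; last by rewrite cl; exact: finite_compact.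
move=> s; move=> U Us.
have n : nbhs (s : arr S) [set s] by exact: (@discrete_set1 T s).
suff : nbhs (s : arr S) (f @^-1` U) by [].
apply: (@filterS _ _ (nbhs_filter (s : arr S)) _ _ _ n) => t ->.
exact: (@nbhs_singleton (R[i] : numClosedFieldType) _ _ Us).
Qed.

Lemma Cc_delta s : Cc (delta R s : arr S -> R[i]).
Proof.
apply/isotropy_Cc; apply: (@sub_finite_set _ _ [set s]) => // t /=.
by rewrite /delta; have [->|_] := eqVneq s t; rewrite ?eqxx.
Qed.

Lemma convol_delta s f t : convol (delta R s) f t = f (mul (inv s) t).
Proof.
rewrite convolE (@cactE _ _ _ _ _ _ [set s]).
- by rewrite fset_set1 finmap.big_seq_fset1 /delta eqxx scale1r.
- exact: finite_set1.
- by rewrite isotropy_tgt_fiber.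
- by move=> u _; rewrite /delta; have [->|_] := eqVneq s u; rewrite ?eqxx.
Qed.

Lemma star_delta s : star (delta R s) = delta R (inv s).
Proof.
apply/funext => t; rewrite /star /delta.
have -> : (s == inv t) = (inv s == t).
  by apply/eqP/eqP => [->|<-]; rewrite ginvK.
by rewrite conjC_nat.
Qed.

Lemma convol_delta_delta s t :
  convol (delta R s) (delta R t) = delta R (mul s t).
Proof.
apply/funext => u; rewrite convol_delta /delta.
congr (_%:R); congr nat_of_bool.
by apply/eqP/eqP => [->|<-]; rewrite ?isoKV ?isoVK.
Qed.

Context (H : hilbert R) (rho : representation S H).
Implicit Types (v : H).

(** [delta_s^* delta_s] is the unit of the group algebra, an idempotent, and [psi] can be that unit.
    A representation may be degenerate, so this is a contraction and not always an isometry. *)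
Lemma rep_delta_le s v : hre (rho (delta R s) v) (rho (delta R s) v) <= hre v v.
Proof.
have e : mul (inv s) s = idg (src s) by rewrite mul_invl.
have k : convol (star (delta R s)) (delta R s) = delta R (idg (src s)).
  by rewrite star_delta convol_delta_delta e.
have kk : convol (delta R (idg (src s))) (delta R (idg (src s))) = delta R (idg (src s)).
  rewrite convol_delta_delta; congr delta.
  by have := mul_idl (idg (src s) : arr S); rewrite tgt_idg.
apply: (@rep_contraction _ _ _ rho _ (delta R (idg (src s)))).
- exact: Cc_delta.
- by rewrite star_delta; exact: Cc_delta.
- by rewrite k; exact: Cc_delta.
- exact: Cc_delta.
- by rewrite kk; exact: Cc_delta.
- by rewrite star_delta ginv_idg.
- by move=> g; rewrite k kk.
Qed.

Lemma rep_delta_mul s t v :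
  rho (delta R (mul s t)) v = rho (delta R s) (rho (delta R t) v).
Proof. by rewrite -rep_convol ?convol_delta_delta//; exact: Cc_delta. Qed.

Lemma Cc_S_lin (b : R[i]) f1 f2 : Cc f1 -> Cc f2 -> Cc (fun s => b * f1 s + f2 s).
Proof.
move=> /isotropy_Cc F1 /isotropy_Cc F2; apply/isotropy_Cc.
apply: (@sub_finite_set _ _ ([set s | f1 s != 0] `|` [set s | f2 s != 0])).
  move=> s /= fs; have [f10|?] := eqVneq (f1 s) 0; last by left.
  by right; apply: contra fs => /eqP ->; rewrite f10 mulr0 addr0.
by rewrite finite_setU.
Qed.

Lemma Cc_S0 : Cc (fun _ : arr S => 0 : R[i]).
Proof.
by apply/isotropy_Cc; apply: (@sub_finite_set _ _ set0) => // s /=; rewrite eqxx.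
Qed.

Lemma rep0 v : rho (fun=> 0) v = 0.
Proof.
have := rep_linear rho (-1) Cc_S0 Cc_S0 v.
by rewrite (_ : (fun g => _) = fun=> 0) ?scaleN1r ?addNr//;
  apply/funext => s; rewrite mulr0 addr0.
Qed.

Lemma rep_sum (I : Type) (r : seq I) (b : I -> R[i]) (F : I -> arr S -> R[i]) v :
  (forall i, Cc (F i)) ->
  Cc (fun s => \sum_(i <- r) b i * F i s) /\
  rho (fun s => \sum_(i <- r) b i * F i s) v = \sum_(i <- r) b i *: rho (F i) v.
Proof.
move=> CF; elim: r => [|i r [Cr IH]].
  have -> : (fun s => \sum_(i <- [::]) b i * F i s) = fun=> 0.
    by apply/funext => s; rewrite big_nil.
  by split; [exact: Cc_S0|rewrite rep0 big_nil].
have -> : (fun s => \sum_(j <- i :: r) b j * F j s) =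
    fun s => b i * F i s + \sum_(j <- r) b j * F j s.
  by apply/funext => s; rewrite big_cons.
by split; [exact: Cc_S_lin|rewrite rep_linear// big_cons IH].
Qed.

Lemma rep_expand f v (A : set (arr S)) : finite_set A ->
  (forall s, f s != 0 -> A s) ->
  rho f v = \sum_(s <- fset_set A) f s *: rho (delta R s) v.
Proof.
move=> fA fsA.
have [_ <-] := @rep_sum _ (fset_set A) f (fun s => delta R s) v Cc_delta.
congr (rho _ v); apply/funext => s.
have [sA|nsA] := pselect (A s); last first.
  rewrite big1_seq => [|t /= /(mem_fset_set fA) At].
    by apply/eqP; apply: contrapT => /negP /fsA.
  rewrite /delta; have [ts|_] := eqVneq t s; last by rewrite mulr0.
  by exfalso; apply: nsA; rewrite -ts.
rewrite -fsbig_finite// (fsbigD1 s)//= /delta eqxx mulr1 fsbig1 ?addr0//.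
by move=> t [_ /= /eqP/negbTE ->]; rewrite mulr0.
Qed.

(* The vector of the induced space supported on the trivial coset with value v
   at the unit. *)
Definition ind_vec v (g : arr G) : H := rho (star (fun s => (g == iv s)%:R)) v.

Lemma ind_vec_iv v s : ind_vec v (iv s) = rho (delta R (inv s)) v.
Proof.
by rewrite /ind_vec -star_delta; congr (rho (star _) v).
Qed.

Lemma ind_vec_out v g : (forall s, iv s <> g) -> ind_vec v g = 0.
Proof.
move=> gn; rewrite -(rep0 v) /ind_vec; congr (rho _ v); apply/funext => s.
by rewrite /star; have [/esym/gn//|_] := eqVneq g (iv (inv s)); rewrite ?conjC0.
Qed.

End isotropy_theory.

Section induced_vector.
Context (R : realType) (G : groupoid) (x : obj G) (H : hilbert R).
Local Notation S := (isotropy x).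
Local Notation iv := (@isotropy_val G x).
Context (rho : representation S H).
Implicit Types (F : arr G -> R[i]) (v : H) (s : arr S) (g : arr G).

Definition res F : arr S -> R[i] := fun s => F (iv s).

Let c0 : set (arr G) := coset x (idg x).

Lemma coset_idgE : c0 = range iv.
Proof.
have e s : mul (idg x) (iv s) = iv s by have := mul_idl (iv s); rewrite iv_tgt.
by apply/seteqP; split => [_ [s _ <-]|_ [s _ <-]]; exists s => //; rewrite e.
Qed.

Let g0 := xget (idg x) c0.

Lemma coset_repr : exists s0, iv s0 = g0.
Proof.
have : c0 g0.
  apply: (xgetPex (idg x)); exists (idg x); rewrite coset_idgE.
  by exists (idg (tt : obj S)).
by rewrite coset_idgE => -[s _ <-]; exists s.
Qed.

Lemma ind_vec_norm v : (ind_norm x (ind_vec rho v) <= hnorm v)%E.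
Proof.
rewrite /ind_norm /hnorm.
apply: (@le_trans _ _ (sqrte ((complex.Re `|v| ^+ 2)%:E))); last first.
  by rewrite /= sqrtr_sqr ger0_norm// Re_norm_ge0.
rewrite lee_sqrt ?lee_fin ?sqr_ge0//.
apply: (@le_trans _ _ (\esum_(c in [set c0]) (complex.Re `|v| ^+ 2)%:E)%E); last first.
  by rewrite esum_set1 ?lee_fin ?sqr_ge0.
rewrite esum_mkcond [leRHS]esum_mkcond; apply: le_esum => c _.
case: ifPn => [/set_mem [g gx gc]|_]; last by case: ifP; rewrite ?lee_fin ?sqr_ge0.
case: ifPn => [/set_mem ->|cc0].
  have [s0 s0g] := coset_repr; rewrite -/g0 -s0g ind_vec_iv -!hre_norm lee_fin.
  exact: rep_delta_le.
(* A nontrivial coset contributes 0: an isotropy arrow in [c] would make [c] the trivial coset. *)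
rewrite ind_vec_out ?normr0 ?expr0n//= => s sc.
have : c (iv s).
  rewrite sc; apply: xgetPex; exists g; rewrite -gc.
  by exists (idg (tt : obj S)) => //; rewrite -gx mul_idr.
rewrite -gc => -[t _ gt]; move/negP: cc0; apply; apply/mem_set => /=.
have gE : g = iv (@mul S s (inv t)).
  by rewrite iv_mul iv_inv -gt gmulVr// iv_tgt.
rewrite -gc; apply/seteqP; rewrite coset_idgE; split => [_ [u _ <-]|_ [u _ <-]].
  by exists (@mul S (@mul S s (inv t)) u) => //; rewrite iv_mul gE.
exists (@mul S (inv (@mul S s (inv t))) u) => //.
by rewrite gE -iv_mul isoKV.
Qed.

Lemma ind_vec_space v : ind_space rho (ind_vec rho v).
Proof.
split.
- by move=> g gx; apply: ind_vec_out => s sg; apply: gx; rewrite -sg iv_src.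
- move=> g h gx; rewrite -/(iv h) star_delta.
  have [[s sg]|no] := pselect (exists s, iv s = g).
    rewrite -sg -iv_mul !ind_vec_iv -rep_delta_mul; congr (rho (delta R _) v).
    by rewrite ginvM//; exact: iso_src_tgt.
  rewrite !ind_vec_out ?linear0//.
    by move=> s sg; apply: no; exists s.
  move=> s sg; apply: no; exists (@mul S s (inv h)).
  by rewrite iv_mul iv_inv sg gmulVr// iv_tgt.
- by apply: le_lt_trans (ind_vec_norm v) _; exact: ltry.
Qed.

(** The vector vanishes off the isotropy arrows, so at [iv s0] only arrows [h = s0 s^-1] contribute,
    and [F] enters through its restriction alone. *)
Lemma ind_ind_vec F v s0 : tgt_finite F -> Cc (res F) ->
  ind F (ind_vec rho v) (iv s0) = rho (delta R (inv s0)) (rho (res F) v).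
Proof.
move=> tF CF; have fS := (isotropy_Cc (res F)).1 CF.
set A := [set s | res F s != 0] in fS.
rewrite (rep_expand rho v fS)// linear_sum.
rewrite -[LHS]/(cact F (ind_vec rho v) (iv s0)).
pose B := tgt_fiber x `&` [set h | F h != 0].
have fB : finite_set B by exact: tF.
have txs : tgt (iv s0) = x by rewrite iv_tgt.
rewrite /cact txs (@fsum_finE _ _ _ (iv @` A)).
- rewrite -fsbig_finite; last exact: finite_image.
  rewrite fsbig_image; last by move=> s t _ _; exact: iv_inj.
  rewrite -fsbig_finite//; apply: eq_fsbigr => s _.
  rewrite linearZ -rep_delta_mul -iv_inv -iv_mul ind_vec_iv.
  by rewrite ginvM ?ginvK//; exact: iso_src_tgt.
- exact: finite_image.
- by move=> _ [s _ <-]; exact: iv_tgt.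
- move=> h hx nA; have [->|Fh] := eqVneq (F h) 0; first by rewrite scale0r.
  rewrite ind_vec_out ?scaler0// => s sh; apply: nA.
  have hE : h = iv (@mul S s0 (inv s)).
    have sh' : src (inv h) = tgt (iv s0) by rewrite src_inv txs.
    by rewrite iv_mul iv_inv sh ginvM// ginvK gmulKV// txs.
  by exists (@mul S s0 (inv s)); rewrite // /A /= /res -hE.
Qed.

Lemma rep_res_le F v : tgt_finite F -> Cc (res F) ->
  (hnorm (rho (res F) v) <= ind_norm x (ind F (ind_vec rho v)))%E.
Proof.
move=> tF CF; have [s0 s0g] := coset_repr.
have le0 : complex.Re `|rho (res F) v| <=
    complex.Re `|ind F (ind_vec rho v) g0|.
  rewrite -s0g ind_ind_vec//; set w := rho (res F) v.
  (* [xget] may return any isotropy arrow [s0], and the value there is [w] moved by [s0^-1]; moving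
     it back does not increase the norm. That the unit of the group algebra fixes [w] is clear only
     because [w] lies in the range of [rho (res F)]. *)
  have wE : w = rho (delta R s0) (rho (delta R (inv s0)) w).
    rewrite -rep_delta_mul mul_invr /w -rep_convol//; last exact: Cc_delta.
    congr (rho _ v); apply/funext => t; rewrite convol_delta ginv_idg.
    by rewrite (_ : tgt s0 = tgt t) ?mul_idl//; case: (tgt s0) (tgt t) => -[].
  rewrite {1}wE -!hnormE (sip_norm_le (@hre_ge0 R H)) ?sip_norm_ge0//.
  by rewrite (sip_norm_sq (@hre_ge0 R H)) rep_delta_le.
rewrite /ind_norm.
apply: (@le_trans _ _ (sqrte ((complex.Re `|ind F (ind_vec rho v) g0|) ^+ 2)%:E)).
  by rewrite /= sqrtr_sqr ger0_norm ?Re_norm_ge0// lee_fin.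
rewrite lee_sqrt ?lee_fin ?sqr_ge0//; last first.
  by apply: esum_ge0 => c _; rewrite lee_fin sqr_ge0.
apply: (@esum_term_le _ _ _ (fun c => ((complex.Re
  `|ind F (ind_vec rho v) (xget (idg x) c)|) ^+ 2)%:E) c0) => [|c].
  by exists (idg x) => //; exact: src_idg.
by rewrite lee_fin sqr_ge0.
Qed.

Lemma rep_res_le_opnorm F v : tgt_finite F -> Cc (res F) ->
  (hnorm v <= 1)%E ->
  (hnorm (rho (res F) v) <= opnorm (ind_space rho) (@ind_norm R G x H) (ind F))%E.
Proof.
move=> tF CF v1; apply: le_trans (rep_res_le v tF CF) _.
apply: ereal_sup_ubound; exists (ind_vec rho v) => //; split.
  exact: ind_vec_space.
exact: le_trans (ind_vec_norm v) v1.
Qed.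

End induced_vector.

(** * Restriction to the isotropy group and extension from it *)

Section stabilizer.
Context (R : realType) (Gam : groupType) (X : topologicalType)
  (a : partial_action Gam X).
Hypothesis hX : hausdorff_space X.
Local Notation G := (action_groupoid a).
Local Notation C := (R[i] : numClosedFieldType).
Context (x : X).
Local Notation S := (isotropy (G := G) x).
Local Notation iv := (@isotropy_val G x).
Local Notation resx := (@res R G x).
Implicit Types (F K : arr G -> R[i]) (g h : arr G) (s t : arr S) (c : Gam).

Definition selt s : Gam := elt (iv s).

Lemma selt_inj : injective selt.
Proof. by move=> s t st; apply: iv_inj; apply: arr_eq_src; rewrite ?iv_src. Qed.

Lemma selt_mul s t : selt (mul s t) = (selt s * selt t)%g.
Proof. by rewrite /selt iv_mul elt_mul// iv_src iv_tgt. Qed.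

Lemma selt_inv s : selt (inv s) = (selt s)^-1%g.
Proof. by rewrite /selt iv_inv elt_inv. Qed.

Definition stab_supp F := forall g, F g != 0 -> exists s, selt s = elt g.

Lemma stab_supp_convol F K : stab_supp F -> stab_supp K -> stab_supp (convol F K).
Proof.
move=> sF sK g /convol_neq0[h hg [/sF[s sh] /sK[t th]]].
exists (mul s t); rewrite selt_mul sh th elt_mul ?src_inv// elt_inv.
by rewrite mulgA mulgV mul1g.
Qed.

Lemma stab_supp_star F : stab_supp F -> stab_supp (star F).
Proof.
move=> sF g; rewrite /star conjC_eq0 => /sF[s sg]; exists (inv s).
by rewrite selt_inv sg elt_inv invgK.
Qed.

Lemma stab_supp_lin (b : R[i]) F K : stab_supp F -> stab_supp K ->
  stab_supp (fun g => b * F g + K g).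
Proof.
move=> sF sK g; have [Fg|/sF//] := eqVneq (F g) 0.
by rewrite Fg mulr0 add0r => /sK.
Qed.

(** An arrow with target [x] whose group element is that of an isotropy arrow coincides with it. The
    support condition thus excludes products that leave [x] and come back, the terms by which
    restriction fails to be multiplicative. *)
Lemma res_convol F K : stab_supp F ->
  resx (convol F K) = convol (resx F) (resx K).
Proof.
move=> sF; apply/funext => s; rewrite /res [RHS]/convol isotropy_tgt_fiber.
rewrite [LHS]/convol iv_tgt.
have iinj : set_inj [set: arr S] iv by move=> ? ? _ _; exact: iv_inj.
rewrite -(fsbig_widen (iv @` [set: arr S])).
- by rewrite fsbig_image.
- by move=> _ [t _ <-]; exact: iv_tgt.
- move=> h [hx nh] /=; have [->|/sF[t th]] := eqVneq (F h) 0; first by rewrite mul0r.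
  exfalso; apply: nh; exists t => //; apply: arr_eq_tgt => //.
  by rewrite iv_tgt.
Qed.

Lemma Cc_res F : Cc F -> Cc (resx F).
Proof.
move=> /Cc_finite_elt fF; apply/isotropy_Cc.
apply: (@finite_set_inj_image _ _ _ selt) => [s t _ _|]; first exact: selt_inj.
by apply: sub_finite_set fF => _ [s fs <-]; exists (iv s).
Qed.

Context (f : arr S -> R[i]).
Hypothesis f_Cc : Cc f.

(** [f] carried to [Gam] along the injection [selt] and extended by 0. *)
Definition coef c : R[i] :=
  if pselect (exists s, selt s = c) is left e then f (projT1 (cid e)) else 0.

Lemma coef_selt s : coef (selt s) = f s.
Proof.
rewrite /coef; case: pselect => [e|[]]; last by exists s.
by case: cid => t /= /selt_inj ->.
Qed.

Lemma coef_neq0 c : coef c != 0 -> exists2 s, selt s = c & f s != 0.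
Proof.
rewrite /coef; case: pselect => [e|_]; last by rewrite eqxx.
by case: cid => t /= tc ft; exists t.
Qed.

Definition coef_supp : set Gam := selt @` [set s | f s != 0].

Lemma coef_supp_finite : finite_set coef_supp.
Proof. exact/finite_image/isotropy_Cc. Qed.

Context (phi : X -> R) (K : set X).
Hypothesis phi_cont : continuous phi.
Hypothesis phi01 : forall z, 0 <= phi z <= 1.
Hypothesis phix : phi x = 1.
Hypothesis cK : compact K.
Hypothesis phiK : forall z, phi z != 0 -> K z.
Hypothesis K_dom : forall c, coef_supp c -> K `<=` pdom a c^-1%g.

Definition bump2 g : R[i] := (phi (tgt g) * phi (src g))%:C.

Definition ext g : R[i] := coef (elt g) * bump2 g.

(** The membership test puts this function in [Cc] for every [c], as [Cc_sum_ag] requires: for [c]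
    outside [coef_supp] nothing relates [K] to the domain of [c]. *)
Definition ext_slice c g : R[i] :=
  (elt g == c)%:R * (if c \in coef_supp then bump2 g else 0).

Lemma ext_slices g : ext g =
  \sum_(c <- fset_set coef_supp) coef c * ext_slice c g.
Proof.
have [cs|ncs] := pselect (coef_supp (elt g)).
  rewrite -fsbig_finite; last exact: coef_supp_finite.
  rewrite (fsbigD1 (elt g))//=; last exact: coef_supp_finite.
  rewrite /ext_slice eqxx mul1r mem_set// fsbig1 ?addr0//.
  by move=> c [_ /= /eqP]; rewrite eq_sym => /negbTE ->; rewrite mul0r mulr0.
rewrite /ext; have -> : coef (elt g) = 0.
  apply/eqP; apply: contrapT => /negP /coef_neq0[s sg fs].
  by apply: ncs; exists s.
rewrite mul0r big1_seq// => c /= /(mem_fset_set coef_supp_finite) cs.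
rewrite /ext_slice; have [gc|_] := eqVneq (elt g) c; last by rewrite mul0r mulr0.
by exfalso; apply: ncs; rewrite gc.
Qed.

Lemma bump2_continuous : continuous (bump2 : arr G -> C).
Proof.
apply: real_complex_comp_continuous => g.
have ct := continuous_comp (@ag_tgt_continuous _ _ a g) (@phi_cont (tgt g)).
have cs := continuous_comp (@ag_src_continuous _ _ a g) (@phi_cont (src g)).
exact: (cvgM ct cs).
Qed.

Lemma Cc_ext_slice c : Cc (ext_slice c).
Proof.
have [/set_mem cs|ncs] := boolP (c \in coef_supp); last first.
  rewrite /ext_slice (negbTE ncs) (_ : (fun g => _) = fun=> 0); first exact: Cc0.
  by apply/funext => g; rewrite mulr0.
rewrite /ext_slice mem_set//.
apply: (Cc_slice hX cK (K_dom cs) bump2_continuous) => g.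
rewrite /bump2 => gn; apply: phiK; apply: contra gn => /eqP ->.
by rewrite mulr0.
Qed.

Lemma ext_slice_elt c h : ext_slice c h != 0 -> elt h = c.
Proof. by rewrite /ext_slice; have [//|_] := eqVneq (elt h) c; rewrite mul0r eqxx. Qed.

Lemma ext_slice_le1 c h : cabs (ext_slice c h) <= 1.
Proof.
rewrite /ext_slice; case: (elt h == c); rewrite ?mul0r ?cabs0 ?mul1r//.
case: ifP => _; last by rewrite cabs0.
rewrite /bump2 cabs_real.
have /andP[t0 t1] := phi01 (tgt h); have /andP[s0 s1] := phi01 (src h).
by rewrite ger0_norm ?mulr_ge0// mulr_ile1.
Qed.

Lemma Cc_sum_ag (I : Type) (r : seq I) (b : I -> R[i]) (F : I -> arr G -> R[i])
    (H : hilbert R) (rho : representation G H) (v : H) :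
  (forall i, Cc (F i)) ->
  Cc (fun g => \sum_(i <- r) b i * F i g) /\
  rho (fun g => \sum_(i <- r) b i * F i g) v = \sum_(i <- r) b i *: rho (F i) v.
Proof.
move=> CF; elim: r => [|i r [Cr IH]].
  have -> : (fun g => \sum_(i <- [::]) b i * F i g) = fun=> 0.
    by apply/funext => g; rewrite big_nil.
  split; first exact: Cc0.
  rewrite big_nil.
  have := rep_linear rho (-1) (@Cc0 R _ _ a hX) (@Cc0 R _ _ a hX) v.
  by rewrite (_ : (fun g => _) = fun=> 0) ?scaleN1r ?addNr//;
    apply/funext => g; rewrite mulr0 addr0.
have -> : (fun g => \sum_(j <- i :: r) b j * F j g) =
    fun g => b i * F i g + \sum_(j <- r) b j * F j g.
  by apply/funext => g; rewrite big_cons.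
by split; [exact: Cc_lin|rewrite rep_linear// big_cons IH].
Qed.

Lemma Cc_ext : Cc ext.
Proof.
have -> : ext = fun g => \sum_(c <- fset_set coef_supp) coef c * ext_slice c g.
  by apply/funext => g; exact: ext_slices.
elim: (enum_fset (fset_set coef_supp)) => [|c r IH].
  have -> : (fun g => \sum_(i <- [::]) coef i * ext_slice i g) = fun=> 0.
    by apply/funext => g; rewrite big_nil.
  exact: Cc0.
have -> : (fun g => \sum_(j <- c :: r) coef j * ext_slice j g) =
    fun g => coef c * ext_slice c g + \sum_(j <- r) coef j * ext_slice j g.
  by apply/funext => g; rewrite big_cons.
by apply: Cc_lin IH => //; exact: Cc_ext_slice.
Qed.

Lemma stab_supp_ext : stab_supp ext.
Proof.
move=> g; rewrite /ext mulf_eq0 negb_or => /andP[/coef_neq0[s sg _] _].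
by exists s.
Qed.

Lemma res_ext : resx ext = f.
Proof.
apply/funext => s; rewrite /res /ext /bump2 iv_src iv_tgt phix mulr1 mulr1.
exact: coef_selt.
Qed.

Definition ext_bound : R := \sum_(c <- fset_set coef_supp) cabs (coef c).

Lemma ext_bound_ge0 : 0 <= ext_bound.
Proof. by apply: sumr_ge0 => c _; exact: cabs_ge0. Qed.

(** [ext] is a combination of functions of modulus at most 1, each on one slice, so [rep_slice_le]
    applies termwise. The constant is the [l^1] norm of [f] and does not depend on [rho]. *)
Lemma rep_ext_le (H : hilbert R) (rho : representation G H) v :
  sip_norm (@hre R H) (rho ext v) <= ext_bound * sip_norm (@hre R H) v.
Proof.
have -> : ext = fun g => \sum_(c <- fset_set coef_supp) coef c * ext_slice c g.
  by apply/funext => g; exact: ext_slices.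
have [_ ->] := Cc_sum_ag (fset_set coef_supp) coef rho v Cc_ext_slice.
rewrite /ext_bound; elim: (enum_fset (fset_set coef_supp)) => [|c r IH].
  by rewrite !big_nil mul0r hnormE normr0.
rewrite !big_cons mulrDl.
apply: le_trans (sip_normD (@hreD R H) (@hreZ R H) (@hreC R H) (@hre_ge0 R H) _ _) _.
apply: lerD => //; rewrite !hnormE normrZ.
have -> : complex.Re (`|coef c| * `|rho (ext_slice c) v|) =
    cabs (coef c) * complex.Re `|rho (ext_slice c) v|.
  by rewrite normcE ReZ.
rewrite ler_wpM2l ?cabs_ge0// -!hnormE (sip_norm_le (@hre_ge0 R H)) ?sip_norm_ge0//.
rewrite (sip_norm_sq (@hre_ge0 R H)).
apply: (@rep_slice_le R Gam X a hX H rho c); [exact: Cc_ext_slice|exact: ext_slice_elt|].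
exact: ext_slice_le1.
Qed.

End stabilizer.

Lemma esum_partition (R : realType) (J : choiceType) (P : set J)
    (cl : J -> set J) (u : J -> \bar R) :
  (forall j, P j -> cl j `<=` P) -> (forall j, P j -> cl j j) ->
  (forall j k, P j -> cl j k -> cl k = cl j) -> (forall j, 0 <= u j)%E ->
  (\esum_(j in P) u j = \esum_(c in cl @` P) \esum_(k in c) u k)%E.
Proof.
move=> clP cl_refl cl_eq u0.
rewrite (esum_esum (a := fun c k => u k))//.
rewrite [RHS](@reindex_esum _ _ _ P _ (fun j => (cl j, j)))//.
split=> [j Pj|j k _ _ []//|[c k] /= [[j Pj <-] clk]].
- by split => /=; [exists j|exact: cl_refl].
- by exists k; [exact: clP clk|rewrite (cl_eq j)].
Qed.

(** The orbits partition [J], and freeness identifies each of them with [T], so the inequality can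
    be summed orbit by orbit. *)
Lemma le_esum_orbits (R : realType) (T J : choiceType) (act : T -> J -> J)
    (C : R) (u w : J -> \bar R) :
  0 <= C -> (forall j, exists t, act t j = j) ->
  (forall t j, range (act^~ (act t j)) = range (act^~ j)) ->
  (forall j, injective (act^~ j)) ->
  (forall j, 0 <= u j)%E -> (forall j, 0 <= w j)%E ->
  (forall j, \esum_(t in [set: T]) u (act t j) <=
             C%:E * \esum_(t in [set: T]) w (act t j))%E ->
  (\esum_(j in [set: J]) u j <= C%:E * \esum_(j in [set: J]) w j)%E.
Proof.
move=> C0 act_id act_orb act_inj u0 w0 uw.
have part (v : J -> \bar R) : (forall j, 0 <= v j)%E ->
    (\esum_(j in [set: J]) v j =
      \esum_(c in range (fun j => range (act^~ j))) \esum_(k in c) v k)%E.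
  move=> v0; apply: esum_partition => // [j _|j k _ [t _ <-]].
    by have [t tj] := act_id j; exists t.
  exact: act_orb.
rewrite !part// -esumZl//; last first.
  by move=> c; apply: esum_ge0.
apply: le_esum => _ [j _ <-].
have bij : set_bij [set: T] (range (act^~ j)) (act^~ j).
  by split => [t _|t t' _ _|//]; [exists t|exact: act_inj].
by rewrite !(@reindex_esum _ _ _ _ _ _ _ bij).
Qed.

(** * The reduced norm *)

Section regular_representation.
Context (R : realType) (G : groupoid).
Implicit Types (f : arr G -> R[i]) (xi : arr G -> R[i]) (g h k : arr G).

Lemma convol_src f xi k :
  convol f xi k = \sum_(g \in src_fiber (src k)) f (mul k (inv g)) * xi g.
Proof.
rewrite (@reindex_fsbig _ _ _ _ _ (fun h => mul (inv h) k) (tgt_fiber (tgt k))).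
  apply: eq_fsbigr => h /set_mem; rewrite /tgt_fiber/= => hk.
  congr (f _ * _); rewrite ginvM ?src_inv// ginvK.
  have sk : src k = tgt (inv k) by rewrite tgt_inv.
  rewrite mul_assoc ?tgt_inv ?src_inv// mul_invr -hk.
  by rewrite mul_idl.
split.
- by move=> h; rewrite /tgt_fiber /src_fiber /= => hk; rewrite src_mul ?src_inv.
- move=> h h' /set_mem; rewrite /tgt_fiber/= => hk /set_mem; rewrite /tgt_fiber/= => h'k e.
  have : inv h = inv h'.
    rewrite -(gmulVr (h := inv h) (k := k)) ?src_inv//.
    by rewrite e gmulVr ?src_inv.
  by move/(congr1 (@inv G)); rewrite !ginvK.
- move=> g; rewrite /src_fiber/= => gk; exists (mul k (inv g)).
    by rewrite /tgt_fiber/= tgt_mul ?tgt_inv.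
  by rewrite ginvM ?tgt_inv// ginvK gmulVl.
Qed.

(** In the inner sum [delta (h g) k] selects [h = k g^-1], which exists exactly when [k] has source
    [y]. *)
Lemma regular_convol (y : obj G) f xi : (forall g, src g <> y -> xi g = 0) ->
  regular y f xi = convol f xi.
Proof.
move=> xi0; apply/funext => k.
have inner g : src g = y ->
    \sum_(h \in src_fiber (tgt g)) f h * delta R (mul h g) k =
    if pselect (src k = y) then f (mul k (inv g)) else 0.
  move=> gy; case: pselect => [ky|nky].
    have kg : src k = tgt (inv g) by rewrite tgt_inv ky.
    rewrite (@fsum_finE _ _ _ [set mul k (inv g)]).
    - rewrite fset_set1 finmap.big_seq_fset1 /delta gmulVl ?gy// eqxx.
      by rewrite mulr1.
    - exact: finite_set1.
    - by move=> _ ->; rewrite /src_fiber/= src_mul// src_inv.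
    - move=> h; rewrite /src_fiber/= => hg nh; rewrite /delta.
      have [hk|_] := eqVneq (mul h g) k; last by rewrite mulr0.
      by exfalso; apply: nh; rewrite -hk /= gmulVr.
  apply: fsbig1 => h; rewrite /src_fiber/= => hg; rewrite /delta.
  have [hk|_] := eqVneq (mul h g) k; last by rewrite mulr0.
  by exfalso; apply: nky; rewrite -hk src_mul.
have -> : regular y f xi k = \sum_(g \in src_fiber y)
    xi g * (if pselect (src k = y) then f (mul k (inv g)) else 0).
  by apply: eq_fsbigr => g /set_mem gy; rewrite inner.
rewrite convol_src; case: pselect => [ky|nky].
  by rewrite /= ky; apply: eq_fsbigr => g _; rewrite mulrC.
rewrite fsbig1 => [|g _]; last by rewrite mulr0.
rewrite fsbig1// => g; rewrite /src_fiber/= => gk.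
by rewrite xi0 ?mulr0// gk.
Qed.

Lemma ell2_norm_sqsum (y : obj G) xi : (forall g, src g <> y -> xi g = 0) ->
  ell2_norm y xi = sqrte (sqsum xi).
Proof.
move=> xi0; congr sqrte; rewrite esum_mkcond; apply: eq_esum => g _.
case: ifPn => // /negP gy; rewrite xi0 ?cabs0 ?expr0n// => gy'.
by apply: gy; exact/mem_set.
Qed.

Lemma sqsum_real_le (y : obj G) xi (c : R) : (forall g, src g <> y -> xi g = 0) ->
  0 <= c -> (ell2_norm y xi <= c%:E)%E = (sqsum xi <= (c ^+ 2)%:E)%E.
Proof.
move=> xi0 c0; rewrite ell2_norm_sqsum//.
have -> : c%:E = sqrte (c ^+ 2)%:E by rewrite /= sqrtr_sqr ger0_norm.
by rewrite lee_sqrt// lee_fin sqr_ge0.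
Qed.

(* Homogeneity turns the supremum over the unit ball into an operator bound. *)
Lemma reduced_norm_sqsum (y : obj G) f xi (c : R) : 0 <= c ->
  (reduced_norm f <= c%:E)%E -> (forall g, src g <> y -> xi g = 0) ->
  (sqsum xi < +oo)%E ->
  (sqsum (convol f xi) <= (c ^+ 2)%:E * sqsum xi)%E.
Proof.
move=> c0 fc xi0 xioo.
have key (m : R) : 0 < m -> (sqsum xi <= (m ^+ 2)%:E)%E ->
    (sqsum (convol f xi) <= (c ^+ 2 * m ^+ 2)%:E)%E.
  move=> m0 xim; pose zeta g := (m^-1)%:C * xi g.
  have zeta0 g : src g <> y -> zeta g = 0 by move=> gy; rewrite /zeta xi0 ?mulr0.
  have zE : sqsum zeta = ((m ^- 2)%:E * sqsum xi)%E.
    by rewrite sqsumZ cabs_real real_normK ?num_real// exprVn.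
  have z1 : (sqsum zeta <= 1)%E.
    by rewrite zE -exprVn muleC -lee_pdivlMr ?exprn_gt0 ?invr_gt0// mul1e -exprVn invrK.
  have zn : (ell2_norm y zeta <= 1)%E by rewrite sqsum_real_le// expr1n.
  have zconv : convol f zeta = fun g => (m^-1)%:C * convol f xi g.
    apply/funext => g; rewrite /convol mulr_fsumr; apply: eq_fsbigr => h _.
    by rewrite /zeta mulrCA.
  have : (ell2_norm y (regular y f zeta) <= c%:E)%E.
    apply: le_trans fc; apply: (@le_trans _ _ (opnorm (ell2 y) (ell2_norm y) (regular y f))).
      apply: ereal_sup_ubound; exists zeta => //; split => //.
      by split => //; apply: le_lt_trans zn _; exact: ltry.
    by apply: ereal_sup_ubound; exists y.
  have reg0 g : src g <> y -> regular y f zeta g = 0.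
    move=> gy; rewrite regular_convol// convol_src fsbig1// => h.
    by rewrite /src_fiber/= => hg; rewrite zeta0 ?mulr0// hg.
  rewrite sqsum_real_le// regular_convol// zconv sqsumZ cabs_real real_normK ?num_real// exprVn.
  rewrite muleC -lee_pdivlMr ?invr_gt0 ?exprn_gt0// => /le_trans; apply.
  by rewrite -EFinM invrK.
have xiP : xi \in @sqsummable R (arr G) by exact/sqsummableP.
have [n0|n0] := eqVneq (ell2_sq (Ell2 xiP)) 0.
  have xi00 g : xi g = 0 by rewrite -[LHS]/(Ell2 xiP g) (ell2_sq0 n0).
  have -> : convol f xi = fun=> 0.
    by apply/funext => g; apply: fsbig1 => h _; rewrite xi00 mulr0.
  have -> : sqsum (fun _ : arr G => 0 : R[i]) = 0%E.
    by apply: esum1 => g _; rewrite cabs0 expr0n.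
  by rewrite mule_ge0 ?sqsum_ge0// lee_fin sqr_ge0.
have np : 0 < ell2_sq (Ell2 xiP) by rewrite lt_neqAle eq_sym n0 ell2_sq_ge0.
have sE : sqsum xi = (Num.sqrt (ell2_sq (Ell2 xiP)) ^+ 2)%:E.
  by rewrite sqr_sqrtr ?ltW// -ell2_sqE.
by rewrite sE -EFinM; apply: key; rewrite ?sqrtr_gt0// sE.
Qed.

End regular_representation.

Lemma le_esum_subset (R : realType) (J : choiceType) (A B : set J)
    (u : J -> \bar R) : A `<=` B ->
  (\esum_(j in A) u j <= \esum_(j in B) u j)%E.
Proof.
move=> AB; apply: le_ereal_sup => _ [F [fF FA] <-].
by exists F => //; split => //; exact: subset_trans AB.
Qed.

(** * The reduced norm of the extension, orbit by orbit *)

Section orbit_estimate.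
Context (R : realType) (Gam : groupType) (X : topologicalType)
  (a : partial_action Gam X).
Local Notation G := (action_groupoid a).
Context (x : X).
Local Notation S := (isotropy (G := G) x).
Local Notation iv := (@isotropy_val G x).
Context (f : arr S -> R[i]) (phi : X -> R) (K : set X).
Hypothesis f_Cc : Cc f.
Hypothesis phi01 : forall z, 0 <= phi z <= 1.
Hypothesis phiK : forall z, phi z != 0 -> K z.
Hypothesis K_dom : forall c, coef_supp f c -> K `<=` pdom a c^-1%g.
Local Notation J := (Gam * X)%type.
Local Notation se := (@selt Gam X a x).

(** Left multiplication on the group component, with the source fixed. Unlike the multiplication of
    arrows it is defined everywhere. *)
Let act (s : arr S) (j : J) : J := (se s * j.1, j.2)%g.

Let act_mul s t j : act s (act t j) = act (mul s t) j.
Proof. by rewrite /act selt_mul mulgA. Qed.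

Let act1 j : act (idg (tt : obj S)) j = j.
Proof. by case: j => c z; rewrite /act /selt iv_idg elt_idg mul1g. Qed.

Let act_orb t j : range (act^~ (act t j)) = range (act^~ j).
Proof.
apply/seteqP; split => [_ [s _ <-]|_ [s _ <-]].
  by exists (mul s t) => //; rewrite act_mul.
exists (mul s (inv t)) => //; rewrite act_mul; congr act.
by rewrite gmulVl//; case: (src s) (src t) => -[].
Qed.

Let act_inj j : injective (act^~ j).
Proof. by move=> s t [/mulIg/selt_inj]. Qed.

Section vector.
Context (xi : arr G -> R[i]).

(* The vector phi xi of G_z, extended by 0 to the whole group. *)
Let eta (j : J) : R[i] :=
  if `[< pdom a j.1^-1%g j.2 >]
  then (phi (pact a j.1 j.2))%:C * xi (larr a j.1 j.2) else 0.

Let e (g : arr G) : J := (elt g, src g).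

Let e_inj : injective e.
Proof. by move=> g h [ge gs]; apply: arr_eq_src. Qed.

Let e_bij : set_bij [set: arr G] (range e) e.
Proof. by split => [g _|g h _ _|//]; [exists g|exact: e_inj]. Qed.

Let eta_e g : eta (e g) = (phi (tgt g))%:C * xi g.
Proof.
rewrite /eta /e /= asboolT; last exact: src_dom.
by rewrite larrE -[X in phi X]tgtE.
Qed.

Let eta_out j : ~ range e j -> eta j = 0.
Proof.
move=> nj; rewrite /eta; case: asboolP => // cj; exfalso; apply: nj.
exists (larr a j.1 j.2) => //; rewrite /e elt_larr// src_larr.
by case: j cj.
Qed.

Let phi_cabs z : cabs (phi z)%:C <= 1.
Proof. by have /andP[p0 p1] := phi01 z; rewrite cabs_real ger0_norm. Qed.

Let eta_sum : (\esum_(j in [set: J]) (cabs (eta j) ^+ 2)%:E <= sqsum xi)%E.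
Proof.
have -> : (\esum_(j in [set: J]) (cabs (eta j) ^+ 2)%:E =
    \esum_(j in range e) (cabs (eta j) ^+ 2)%:E)%E.
  rewrite [RHS]esum_mkcond; apply: eq_esum => j _.
  case: ifPn => // /negP nj; rewrite eta_out ?cabs0 ?expr0n// => ej.
  by apply: nj; exact/mem_set.
rewrite (@reindex_esum _ _ _ _ _ _ _ e_bij); apply: le_esum => g _.
rewrite lee_fin eta_e cabsM exprMn ler_piMl ?sqr_ge0// expr_le1// ?cabs_ge0//.
Qed.

(** The point is that both sides vanish together. If [phi] is nonzero at [d z], for [z] the source
    of [g], then [d z] lies in [K], where [c] is defined. Hence [c d z], the target of [g], lies in
    the range of [c], and the arrow required on the left exists. *)
Let ext_term (g : arr G) s : f s != 0 ->
  slice (ext f phi \o @inv G) (se s)^-1%g (tgt g) * slice xi ((se s)^-1 * elt g)%g (src g) =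
  (phi (tgt g))%:C * (f s * eta ((se s)^-1 * elt g, src g)%g).
Proof.
move=> fs; set c := se s; set d := (c^-1 * elt g)%g.
have cs : coef_supp f c by exists s.
have cd : (c * d = elt g)%g by rewrite /d mulgA mulgV mul1g.
rewrite {2}/slice /eta /=; case: asboolP => [dz|_]; last by rewrite !mulr0.
rewrite /slice; case: asboolP => [ct|nct].
  rewrite /= /ext /bump2 elt_inv elt_larr// invgK coef_selt.
  rewrite [tgt (inv _)]tgt_inv [src (inv _)]src_inv src_larr tgt_larr//.
  have ct' : pdom a (c^-1)^-1%g (pact a (elt g) (src g)) by rewrite -tgtE.
  have [_ wE] := pactM (src_dom g) ct'.
  have wE' : pact a c^-1%g (ag_tgt g) = pact a d (ag_src g).
    by rewrite -[ag_tgt g]/(tgt g) tgtE -wE.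
  by rewrite wE' (rmorphM (real_complex R)) /=; ring.
rewrite mul0r.
have [->|pw] := eqVneq (phi (pact a d (src g))) 0; first by rewrite mul0r !mulr0.
exfalso; apply: nct; rewrite invgK.
have [_ wE] := pactM dz (K_dom cs (phiK pw)).
by rewrite -[ag_tgt g]/(tgt g) tgtE -cd wE; apply: pdom_act; exact: (K_dom cs (phiK pw)).
Qed.

Let orb j t : R[i] := eta (act t j).

Let convol_orb j t :
  convol f (orb (act t j)) (idg (tt : obj S)) = convol f (orb j) t.
Proof.
rewrite /convol !isotropy_tgt_fiber; apply: eq_fsbigr => s _.
congr (_ * _); rewrite /orb act_mul; congr (eta (act _ j)).
rewrite -mul_assoc; try exact: iso_src_tgt.
by congr mul; have := mul_idl t; case: (tgt t).
Qed.

Let ext_conv (g : arr G) : convol (ext f phi) xi g =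
  (phi (tgt g))%:C * convol f (orb (e g)) (idg (tt : obj S)).
Proof.
have fA : finite_set [set s | f s != 0] by exact/isotropy_Cc.
rewrite (@convol_sliceE _ _ _ _ _ _ _ (coef_supp f)); first last.
- move=> h; rewrite /ext mulf_eq0 negb_or => /andP[/coef_neq0[s sh fs] _].
  by exists s.
- exact: coef_supp_finite.
rewrite -fsbig_finite; last exact: coef_supp_finite.
rewrite fsbig_image; last by move=> s t _ _; exact: selt_inj.
rewrite /convol isotropy_tgt_fiber.
rewrite -(@fsbig_widen _ _ _ _ [set s | f s != 0] [set: arr S])//; last first.
  by move=> s [_ /= /negP/negPn/eqP ->]; rewrite mul0r.
rewrite !fsbig_finite// mulr_sumr; apply: eq_big_seq => s /(mem_fset_set fA) /= fs.
rewrite ext_term//; congr (_ * (_ * eta _)).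
rewrite /act /e /=; congr (_ * _, _)%g.
by rewrite selt_mul selt_inv /selt iv_idg elt_idg mulg1.
Qed.

(** Passing from the arrows to [Gam * X] completes the pieces of orbits to whole orbits. Each is a
    copy of [S], on which the values in question form the left convolution by [f] of a vector of
    [l^2(S)], by [convol_orb]; the factors [phi] are at most 1. *)
Lemma sqsum_convol_ext (c : R) : 0 <= c -> (reduced_norm f <= c%:E)%E ->
  (sqsum xi < +oo)%E ->
  (sqsum (convol (ext f phi) xi) <= (c ^+ 2)%:E * sqsum xi)%E.
Proof.
move=> c0 fc xioo.
pose u j := (cabs (convol f (orb j) (idg (tt : obj S))) ^+ 2)%:E.
apply: (@le_trans _ _ (\esum_(j in [set: J]) u j)%E).
  apply: (@le_trans _ _ (\esum_(j in range e) u j)%E); last exact: le_esum_subset.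
  rewrite (@reindex_esum _ _ _ _ _ _ _ e_bij); apply: le_esum => g _.
  rewrite lee_fin ext_conv cabsM exprMn ler_piMl ?sqr_ge0// expr_le1// ?cabs_ge0//.
apply: (@le_trans _ _ ((c ^+ 2)%:E *
    \esum_(j in [set: J]) (cabs (eta j) ^+ 2)%:E)%E); last first.
  by apply: lee_wpmul2l; [rewrite lee_fin sqr_ge0|exact: eta_sum].
apply: (@le_esum_orbits _ _ _ act).
- exact: sqr_ge0.
- by move=> j; exists (idg (tt : obj S)).
- exact: act_orb.
- exact: act_inj.
- by move=> j; rewrite lee_fin sqr_ge0.
- by move=> j; rewrite lee_fin sqr_ge0.
move=> j.
have -> : (\esum_(t in [set: arr S]) u (act t j) = sqsum (convol f (orb j)))%E.
  by apply: eq_esum => t _; rewrite /u convol_orb.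
apply: (@reduced_norm_sqsum _ _ (tt : obj S)) => //.
apply: le_lt_trans xioo; apply: le_trans eta_sum.
have bij : set_bij [set: arr S] (range (act^~ j)) (act^~ j).
  by split => [t _|t t' _ _|//]; [exists t|exact: act_inj].
rewrite -[leLHS](@reindex_esum _ _ _ _ _ (act^~ j) (fun k => (cabs (eta k) ^+ 2)%:E) bij).
exact: le_esum_subset.
Qed.

End vector.
End orbit_estimate.

(** * Finitely supported functions and truncation *)

Section finite_sums.
Context (R : realType) (I : choiceType).

Lemma usum_fin_supp (g : I -> R) (A : set I) : finite_set A ->
  (forall i, 0 <= g i) -> (forall i, ~ A i -> g i = 0) ->
  usum g = (\sum_(i <- fset_set A) g i)%:E.
Proof.
move=> fA g0 gA; rewrite /usum.
have -> : (\esum_(i in [set: I]) (g i)%:E = \esum_(i in A) (g i)%:E)%E.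
  rewrite [RHS]esum_mkcond; apply: eq_esum => i _.
  by case: ifPn => // /negP nA; rewrite gA// => Ai; apply: nA; exact/mem_set.
rewrite esum_fset// => [|i _]; last by rewrite lee_fin.
by rewrite fsbig_finite// sumEFin.
Qed.

Lemma rsum_fin_supp (g : I -> R) (A : set I) : finite_set A ->
  (forall i, ~ A i -> g i = 0) -> rsum g = \sum_(i <- fset_set A) g i.
Proof.
move=> fA gA; rewrite /rsum !(@usum_fin_supp _ A)//=.
- rewrite -sumrB; apply: eq_bigr => i _.
  by have [] := ltP (g i) 0; have [] := ltP (- g i) 0; lra.
- by move=> i; rewrite le_max lexx orbT.
- by move=> i nA; rewrite gA// oppr0 maxxx.
- by move=> i; rewrite le_max lexx orbT.
- by move=> i nA; rewrite gA// maxxx.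
Qed.

Lemma ell2_dot_fin_supp (x y : ell2_of R I) (A : set I) : finite_set A ->
  (forall i, ~ A i -> x i * (y i)^* = 0) ->
  ell2_dot x y = \sum_(i <- fset_set A) x i * (y i)^*.
Proof.
move=> fA xyA; apply: complex_eq => /=.
  rewrite /ell2_dot_re (rsum_fin_supp fA) => [|i /xyA -> //].
  by elim: (enum_fset _) => [|i r IH]; rewrite ?big_nil ?big_cons// ReD IH.
rewrite /ell2_dot_im (rsum_fin_supp fA) => [|i /xyA -> //].
by elim: (enum_fset _) => [|i r IH]; rewrite ?big_nil ?big_cons// ImD IH.
Qed.

Definition fin_supp : {pred I -> R[i]} :=
  fun u => `[< finite_set [set i | u i != 0] >].

Lemma fin_suppP (u : I -> R[i]) :
  reflect (finite_set [set i | u i != 0]) (u \in fin_supp).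
Proof. exact: asboolP. Qed.

Lemma fin_supp_submod : submod_closed fin_supp.
Proof.
split=> [|b u v /fin_suppP uf /fin_suppP vf]; apply/fin_suppP.
  by apply: (@sub_finite_set _ _ set0) => // i /=; rewrite eqxx.
apply: (@sub_finite_set _ _ ([set i | u i != 0] `|` [set i | v i != 0])).
  move=> i /= uv; have [ui|?] := eqVneq (u i) 0; last by left.
  right; apply: contra uv => /eqP vi.
  by rewrite -[_ i]/(b * u i + v i) ui vi mulr0 addr0.
by rewrite finite_setU.
Qed.

HB.instance Definition _ :=
  GRing.isSubmodClosed.Build _ _ fin_supp fin_supp_submod.

(** A possibly incomplete inner product space on which convolution by a fiber-finite function acts
    before any boundedness is known; the contraction estimates need no completeness. *)
Record fs_of : Type := Fs { fs_val :> I -> R[i]; fs_valP : fs_val \in fin_supp }.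

HB.instance Definition _ := [isSub for fs_val].
HB.instance Definition _ := [Choice of fs_of by <:].
HB.instance Definition _ := [SubChoice_isSubLmodule of fs_of by <:].

Lemma fs_eq (u v : fs_of) : (forall i, u i = v i) -> u = v.
Proof. by move=> uv; apply/val_inj/funext. Qed.

Lemma fin_supp_sqsummable (u : I -> R[i]) : u \in fin_supp -> u \in @sqsummable R I.
Proof.
move=> /fin_suppP uf; apply/sqsummableP.
rewrite /sqsum (usum_fin_supp uf) ?ltry// => [i|i]; first exact: sqr_ge0.
by move=> /negP/negPn/eqP ->; rewrite cabs0 expr0n.
Qed.

Definition fs_ell2 (u : fs_of) : ell2_of R I :=
  Ell2 (fin_supp_sqsummable (fs_valP u)).

Definition fs_dot (u v : fs_of) : R := @hre R (ell2_hilbert R I) (fs_ell2 u) (fs_ell2 v).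

Lemma fs_dotD u v w : fs_dot (u + v) w = fs_dot u w + fs_dot v w.
Proof.
by rewrite /fs_dot -hreD; congr (hre _ _).
Qed.

Lemma fs_dotZ (b : R) u w : fs_dot (b%:C *: u) w = b * fs_dot u w.
Proof.
by rewrite /fs_dot -hreZ; congr (hre _ _).
Qed.

Lemma fs_dotC u v : fs_dot u v = fs_dot v u. Proof. exact: hreC. Qed.

Lemma fs_dot_ge0 u : 0 <= fs_dot u u. Proof. exact: hre_ge0. Qed.

Lemma fs_dot_sqsum u : (fs_dot u u)%:E = sqsum u.
Proof.
have -> : fs_dot u u = complex.Re (ell2_dot (fs_ell2 u) (fs_ell2 u)) by [].
by rewrite ell2_dot_self -ell2_sqE.
Qed.

End finite_sums.

Section convolution_operator.
Context (R : realType) (G : groupoid).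
Implicit Types (F f : arr G -> R[i]) (g h k : arr G).

Definition fiber_finite F := tgt_finite F /\
  forall y : obj G, finite_set (src_fiber y `&` [set h | F h != 0]).

Lemma fiber_finite_star F : fiber_finite F -> fiber_finite (star F).
Proof.
move=> [tF sF]; split => y.
  apply: (@sub_finite_set _ _ (@inv G @` (src_fiber y `&` [set h | F h != 0]))).
    move=> h [hy]; rewrite /star /= conjC_eq0 => Fh; exists (inv h); last exact: ginvK.
    by split => //; rewrite /src_fiber/= src_inv.
  exact: finite_image.
apply: (@sub_finite_set _ _ (@inv G @` (tgt_fiber y `&` [set h | F h != 0]))).
  move=> h [hy]; rewrite /star /= conjC_eq0 => Fh; exists (inv h); last exact: ginvK.
  by split => //; rewrite /tgt_fiber/= tgt_inv.
exact: finite_image.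
Qed.

Lemma convol_fin_supp F (u : arr G -> R[i]) : fiber_finite F ->
  u \in @fin_supp R (arr G) -> convol F u \in @fin_supp R (arr G).
Proof.
move=> [_ sF] /fin_suppP uf; apply/fin_suppP.
pose B := \bigcup_(k in [set k | u k != 0])
  ((fun h => mul h k) @` (src_fiber (tgt k) `&` [set h | F h != 0])).
apply: (@sub_finite_set _ _ B); last first.
  by apply: bigcup_finite => // k _; exact/finite_image/sF.
move=> g /= /convol_neq0[h hg [Fh uh]].
exists (mul (inv h) g) => //; exists h; last by rewrite gmulKV.
by split => //; rewrite /src_fiber/= tgt_mul ?src_inv// tgt_inv.
Qed.

(** The default value 0 occurs only when the convolution is not finitely supported, which
    [fiber_finite F] excludes. *)
Definition fconv F (u : fs_of R (arr G)) : fs_of R (arr G) :=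
  insubd (0 : fs_of R (arr G)) (convol F u).

Lemma fconvE F u : fiber_finite F -> fconv F u = convol F u :> (_ -> _).
Proof.
by move=> fF; rewrite [LHS]val_insubd convol_fin_supp//; exact: fs_valP.
Qed.

Lemma fconv_linear F : fiber_finite F -> linear (fconv F).
Proof.
move=> fF b u v; apply: fs_eq => g; rewrite fconvE//.
rewrite -[RHS]/(b * fconv F u g + fconv F v g) !fconvE//.
have := @cact_linr R G R[i]^o b F (u : arr G -> R[i]) v fF.1.
by move=> /(congr1 (fun w => w g)).
Qed.

(** The matrix of left convolution, block diagonal along the source fibers. The adjoint relation
    becomes the conjugate transpose of this matrix. *)
Definition fker F g k : R[i] := if g \in src_fiber (src k) then F (mul k (inv g)) else 0.

Lemma convol_fker F (u : arr G -> R[i]) k (A : set (arr G)) : finite_set A ->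
  (forall i, ~ A i -> u i = 0) ->
  convol F u k = \sum_(g <- fset_set A) fker F g k * u g.
Proof.
move=> fA uA; rewrite convol_src.
rewrite -(@fsbig_widen _ _ _ _ (src_fiber (src k) `&` A) (src_fiber (src k))).
- rewrite fsbig_mkcondl fsbig_finite//; apply: eq_bigr => g _.
  by rewrite /fker; case: ifP => // _; rewrite mul0r.
- by move=> g [].
- by move=> g [gk nA] /=; rewrite uA ?mulr0// => Ag; apply: nA.
Qed.

Lemma fker_star F g k : fker (star F) k g = (fker F g k)^*.
Proof.
rewrite /fker; have -> : (k \in src_fiber (src g)) = (g \in src_fiber (src k)).
  by apply/idP/idP => /set_mem; rewrite /src_fiber/= => ?; apply/mem_set.
case: ifPn => [/set_mem|_]; last by rewrite conjC0.
rewrite /src_fiber/= => gk; rewrite /star ginvM ?tgt_inv// ginvK//.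
Qed.

Lemma fconv_adj F u v : fiber_finite F ->
  fs_dot (fconv F u) v = fs_dot u (fconv (star F) v).
Proof.
move=> fF; have fsF := fiber_finite_star fF.
have /fin_suppP uf := fs_valP u; have /fin_suppP vf := fs_valP v.
set A := [set i | u i != 0] in uf; set B := [set i | v i != 0] in vf.
have uA i : ~ A i -> u i = 0 by move=> /negP/negPn/eqP.
have vB i : ~ B i -> v i = 0 by move=> /negP/negPn/eqP.
rewrite /fs_dot /hre; congr complex.Re.
rewrite [LHS](@ell2_dot_fin_supp _ _ _ _ B)//; last first.
  by move=> i nB; rewrite [X in X^*]vB// conjC0 mulr0.
rewrite [RHS](@ell2_dot_fin_supp _ _ _ _ A)//; last first.
  by move=> i nA; rewrite [X in X * _]uA// mul0r.
transitivity (\sum_(k <- fset_set B) \sum_(g <- fset_set A)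
    fker F g k * u g * (v k)^*).
  apply: eq_bigr => k _; rewrite -[fs_ell2 (fconv F u) k]/(fconv F u k) fconvE//.
  by rewrite (convol_fker _ _ uf)// mulr_suml.
rewrite exchange_big; apply: eq_bigr => g _ /=.
rewrite fconvE//.
rewrite (convol_fker _ _ vf)// rmorph_sum mulr_sumr; apply: eq_bigr => k _ /=.
rewrite rmorphM fker_star /= -[RHS]/(u g * ((fker F g k)^*^* * (v k)^*)).
by rewrite conjCK mulrA (mulrC (u g)).
Qed.

End convolution_operator.

Section truncation.
Context (R : realType) (G : groupoid).
Implicit Types (F : arr G -> R[i]) (xi : arr G -> R[i]).

Definition fconv_lin F (fF : fiber_finite F) :
    {linear fs_of R (arr G) -> fs_of R (arr G)} :=
  HB.pack (fconv F)
    (GRing.isLinear.Build R[i] (fs_of R (arr G)) (fs_of R (arr G)) *:%R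
       (fconv F) (fconv_linear fF)).

(** The values of [convol F xi] on a finite set involve finitely many values of [xi], those on [B],
    so each partial sum is unchanged when [xi] is truncated. *)
Lemma sqsum_convol_trunc F (C : R) : tgt_finite F -> 0 <= C ->
  (forall u : arr G -> R[i], u \in @fin_supp R (arr G) ->
    (sqsum (convol F u) <= C%:E * sqsum u)%E) ->
  forall xi, (sqsum (convol F xi) <= C%:E * sqsum xi)%E.
Proof.
move=> tF C0 Fle xi; apply: ge_ereal_sup => _ [A [fA _] <-].
pose B := \bigcup_(k in A)
  ((fun h => mul (inv h) k) @` (tgt_fiber (tgt k) `&` [set h | F h != 0])).
have fB : finite_set B by apply: bigcup_finite => // k _; exact/finite_image/tF.
pose u k : R[i] := if `[< B k >] then xi k else 0.
have uf : u \in @fin_supp R (arr G).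
  apply/fin_suppP; apply: sub_finite_set fB => k /=.
  by rewrite /u; case: asboolP => // _; rewrite eqxx.
have uE k : A k -> convol F xi k = convol F u k.
  move=> Ak; apply: eq_fsbigr => h /set_mem hk.
  have [->|Fh] := eqVneq (F h) 0; first by rewrite !mul0r.
  rewrite /u asboolT//; exists k => //; exists h => //.
apply: (@le_trans _ _ (sqsum (convol F u))).
  apply: ereal_sup_ubound; exists A => //; apply: eq_fsbigr => k /set_mem Ak.
  by rewrite uE.
apply: le_trans (Fle _ uf) _; apply: lee_wpmul2l; first by rewrite lee_fin.
apply: le_usum => k; rewrite /u; case: asboolP => // _.
by rewrite cabs0 expr0n sqr_ge0.
Qed.

Lemma reduced_norm_le F (c : R) : 0 <= c ->
  (forall xi, (sqsum (convol F xi) <= (c ^+ 2)%:E * sqsum xi)%E) ->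
  (reduced_norm F <= c%:E)%E.
Proof.
move=> c0 Fle; apply: ge_ereal_sup => _ [y _ <-].
apply: ge_ereal_sup => _ [xi [[xi0 xioo] xi1] <-].
have reg0 g : src g <> y -> regular y F xi g = 0.
  move=> gy; rewrite regular_convol// convol_src fsbig1// => h.
  by rewrite /src_fiber/= => hg; rewrite xi0 ?mulr0// hg.
rewrite sqsum_real_le// regular_convol//; apply: le_trans (Fle _) _.
have : (sqsum xi <= 1)%E by move: xi1 => /=; rewrite sqsum_real_le// expr1n.
by move=> x1; rewrite -[leRHS]mule1; apply: lee_wpmul2l; rewrite ?lee_fin ?sqr_ge0.
Qed.

(** The object [y] is needed as a witness: with no object the supremum is that of the empty set. *)
Lemma reduced_norm_ge0 F (y : obj G) : (0 <= reduced_norm F)%E.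
Proof.
apply: (@le_trans _ _ (opnorm (ell2 y) (ell2_norm y) (regular y F))).
  apply: (@le_trans _ _ (ell2_norm y (regular y F (fun=> 0)))).
    exact: sqrte_ge0.
  apply: ereal_sup_ubound; exists (fun=> 0) => //.
  have z0 : ell2_norm y (fun=> 0 : R[i]) = 0%E.
    rewrite /ell2_norm esum1 ?sqrte0// => g _.
    by rewrite normr0 expr0n.
  by split; [split => //; rewrite z0|rewrite /= z0].
by apply: ereal_sup_ubound; exists y.
Qed.

End truncation.

Lemma cvg_EFin0 (R : realType) (e : nat -> R) :
  e n @[n --> \oo] --> (0 : R) -> (e n)%:E @[n --> \oo] --> 0%E.
Proof. by move=> e0; apply: cvg_EFin; [exact: nearW|exact: e0]. Qed.

(** * Contractions on the isotropy group *)

Section transfer.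
Context (R : realType) (Gam : groupType) (X : topologicalType)
  (a : partial_action Gam X).
Hypothesis hX : hausdorff_space X.
Local Notation G := (action_groupoid a).
Context (x : X).
Local Notation S := (isotropy (G := G) x).
Local Notation resx := (@res R G x).
Context (F0 : arr G -> R[i]).
Hypothesis CF0 : Cc F0.
Hypothesis stF0 : @stab_supp R Gam X a x F0.
Context (B c s : R).
Hypothesis B0 : 0 <= B.
Hypothesis F0_full : forall (H : hilbert R) (rho : representation G H) v,
  sip_norm (@hre R H) (rho F0 v) <= B * sip_norm (@hre R H) v.
Hypothesis c01 : 0 <= c < 1.
Hypothesis F0_red : forall u, u \in @fin_supp R (arr G) ->
  (sqsum (convol F0 u) <= (c ^+ 2)%:E * sqsum u)%E.
Hypothesis s_full : 1 + B ^+ 2 <= s.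
Hypothesis s_red : 1 + c ^+ 2 <= s.

Let a0 := convol (star F0) F0.
Let A (w : arr G -> R[i]) : arr G -> R[i] := convol a0 w.

(** [locked] keeps conversion from unfolding the iteration, in which [rn_iter] calls itself twice at
    each level. *)
Definition cut_seq n : arr G -> R[i] :=
  locked (rn_cut s A n (convol a0 a0)).

Let cut_seqE n : cut_seq n = rn_cut s A n (convol a0 a0).
Proof. by rewrite /cut_seq -lock. Qed.

Let CsF0 : Cc (star F0). Proof. exact: Cc_star. Qed.
Let Ca0 : Cc a0. Proof. exact: Cc_convol. Qed.
Let tfin (F : arr G -> R[i]) : Cc F -> tgt_finite F.
Proof. by move=> CF; apply: finite_elt_tgt; exact: Cc_finite_elt. Qed.
Let ffin (F : arr G -> R[i]) : Cc F -> fiber_finite F.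
Proof.
move=> CF; split; first exact: tfin.
by apply: finite_elt_src; exact: Cc_finite_elt.
Qed.

Let D_lin (b : R[i]) (u w : arr G -> R[i]) : Cc u -> Cc w -> Cc (b *: u + w).
Proof. exact: (@Cc_lin R Gam X a hX b u w). Qed.
Let D0 : Cc (0 : arr G -> R[i]). Proof. exact: (@Cc0 R Gam X a hX). Qed.
Let D_A (w : arr G -> R[i]) : Cc w -> Cc (A w). Proof. by move=> Cw; exact: Cc_convol. Qed.
Let Caa : Cc (convol a0 a0). Proof. exact: Cc_convol. Qed.

Lemma Cc_cut_seq n : Cc (cut_seq n).
Proof. by rewrite cut_seqE; exact: (rn_cut_closed (D := @Cc R G) s D_lin D0 D_A n Caa). Qed.

Section full.
Context (H : hilbert R) (rho : representation G H).
Let T v := rho (star F0) (rho F0 v).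

Let rho_a0 v : rho a0 v = T v. Proof. by rewrite /a0 rep_convol. Qed.

Lemma rep_cut_seq n v : rho (cut_seq n) v = rn_cut s T n (T (T v)).
Proof.
rewrite cut_seqE; have := rn_cut_morph (TV := T) (J := fun w => rho w v) s D_lin D0 D_A.
move=> /(_ _ _ n _ Caa) ->.
- by rewrite rep_convol// !rho_a0.
- by move=> b u w Cu Cw; exact: (rep_linear rho b Cu Cw v).
- by move=> u Cu; rewrite /A rep_convol// rho_a0.
Qed.

Lemma rep_cut_seq_sub m n v :
  sip_norm (@hre R H) (rho (cut_seq m \- cut_seq n)%R v) <=
  s * (B ^+ 2) ^+ 2 * `|rn_real R m - rn_real R n| * sip_norm (@hre R H) v.
Proof.
have -> : rho (cut_seq m \- cut_seq n)%R v = rho (cut_seq m) v - rho (cut_seq n) v.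
  have -> : (cut_seq m \- cut_seq n)%R = fun g => -1 * cut_seq n g + cut_seq m g.
    by apply/funext => g; rewrite /= mulN1r addrC.
  by rewrite (rep_linear rho (-1) (Cc_cut_seq n) (Cc_cut_seq m)) scaleN1r addrC.
(* The vectors are made opaque before the estimate on [H] is applied to them. *)
have E u w : u = rn_cut s T m (T (T v)) -> w = rn_cut s T n (T (T v)) ->
    sip_norm (@hre R H) (u - w) <=
    s * (B ^+ 2) ^+ 2 * `|rn_real R m - rn_real R n| * sip_norm (@hre R H) v.
  move=> -> ->.
  apply: (@rn_cut_TT_sub_le R H (@hre R H) (@hreD R H) (@hreZ R H) (@hreC R H)
    (@hre_ge0 R H) (rho F0) (rho (star F0)) T (B ^+ 2) s) => //.
  - by move=> y z; exact: rep_adj.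
  - exact: sqr_ge0.
  - move=> y; have := F0_full rho y.
    rewrite -(ler_pXn2r (n := 2)) ?nnegrE ?mulr_ge0 ?sip_norm_ge0//.
    by rewrite exprMn !(sip_norm_sq (@hre_ge0 R H)).
exact: E (rep_cut_seq m v) (rep_cut_seq n v).
Qed.

End full.

Lemma full_norm_cut_seq m n : (full_norm (cut_seq m \- cut_seq n)%R <=
  (s * (B ^+ 2) ^+ 2 * `|rn_real R m - rn_real R n|)%:E)%E.
Proof.
apply: ge_ereal_sup => _ [H [rho ->]].
apply: ge_ereal_sup => _ [v [_ v1] <-].
rewrite /hnorm -!hnormE lee_fin.
have {}v1 : sip_norm (@hre R H) v <= 1 by move: v1; rewrite /= /hnorm lee_fin -hnormE.
apply: le_trans (rep_cut_seq_sub rho m n v) _.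
rewrite -[leRHS]mulr1 ler_wpM2l// !mulr_ge0// ?sqr_ge0//.
by apply: le_trans s_full; rewrite addr_ge0 ?sqr_ge0.
Qed.

Lemma cut_seq_cauchy (e : R) : 0 < e -> exists N : nat,
  forall m n, (N <= m)%N -> (N <= n)%N ->
    (full_norm (cut_seq m \- cut_seq n)%R <= e%:E)%E.
Proof.
move=> e0; pose k := s * (B ^+ 2) ^+ 2.
have k0 : 0 <= k.
  by rewrite mulr_ge0 ?sqr_ge0//; apply: le_trans s_full; rewrite addr_ge0 ?sqr_ge0.
have d0 : 0 < e / (k + 1) / 2 by rewrite !divr_gt0// ltr_wpDl.
have /cvgrPdist_le /(_ _ d0) [N _ hN] := @rn_real_cvg R.
exists N => m n Nm Nn; apply: le_trans (full_norm_cut_seq m n) _.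
rewrite lee_fin -/k.
have hm := hN m Nm; have hn := hN n Nn; rewrite /= in hm hn.
have : `|rn_real R m - rn_real R n| <= e / (k + 1).
  rewrite -(subrKA (limn (@rn_real R))) (le_trans (ler_normD _ _))//.
  by rewrite [leRHS](splitr (e / (k + 1))) lerD// distrC.
move=> h; apply: le_trans (ler_wpM2l k0 h) _.
by rewrite mulrCA ler_piMr ?(ltW e0)// ler_pdivrMr ?ltr_wpDl// mul1r lerDl.
Qed.

Definition cut_cstar : cstar R G := Cstar Cc_cut_seq cut_seq_cauchy.

Let V := fs_of R (arr G).
Let SV := fconv_lin (ffin CF0).
Let SV' := fconv_lin (ffin CsF0).
Let TV (u : V) : V := SV' (SV u).

Let SV_le (u : V) : fs_dot (SV u) (SV u) <= c ^+ 2 * fs_dot u u.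
Proof.
rewrite -lee_fin EFinM !fs_dot_sqsum.
have -> : (SV u : arr G -> R[i]) = convol F0 u by rewrite -fconvE//; exact: ffin.
exact/F0_red/fs_valP.
Qed.

Let J (u : V) (w : arr G -> R[i]) : V := fconv w u.

Let J_conv (w w' : arr G -> R[i]) u : Cc w -> Cc w' -> J u (convol w w') = J (J u w') w.
Proof.
move=> Cw Cw'; have Cww : Cc (convol w w') by exact: Cc_convol.
apply: fs_eq => g; rewrite !fconvE; do ?exact: ffin.
by rewrite convolA//; exact: tfin.
Qed.

Let J_a0 u : J u a0 = TV u.
Proof. by rewrite /a0 J_conv. Qed.

Lemma fs_cut_seq n u : fconv (cut_seq n) u = rn_cut s TV n (TV (TV u)).
Proof.
rewrite cut_seqE; have := rn_cut_morph (TV := TV) (J := J u) s D_lin D0 D_A.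
move=> /(_ _ _ n _ Caa) h; rewrite [LHS]h.
- congr (rn_cut s TV n _); apply: etrans (J_conv u Ca0 Ca0) _.
  by apply: etrans (J_a0 _) _; congr TV; exact: J_a0.
- move=> b w w' Cw Cw'; apply: fs_eq => g.
  rewrite -[RHS]/(b * J u w g + J u w' g) !fconvE; do ?exact: ffin.
    have := @cact_linl R G R[i]^o b w w' (u : arr G -> R[i]) (tfin Cw) (tfin Cw').
    by move=> /(congr1 (fun z => z g)).
  exact/ffin/D_lin.
- by move=> w Cw; rewrite /A J_conv// J_a0.
Qed.

(** The bound of [rn_cut_le] with [M = c^2] at the vector [T (T u)], where each [T] contributes a
    factor [c^2]. *)
Let err n : R := 2 * s ^+ 2 / (1 - c ^+ 2) * (rn_real R n.+1 - rn_real R n) *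
  (c ^+ 2 * c ^+ 2).

Let c2 : c ^+ 2 < 1.
Proof. by have /andP[c0 c1] := c01; rewrite expr_lt1. Qed.

Let err_ge0 n : 0 <= err n.
Proof.
apply: mulr_ge0; last by rewrite mulr_ge0 ?sqr_ge0.
apply: mulr_ge0; last by rewrite subr_ge0 rn_real_leS.
apply: mulr_ge0; last by rewrite invr_ge0 subr_ge0 ltW.
by rewrite mulr_ge0 ?sqr_ge0.
Qed.

Let err_cvg : err n @[n --> \oo] --> (0 : R).
Proof.
have -> : (0 : R) = 2 * s ^+ 2 / (1 - c ^+ 2) * 0 * (c ^+ 2 * c ^+ 2) by rewrite mulr0 mul0r.
by apply: cvgMr_tmp; apply: cvgMl_tmp; exact: rn_realS_sub_cvg.
Qed.

Let fs_cut_le n (u : V) : sip_norm (@fs_dot R (arr G)) (fconv (cut_seq n) u) <=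
  err n * sip_norm (@fs_dot R (arr G)) u.
Proof.
have adj v w : fs_dot (SV v) w = fs_dot v (SV' w) by apply: fconv_adj; exact: ffin.
have hT v : TV v = SV' (SV v) by [].
have TVle := gram_norm_le (@fs_dotD R (arr G)) (@fs_dotZ R (arr G)) (@fs_dotC R (arr G))
  (@fs_dot_ge0 R (arr G)) adj hT (sqr_ge0 c) SV_le.
rewrite fs_cut_seq.
have := rn_cut_le (@fs_dotD R (arr G)) (@fs_dotZ R (arr G)) (@fs_dotC R (arr G))
  (@fs_dot_ge0 R (arr G)) adj hT (sqr_ge0 c) SV_le s_red n (TV (TV u)) c2.
move=> /le_trans; apply; rewrite /err -[leRHS]mulrA.
apply: ler_wpM2l.
  apply: mulr_ge0; last by rewrite subr_ge0 rn_real_leS.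
  apply: mulr_ge0; last by rewrite invr_ge0 subr_ge0 ltW.
  by rewrite mulr_ge0 ?sqr_ge0.
apply: le_trans (TVle _) _; rewrite -mulrA.
by apply: ler_wpM2l; [exact: sqr_ge0|exact: TVle].
Qed.

Lemma reduced_norm_cut_seq n : (reduced_norm (cut_seq n) <= (err n)%:E)%E.
Proof.
apply: reduced_norm_le => //; apply: sqsum_convol_trunc.
- exact/tfin/Cc_cut_seq.
- exact: sqr_ge0.
move=> u uf; have := fs_cut_le n (Fs uf).
rewrite -(ler_pXn2r (n := 2)) ?nnegrE ?(mulr_ge0 (err_ge0 n)) ?sip_norm_ge0//.
rewrite exprMn !(sip_norm_sq (@fs_dot_ge0 R (arr G))) -lee_fin EFinM !fs_dot_sqsum.
by rewrite fconvE//; exact/ffin/Cc_cut_seq.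
Qed.

Lemma cut_seq_ker : ker_reduced cut_cstar.
Proof.
apply: (squeeze_cvge (f := fun=> 0%E) (h := fun n => (err n)%:E)).
- apply: nearW => n; rewrite reduced_norm_cut_seq andbT.
  exact: (reduced_norm_ge0 _ (x : obj G)).
- exact: cvg_cst.
- exact: cvg_EFin0.
Qed.

Section contraction.
Context (H : hilbert R) (rho : representation S H).
Hypothesis rho_red : ind_factors_reduced rho.
Context (b : R).
Hypothesis b0 : 0 <= b.
Hypothesis rho_b : forall v,
  sip_norm (@hre R H) (rho (resx F0) v) <= b * sip_norm (@hre R H) v.
Hypothesis s_b : 1 + b ^+ 2 <= s.

Let T v := rho (star (resx F0)) (rho (resx F0) v).

Let Cr (F : arr G -> R[i]) : Cc F -> Cc (resx F).
Proof. exact: Cc_res. Qed.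
Let CrF0 : Cc (resx F0). Proof. exact: Cc_res. Qed.
Let CrsF0 : Cc (resx (star F0)). Proof. exact: Cc_res. Qed.

(** The intertwining argument runs on this smaller space because [w |-> rho (resx w) v] turns
    convolution by [a0] into [T] through [res_convol], a statement about functions supported over
    the stabilizer. *)
Let D : set (arr G -> R[i]) := [set F | Cc F /\ @stab_supp R Gam X a x F].

Let st_a0 : @stab_supp R Gam X a x a0.
Proof. by apply: stab_supp_convol => //; exact: stab_supp_star. Qed.

Let rho_a0 v : rho (resx a0) v = T v.
Proof. by rewrite /a0 res_convol ?rep_convol//; exact: stab_supp_star. Qed.

Let rho_conv (w : arr G -> R[i]) v : D w -> rho (resx (convol a0 w)) v = T (rho (resx w) v).
Proof.
move=> [Cw sw]; rewrite (res_convol w st_a0).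
by rewrite (rep_convol rho (Cr Ca0) (Cr Cw)); exact: rho_a0.
Qed.

Let DD_lin (d : R[i]) (u w : arr G -> R[i]) : D u -> D w -> D (d *: u + w).
Proof.
move=> [Cu su] [Cw sw]; split; first exact: D_lin.
exact: (@stab_supp_lin R Gam X a x d u w).
Qed.
Let DD0 : D 0.
Proof. by split; [exact: D0|move=> g; rewrite eqxx]. Qed.
Let DD_A (w : arr G -> R[i]) : D w -> D (A w).
Proof. by move=> [Cw sw]; split; [exact: D_A|exact: stab_supp_convol]. Qed.

Let rho_cut n v : rho (resx (cut_seq n)) v = rn_cut s T n (T (T v)).
Proof.
have Daa : D (convol a0 a0) by exact: DD_A.
rewrite cut_seqE; have := rn_cut_morph (TV := T) (J := fun w => rho (resx w) v) s DD_lin DD0 DD_A.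
move=> /(_ _ _ n _ Daa) ->.
- by rewrite rho_conv// rho_a0.
- move=> d u w [Cu _] [Cw _].
  exact: (rep_linear rho d (Cr Cu) (Cr Cw) v).
- by move=> u Du; exact: rho_conv.
Qed.

(** [cut_cstar] lies in the kernel, so its induced operators tend to 0 in norm. By
    [rep_res_le_opnorm] they dominate the cuts of [T (T v)] computed in [rho], and
    [contraction_of_rn_cut_cvg0] concludes. *)
Lemma res_contraction v :
  sip_norm (@hre R H) (rho (resx F0) v) <= sip_norm (@hre R H) v.
Proof.
have adj u w : hre (rho (resx F0) u) w = hre u (rho (star (resx F0)) w).
  exact: rep_adj.
have hT u : T u = rho (star (resx F0)) (rho (resx F0) u) by [].
have Sle u : hre (rho (resx F0) u) (rho (resx F0) u) <= b ^+ 2 * hre u u.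
  have := rho_b u; rewrite -(ler_pXn2r (n := 2)) ?nnegrE ?mulr_ge0 ?sip_norm_ge0//.
  by rewrite exprMn !(sip_norm_sq (@hre_ge0 R H)).
apply: (contraction_of_rn_cut_cvg0 (@hreD R H) (@hreZ R H) (@hreC R H) (@hre_ge0 R H)
  adj hT (sqr_ge0 b) Sle s_b) => {}v.
have := rho_red cut_seq_ker; rewrite /ind_vanishes => van.
have le1 u n : sip_norm (@hre R H) u <= 1 ->
    ((sip_norm (@hre R H) (rn_cut s T n (T (T u))))%:E <=
     opnorm (ind_space rho) (@ind_norm R G x H) (ind (cut_cstar n)))%E.
  move=> u1; rewrite -rho_cut hnormE.
  apply: rep_res_le_opnorm; [exact/tfin/Cc_cut_seq|exact/Cc_res/Cc_cut_seq|].
  by rewrite /hnorm lee_fin -hnormE.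
have small u : sip_norm (@hre R H) u <= 1 ->
    sip_norm (@hre R H) (rn_cut s T n (T (T u))) @[n --> \oo] --> (0 : R).
  move=> u1.
  have : (sip_norm (@hre R H) (rn_cut s T n (T (T u))))%:E @[n --> \oo] --> 0%E.
    apply: (squeeze_cvge _ (@cvg_cst _ 0%E _ _ _) van).
    by apply: nearW => n; rewrite lee_fin sip_norm_ge0 le1.
  by move=> /fine_cvgP[].
(* [opnorm] controls the unit ball only; a general [v] is rescaled, and the [+ 1] keeps [m]
   positive. *)
pose m := sip_norm (@hre R H) v + 1.
have m0 : 0 < m by rewrite ltr_wpDl// sip_norm_ge0.
have mv : sip_norm (@hre R H) (m^-1%:C *: v) <= 1.
  rewrite (sip_normZ (@hreZ R H) (@hreC R H)) gtr0_norm ?invr_gt0//.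
  by rewrite ler_pdivrMl// mulr1 lerDl.
have := small _ mv.
have e n : sip_norm (@hre R H) (rn_cut s T n (T (T v))) =
    m * sip_norm (@hre R H) (rn_cut s T n (T (T (m^-1%:C *: v)))).
  rewrite -!rho_cut linearZ (sip_normZ (@hreZ R H) (@hreC R H)).
  by rewrite gtr0_norm ?invr_gt0// mulrA divff ?mul1r// gt_eqF.
move=> h; have {h} := cvgMl_tmp (a := m) h; rewrite mulr0.
by rewrite (_ : (fun n => m * _) = fun n => sip_norm (@hre R H) (rn_cut s T n (T (T v))));
  [exact|apply/funext => n; rewrite e].
Qed.

End contraction.

End transfer.

Section norm_e_le.
Context (R : realType) (Gam : groupType) (X : topologicalType)
  (a : partial_action Gam X).
Hypothesis hX : hausdorff_space X.
Hypothesis lX : locally_compact [set: X].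
Local Notation G := (action_groupoid a).
Context (x : X).
Local Notation S := (isotropy (G := G) x).
Local Notation nn H := (sip_norm (@hre R H)).

Lemma rep_isotropy_le (f : arr S -> R[i]) (H : hilbert R)
    (rho : representation S H) : Cc f ->
  exists2 b, 0 <= b & forall v, nn H (rho f v) <= b * nn H v.
Proof.
move=> /isotropy_Cc fA; set A := [set s | f s != 0] in fA.
exists (\sum_(s <- fset_set A) cabs (f s)).
  by apply: sumr_ge0 => s _; exact: cabs_ge0.
move=> v; rewrite (rep_expand rho v fA)//.
elim: (enum_fset (fset_set A)) => [|s r IH].
  by rewrite !big_nil mul0r hnormE normr0.
rewrite !big_cons mulrDl.
apply: le_trans (sip_normD (@hreD R H) (@hreZ R H) (@hreC R H) (@hre_ge0 R H) _ _) _.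
apply: lerD => //; rewrite hnormE normrZ.
have -> : complex.Re (`|f s| * `|rho (delta R s) v|) =
    cabs (f s) * complex.Re `|rho (delta R s) v|.
  by rewrite normcE ReZ.
rewrite ler_wpM2l ?cabs_ge0// -hnormE (sip_norm_le (@hre_ge0 R H)) ?sip_norm_ge0//.
by rewrite (sip_norm_sq (@hre_ge0 R H)) rep_delta_le.
Qed.

(** An isotropy arrow over [c] has source [x], so [x] lies in each of the finitely many open domains
    and in the interior of their intersection. *)
Lemma coef_supp_bump (f : arr S -> R[i]) : Cc f ->
  exists phi : X -> R, exists K : set X,
    [/\ continuous phi, (forall z, 0 <= phi z <= 1), phi x = 1,
        compact K & (forall z, phi z != 0 -> K z) /\
        forall c, @coef_supp R Gam X a x f c -> K `<=` pdom a c^-1%g].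
Proof.
move=> fC; have fin := coef_supp_finite fC.
pose U := (\bigcap_(c in coef_supp f) pdom a c^-1%g)°.
have oU : open U by exact: open_interior.
have Ux : U x.
  rewrite /U /interior /=.
  have -> : coef_supp f = [set` fset_set (coef_supp f)] by rewrite fset_setK.
  apply: filter_bigI => c /(mem_fset_set fin)[s fs <-].
  apply: open_nbhs_nbhs; split; first exact: pdom_open.
  have := src_dom (@isotropy_val G x s); rewrite iv_src; exact.
have [phi [K [cphi phi01 phix [cK KU] phiK]]] := @bump_function R X x U hX lX oU Ux.
exists phi, K; split => //; split => // c cs z Kz.
exact: (interior_subset (KU _ Kz)).
Qed.

(** Dividing the extension by [t] makes its reduced norm at most [N / t < 1]. The strict inequality
    provides the gap [1 - c^2] that the estimate of the cut divides by. *)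
Lemma rep_norm_le_reduced (f : arr S -> R[i]) (H : hilbert R)
    (rho : representation S H) (N t : R) : Cc f ->
  ind_factors_reduced rho -> 0 <= N -> (reduced_norm f <= N%:E)%E -> N < t ->
  forall v, nn H (rho f v) <= t * nn H v.
Proof.
move=> fC red N0 fN Nt v; have t0 : 0 < t by exact: le_lt_trans Nt.
have [phi [K [cphi phi01 phix cK [phiK Kdom]]]] := coef_supp_bump fC.
pose E := ext f phi.
have CE : Cc E by exact: (Cc_ext hX fC cphi cK phiK Kdom).
(* The summand 0 gives the shape of [Cc_lin] and [rep_linear]. *)
pose F0 : arr G -> R[i] := fun g => (t^-1)%:C * E g + 0.
have C0 : Cc (fun _ : arr G => 0 : R[i]) by exact: Cc0.
have CF0 : Cc F0 by exact: Cc_lin.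
have st0 : @stab_supp R Gam X a x F0.
  by apply: stab_supp_lin; [exact: stab_supp_ext|move=> g; rewrite eqxx].
have ti0 : 0 <= t^-1 by rewrite invr_ge0 ltW.
have rF0 (H' : hilbert R) (sg : representation G H') w : sg F0 w = (t^-1)%:C *: sg E w.
  have z : sg (fun=> 0) w = 0.
    have := rep_linear sg (-1) C0 C0 w.
    by rewrite (_ : (fun g => _) = fun=> 0) ?scaleN1r ?addNr//;
      apply/funext => g; rewrite mulr0 addr0.
  by rewrite (rep_linear sg _ CE C0) z addr0.
pose B := t^-1 * @ext_bound R Gam X a x f.
have B0 : 0 <= B by rewrite mulr_ge0// ext_bound_ge0.
have F0full (H' : hilbert R) (sg : representation G H') w : nn H' (sg F0 w) <= B * nn H' w.
  rewrite rF0 (sip_normZ (@hreZ R H') (@hreC R H')) ger0_norm// -mulrA ler_wpM2l//.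
  exact: (rep_ext_le hX fC cphi phi01 cK phiK Kdom).
pose c := N / t.
have c0 : 0 <= c by rewrite divr_ge0// ltW.
have c01 : 0 <= c < 1 by rewrite c0 ltr_pdivrMr// mul1r.
have F0red u : u \in @fin_supp R (arr G) ->
    (sqsum (convol F0 u) <= (c ^+ 2)%:E * sqsum u)%E.
  move=> uf; have uoo : (sqsum u < +oo)%E.
    exact/sqsummableP/fin_supp_sqsummable.
  have -> : convol F0 u = fun g => (t^-1)%:C * convol E u g.
    apply/funext => g; rewrite /convol mulr_fsumr; apply: eq_fsbigr => h _.
    by rewrite /F0 addr0 -[LHS]mulrA.
  have -> : ((c ^+ 2)%:E * sqsum u = (t^-1 ^+ 2)%:E * ((N ^+ 2)%:E * sqsum u))%E.
    by rewrite muleA -EFinM /c exprMn mulrC.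
  rewrite sqsumZ cabs_real ger0_norm//.
  apply: lee_wpmul2l; first by rewrite lee_fin sqr_ge0.
  by apply: (sqsum_convol_ext fC phi01 phiK Kdom).
have resF0 : @res R G x F0 = fun s => (t^-1)%:C * f s + 0.
  apply/funext => s; rewrite -[in RHS](res_ext f phix) //.
have rho0 w : rho (@res R G x F0) w = (t^-1)%:C *: rho f w.
  by rewrite resF0 (rep_linear rho _ fC (Cc_S0 _ _)) rep0 addr0.
have [b b0 rb] := rep_isotropy_le rho fC.
(* One scale for three operators: [F0] in every representation of the groupoid ([B]), convolution by
   [F0] on finitely supported functions ([c]), and the restriction of [F0] in [rho] ([t^-1 * b]). It
   may depend on [rho], as the element of the kernel is chosen for each [rho]. *)
pose s := 1 + B ^+ 2 + c ^+ 2 + (t^-1 * b) ^+ 2.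
have sq (y : R) : 0 <= y ^+ 2 by exact: sqr_ge0.
have := @res_contraction R Gam X a hX x F0 CF0 st0 B c s B0 F0full c01 F0red _ _
  H rho red (t^-1 * b) _ _ _ v.
rewrite rho0 (sip_normZ (@hreZ R H) (@hreC R H)) ger0_norm// ler_pdivrMl//; apply.
- by rewrite /s; have := sq c; have := sq (t^-1 * b); lra.
- by rewrite /s; have := sq B; have := sq (t^-1 * b); lra.
- by rewrite mulr_ge0.
- move=> w; rewrite rho0 (sip_normZ (@hreZ R H) (@hreC R H)) ger0_norm// -mulrA.
  by rewrite ler_wpM2l.
- by rewrite /s; have := sq B; have := sq c; lra.
Qed.

Lemma norm_e_le_reduced (f : arr S -> R[i]) : Cc f -> (norm_e f <= reduced_norm f)%E.
Proof.
move=> fC; apply: ge_ereal_sup => _ [H [rho [red ->]]].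
have r0 := reduced_norm_ge0 f (tt : obj S).
have [->|rfin] := eqVneq (reduced_norm f) +oo%E; first exact: leey.
have rE : reduced_norm f = (fine (reduced_norm f))%:E.
  by rewrite fineK// ge0_fin_numE// ltey.
apply/lee_addgt0Pr => e e0; rewrite rE -EFinD.
set N := fine _; have N0 : 0 <= N by exact: fine_ge0.
apply: ge_ereal_sup => _ [v [_ v1] <-].
rewrite /hnorm -hnormE lee_fin.
have {}v1 : nn H v <= 1 by move: v1; rewrite /= /hnorm lee_fin -hnormE.
have fN : (reduced_norm f <= N%:E)%E by rewrite {1}rE.
have lt : N < N + e by rewrite ltrDl.
apply: le_trans (rep_norm_le_reduced fC red N0 fN lt v) _.
by rewrite -[leRHS]mulr1 ler_wpM2l// addr_ge0// ltW.
Qed.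

End norm_e_le.

Lemma ell2_sumE (R : realType) (I : choiceType) (J : Type) (r : seq J)
    (F : J -> ell2_of R I) i :
  (\sum_(j <- r) F j) i = \sum_(j <- r) F j i.
Proof. by elim: r => [|j r IH]; rewrite ?big_nil ?big_cons// -IH. Qed.

(** * The left regular representation of the isotropy group *)

Section left_regular.
Context (R : realType) (G : groupoid) (x : obj G).
Local Notation S := (isotropy x).
Local Notation L := (ell2_of R (arr S)).
Implicit Types (s t : arr S) (f : arr S -> R[i]) (u v : L).

Let lmul_set_bij s : set_bij [set: arr S] [set: arr S] (mul (inv s)).
Proof.
split => [//|t t' _ _ e|t _].
  by rewrite -(isoKV s t) e isoKV.
by exists (mul s t) => //; exact: isoVK.
Qed.

Lemma usum_lmul (g : arr S -> R) s : usum (fun t => g (mul (inv s) t)) = usum g.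
Proof.
rewrite /usum; symmetry.
exact: (@reindex_esum _ _ _ _ _ _ (fun t => (g t)%:E) (lmul_set_bij s)).
Qed.

Lemma rsum_lmul (g : arr S -> R) s : rsum (fun t => g (mul (inv s) t)) = rsum g.
Proof.
rewrite /rsum (usum_lmul (fun t => Num.max (g t) 0)).
by rewrite (usum_lmul (fun t => Num.max (- g t) 0)).
Qed.

Lemma sqsum_lmul (w : arr S -> R[i]) s : sqsum (fun t => w (mul (inv s) t)) = sqsum w.
Proof. exact: (usum_lmul (fun t => cabs (w t) ^+ 2)). Qed.

Lemma ell2_lmul_subproof s u : (fun t => u (mul (inv s) t)) \in @sqsummable R (arr S).
Proof. by apply/sqsummableP; rewrite sqsum_lmul; exact: ell2_fin. Qed.

Definition ell2_lmul s u : L := Ell2 (ell2_lmul_subproof s u).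

Lemma ell2_lmul_norm s u : `|ell2_lmul s u| = `|u|.
Proof.
by rewrite !ell2_normE /ell2_normr /ell2_sq sqsum_lmul.
Qed.

Lemma ell2_lmul_dot s u v :
  ell2_dot (ell2_lmul s u) v = ell2_dot u (ell2_lmul (inv s) v).
Proof.
have e t : mul (inv (inv s)) (mul (inv s) t) = t by rewrite ginvK isoKV.
have e' t : u (mul (inv s) t) * (v t)^* =
    u (mul (inv s) t) * (v (mul (inv (inv s)) (mul (inv s) t)))^* by rewrite e.
apply: complex_eq; rewrite -[RHS](rsum_lmul _ s); congr rsum;
  by apply/funext => t; congr (_ _); exact: e'.
Qed.

(** A finite sum of translations is bounded without any further estimate. If [f] has infinite
    support, [fset_set] is empty and the operator is 0, so linearity and continuity hold for every
    [f]. *)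
Definition left_regular_fun f u : L :=
  \sum_(s <- fset_set [set s | f s != 0]) f s *: ell2_lmul s u.

Lemma left_regular_linear f : linear (left_regular_fun f).
Proof.
move=> b u v; rewrite /left_regular_fun scaler_sumr -big_split; apply: eq_bigr => s _ /=.
rewrite scalerA (mulrC b) -scalerA -scalerDr; congr (_ *: _).
exact: ell2_eq.
Qed.

Definition left_regular_lin f : {linear ell2_hilbert R (arr S) -> ell2_hilbert R (arr S)} :=
  HB.pack (left_regular_fun f)
    (GRing.isLinear.Build R[i] (ell2_hilbert R (arr S)) (ell2_hilbert R (arr S)) *:%R
       (left_regular_fun f) (left_regular_linear f)).

Lemma left_regularE f u t : Cc f -> left_regular_lin f u t = convol f u t.
Proof.
move=> /isotropy_Cc fA; rewrite convolE (@cactE _ _ _ _ _ _ _ fA); first last.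
- by [].
- by rewrite isotropy_tgt_fiber.
rewrite -[LHS]/(left_regular_fun f u t) ell2_sumE; exact: eq_bigr.
Qed.

Lemma left_regular_continuous f : continuous (left_regular_lin f).
Proof.
apply: bounded_linear_continuous; apply/linear_boundedP.
exists (\sum_(s <- fset_set [set s | f s != 0]) `|f s|).
split; first by apply: ger0_real; apply: sumr_ge0 => s _.
move=> r /ltW fr u; apply: le_trans (ler_wpM2r (normr_ge0 _) fr).
rewrite -[left_regular_lin f u]/(left_regular_fun f u) /left_regular_fun.
apply: le_trans (ler_norm_sum _ _ _) _; rewrite mulr_suml; apply: ler_sum => s _.
by rewrite normrZ ell2_lmul_norm.
Qed.

Lemma ell2_dot_suml (r : seq (arr S)) (b : arr S -> R[i]) (F : arr S -> L) v :
  ell2_dot (\sum_(s <- r) b s *: F s) v = \sum_(s <- r) b s * ell2_dot (F s) v.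
Proof.
elim: r => [|s r IH].
  rewrite !big_nil; have := ell2_dot_linearl v (-1) 0 0.
  by rewrite scaler0 addr0 mulN1r addNr.
by rewrite !big_cons ell2_dot_linearl IH.
Qed.

Lemma left_regular_star f u v : Cc f ->
  ell2_dot (left_regular_lin f u) v = ell2_dot u (left_regular_lin (star f) v).
Proof.
move=> /isotropy_Cc fA; set A := [set s | f s != 0] in fA.
have fB : finite_set [set s | star f s != 0].
  apply: (@sub_finite_set _ _ (@inv S @` A)); last exact: finite_image.
  move=> s /=; rewrite /star conjC_eq0 => fs; exists (inv s); first exact: fs.
  exact: (@ginvK S s).
rewrite ell2_dotC (ell2_dotC u).
rewrite -[left_regular_lin f u]/(left_regular_fun f u).
rewrite -[left_regular_lin (star f) v]/(left_regular_fun (star f) v).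
rewrite -(ell2_dotC (left_regular_fun f u)) ell2_dot_suml ell2_dot_suml rmorph_sum.
rewrite -!fsbig_finite//.
rewrite (@reindex_fsbig _ _ _ _ _ (@inv S) A [set s | star f s != 0]).
  apply: eq_fsbigr => s _; rewrite rmorphM /star ginvK.
  rewrite -[RHS]/((f s)^*^* * (ell2_dot (ell2_lmul (inv s) v) u)^*).
  by rewrite conjCK -ell2_dotC ell2_lmul_dot.
split=> [s fs|s t _ _ e|s fs].
- by have : star f (inv s) != 0 by rewrite /star ginvK conjC_eq0; exact: fs.
- by rewrite -(ginvK s) e ginvK.
- exists (inv s); last exact: (@ginvK S s).
  by have : f (inv s) != 0 by move: fs; rewrite /= /star conjC_eq0.
Qed.
End left_regular.

Section left_regular_representation.
Context (R : realType) (G : groupoid) (x : obj G).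
Local Notation S := (isotropy x).
Local Notation L := (ell2_of R (arr S)).
Local Notation iv := (@isotropy_val G x).
Implicit Types (s t : arr S) (f : arr S -> R[i]) (u v : L).

Lemma Cc_S_convol f1 f2 : Cc f1 -> Cc f2 -> Cc (convol f1 f2).
Proof.
move=> /isotropy_Cc F1 /isotropy_Cc F2; apply/isotropy_Cc.
pose B := \bigcup_(s in [set s | f1 s != 0]) (mul s @` [set t | f2 t != 0]).
apply: (@sub_finite_set _ _ B); last first.
  by apply: bigcup_finite => // s _; exact: finite_image.
move=> t /convol_neq0[s _ [f1s f2s]]; exists s => //.
by exists (mul (inv s) t) => //; exact: isoKV.
Qed.

Lemma tgt_finite_S f : Cc f -> tgt_finite f.
Proof.
move=> /isotropy_Cc fA y; apply: (sub_finite_set _ fA) => s [_ fs]; exact: fs.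
Qed.

Let lam_linear (b : R[i]) f1 f2 : Cc f1 -> Cc f2 -> forall v,
  left_regular_lin (fun s => b * f1 s + f2 s) v =
  b *: left_regular_lin f1 v + left_regular_lin f2 v.
Proof.
move=> C1 C2 v; apply: ell2_eq => t.
rewrite -[RHS]/(b * left_regular_lin f1 v t + left_regular_lin f2 v t).
rewrite !left_regularE//; last exact: Cc_S_lin.
have := @cact_linl R S R[i]^o b f1 f2 (v : arr S -> R[i]) (tgt_finite_S C1) (tgt_finite_S C2).
by move=> /(congr1 (fun z => z t)).
Qed.

Let lam_convol f1 f2 : Cc f1 -> Cc f2 -> forall v,
  left_regular_lin (convol f1 f2) v = left_regular_lin f1 (left_regular_lin f2 v).
Proof.
move=> C1 C2 v; apply: ell2_eq => t.
rewrite !left_regularE//; last exact: Cc_S_convol.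
rewrite convolA; [|exact: tgt_finite_S|exact: tgt_finite_S].
by congr (convol f1 _ t); apply/funext => s; rewrite left_regularE.
Qed.

Definition left_regular : representation S (ell2_hilbert R (arr S)) :=
  @Representation R S (ell2_hilbert R (arr S)) (@left_regular_lin R G x)
    (fun f _ => @left_regular_continuous R G x f) lam_linear lam_convol
    (fun f Cf u v => left_regular_star u v Cf).

Lemma hnorm_ell2 u : @hnorm R (ell2_hilbert R (arr S)) u = sqrte (sqsum u).
Proof.
by rewrite /hnorm ell2_normE /ell2_normr ell2_sqE.
Qed.

Lemma reduced_norm_le_left_regular f : Cc f ->
  (reduced_norm f <= rep_norm left_regular f)%E.
Proof.
move=> Cf; apply: ge_ereal_sup => _ [y _ <-].
have out (w : arr S -> R[i]) (g : arr S) : src g <> y -> w g = 0.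
  by case: y (src g) => -[].
apply: ge_ereal_sup => _ [xi [[xi0 xioo] /= xi1] <-].
rewrite regular_convol// ell2_norm_sqsum; last exact: out.
rewrite ell2_norm_sqsum in xioo xi1; last exact: out.
have xis : xi \in @sqsummable R (arr S).
  apply/sqsummableP; rewrite ltey; apply/eqP => e.
  by move: xioo; rewrite e /= ltxx.
apply: ereal_sup_ubound; exists (Ell2 xis); last first.
  rewrite hnorm_ell2; congr (sqrte (sqsum _)); apply/funext => t.
  by rewrite -[LHS]/(left_regular_lin f (Ell2 xis) t) left_regularE.
by split=> //=; rewrite hnorm_ell2.
Qed.

Section induced.
Variable xi : arr G -> ell2_hilbert R (arr S).
Hypothesis xi0 : forall g, src g <> x -> xi g = 0.
Hypothesis xi_equiv : forall g s, src g = x ->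
  xi (mul g (iv s)) = left_regular (star (delta R s)) (xi g).

Definition ind_eval (g : arr G) : R[i] := (xi g : L) (idg (tt : obj S)).

Lemma ind_eval_out g : src g <> x -> ind_eval g = 0.
Proof. by move=> gx; rewrite /ind_eval xi0. Qed.

(** Equivariance gives [xi (g s) = lam(s^-1) (xi g)], whose value at the unit is the coordinate of
    [xi g] at [s]. So [ind_eval] determines the whole vector [xi g] along the coset of [g]. *)
Lemma ind_eval_mul g s : src g = x -> ind_eval (mul g (iv s)) = (xi g : L) s.
Proof.
move=> gx; rewrite /ind_eval xi_equiv// star_delta.
rewrite -[LHS]/(left_regular_lin (delta R (inv s)) (xi g) (idg (tt : obj S))).
rewrite left_regularE; last exact: Cc_delta.
rewrite convol_delta ginvK; congr ((xi g : L) _).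
by have := mul_idr s; case: (src s).
Qed.

Lemma coset_src g : src g = x -> coset x g `<=` src_fiber x.
Proof.
move=> gx _ [s _ <-]; rewrite /src_fiber/= src_mul ?iv_src//.
by rewrite iv_tgt.
Qed.

Lemma coset_refl g : src g = x -> coset x g g.
Proof. by move=> gx; exists (idg (tt : obj S)) => //; rewrite -gx; exact: mul_idr. Qed.

Lemma coset_eq g k : src g = x -> coset x g k -> coset x k = coset x g.
Proof.
move=> gx [s _ <-]; apply/seteqP; split => [_ [t _ <-]|_ [t _ <-]].
  exists (mul s t) => //; rewrite -/(iv _) iv_mul mul_assoc ?iv_src ?iv_tgt//.
exists (mul (inv s) t) => //; rewrite -!/(iv _) -mul_assoc ?iv_src ?iv_tgt//.
  by rewrite -iv_mul isoKV.
Qed.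

(** Splitting the sum over [G_x] into cosets, the values of [ind_eval] on the coset of [r] are the
    coordinates of [xi r], so the coset contributes [|xi r|^2]. *)
Lemma ind_norm_eval : ind_norm x xi = sqrte (sqsum ind_eval).
Proof.
congr sqrte.
transitivity (\esum_(g in src_fiber x) (cabs (ind_eval g) ^+ 2)%:E)%E; last first.
  rewrite esum_mkcond; apply: eq_esum => g _; case: ifPn => // /negP gx.
  rewrite ind_eval_out ?cabs0 ?expr0n// => e; apply: gx; exact/mem_set.
rewrite (@esum_partition _ _ _ (coset x)); first last.
- by move=> g; rewrite lee_fin sqr_ge0.
- by move=> g k; exact: coset_eq.
- by move=> g; exact: coset_refl.
- by move=> g; exact: coset_src.
apply: eq_esum => c [g gx gc].
have cr : c (xget (idg x) c).
  by apply: xgetPex; exists g; rewrite -gc; exact: coset_refl.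
set r := xget (idg x) c in cr *.
rewrite -gc in cr; have rx : src r = x by exact: coset_src cr.
have rc : coset x r = c by rewrite (coset_eq gx cr).
have bij : set_bij [set: arr S] c (fun s => mul r (iv s)).
  rewrite -rc; split=> [s _|s t _ _ e|k [s _ <-]]; [by exists s| |by exists s].
  apply: iv_inj; rewrite -(gmulK (h := r) (m := iv s)) ?iv_tgt//.
  by rewrite e gmulK ?iv_tgt.
rewrite (@reindex_esum _ _ _ _ _ _ _ bij).
transitivity (sqsum (xi r : L)); last first.
  by apply: eq_esum => s _; rewrite ind_eval_mul.
by rewrite ell2_sqE -ell2_normr_sq.
Qed.

End induced.

End left_regular_representation.

Section induced_regular.
Context (R : realType) (G : groupoid) (x : obj G).
Local Notation S := (isotropy x).
Local Notation L := (ell2_of R (arr S)).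
Local Notation iv := (@isotropy_val G x).
Local Notation lam := (left_regular R x).
Context (F : arr G -> R[i]).
Hypothesis tF : tgt_finite F.

Let supp_in g := tgt_fiber (tgt g) `&` [set h | F h != 0].

Let indE (xi : arr G -> ell2_hilbert R (arr S)) g k : tgt k = tgt g ->
  ind F xi k = \sum_(h <- fset_set (supp_in g)) F h *: xi (mul (inv h) k).
Proof.
move=> kg; rewrite -[LHS]/(cact F xi k); apply: cactE; first exact: tF.
- by rewrite kg => h [].
- by move=> h hk Fh; split => //; rewrite /tgt_fiber/= hk.
Qed.

Context (xi : arr G -> ell2_hilbert R (arr S)).
Hypothesis xi0 : forall g, src g <> x -> xi g = 0.
Hypothesis xi_equiv : forall g s, src g = x ->
  xi (mul g (iv s)) = lam (star (delta R s)) (xi g).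

Lemma ind_out g : src g <> x -> ind F xi g = 0.
Proof.
move=> gx; rewrite (@indE xi g g)// big_seq big1// => h.
move=> /(mem_fset_set (tF (tgt g))) [hg _].
by rewrite xi0 ?scaler0// src_mul ?src_inv.
Qed.

Lemma ind_equiv g s : src g = x ->
  ind F xi (mul g (iv s)) = lam (star (delta R s)) (ind F xi g).
Proof.
move=> gx; have gs : src g = tgt (iv s) by rewrite iv_tgt.
rewrite (@indE xi g g)// (@indE xi g (mul g (iv s))) ?tgt_mul//.
rewrite linear_sum; apply: eq_big_seq => h /(mem_fset_set (tF (tgt g))) [hg _].
have hg' : src (inv h) = tgt g by rewrite src_inv.
rewrite linearZ mul_assoc//; congr (_ *: _); apply: xi_equiv.
by rewrite src_mul.
Qed.

Lemma ind_eval_ind g : ind_eval (ind F xi) g = convol F (ind_eval xi) g.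
Proof.
rewrite /ind_eval (@indE xi g g)//.
rewrite convolE (@cactE _ _ _ _ _ _ (supp_in g)); first last.
- by move=> h hk Fh; split => //; rewrite /tgt_fiber/= hk.
- by move=> h [].
- exact: tF.
by rewrite (@ell2_sumE R (arr S)); exact: eq_bigr.
Qed.

End induced_regular.

Section norm_e_ge.
Context (R : realType) (G : groupoid) (x : obj G).
Local Notation S := (isotropy x).
Local Notation lam := (left_regular R x).

(** By [ind_norm_eval] and [ind_eval_ind], [ind_eval] is isometric and carries [ind F] to
    convolution by [F], so it maps the unit ball of the induced space into that of [l^2(G_x)]. *)
Lemma opnorm_ind_left_regular F : tgt_finite F ->
  (opnorm (ind_space lam) (@ind_norm R G x (ell2_hilbert R (arr S))) (ind F) <=
   reduced_norm F)%E.
Proof.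
move=> tF; apply: ge_ereal_sup => _ [xi [[xi0 xie xioo] /= xi1] <-].
rewrite (ind_norm_eval (ind_out tF xi0) (ind_equiv tF xie)).
rewrite (ind_norm_eval xi0 xie) in xioo xi1.
have out := ind_eval_out xi0.
have cout g : src g <> x -> convol F (ind_eval xi) g = 0.
  move=> gx; rewrite convol_src fsbig1// => h; rewrite /src_fiber/= => hg.
  by rewrite out ?mulr0// hg.
have -> : ind_eval (ind F xi) = convol F (ind_eval xi).
  by apply/funext => g; exact: ind_eval_ind.
rewrite -(ell2_norm_sqsum cout) -(regular_convol _ out).
apply: (@le_trans _ _ (opnorm (ell2 x) (ell2_norm x) (regular x F))).
  apply: ereal_sup_ubound; exists (ind_eval xi) => //.
  by split => /=; [split => //|]; rewrite ell2_norm_sqsum.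
by apply: ereal_sup_ubound; exists x.
Qed.

Lemma opnorm_ind_ge0 F (H : hilbert R) (rho : representation S H) :
  (0 <= opnorm (ind_space rho) (@ind_norm R G x H) (ind F))%E.
Proof.
apply: (@le_trans _ _ (ind_norm x (ind F (fun=> 0 : H)))); first exact: sqrte_ge0.
apply: ereal_sup_ubound; exists (fun=> 0) => //.
have z : ind_norm x (fun=> 0 : H) = 0%E.
  by rewrite /ind_norm esum1 ?sqrte0// => c _; rewrite normr0 expr0n.
by split; [split=> // [g h _|]; rewrite ?linear0 ?z|rewrite /= z].
Qed.

Lemma left_regular_factors : (forall F : arr G -> R[i], Cc F -> tgt_finite F) ->
  ind_factors_reduced lam.
Proof.
move=> tF b ker.
apply: (squeeze_cvge (f := fun=> 0%E) (h := fun n => reduced_norm (b n))) ker.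
- apply: nearW => n; rewrite opnorm_ind_ge0/=.
  exact/opnorm_ind_left_regular/tF/cstar_Cc.
- exact: cvg_cst.
Qed.

End norm_e_ge.

Theorem corollary4p15 (R : realType) (Gam : groupType) (X : topologicalType)
    (X_hausdorff : hausdorff_space X) (X_lc : locally_compact [set: X])
    (a : partial_action Gam X) (x : X)
    (f : arr (isotropy (G := action_groupoid a) x) -> R[i]) (f_Cc : Cc f) :
  norm_e f = reduced_norm f.
Proof.
apply/eqP; rewrite eq_le norm_e_le_reduced//=.
apply: le_trans (reduced_norm_le_left_regular f_Cc) _.
apply: ereal_sup_ubound; exists (ell2_hilbert R (arr (isotropy (G := action_groupoid a) x))).
exists (left_regular R (G := action_groupoid a) x); split => //.
apply: left_regular_factors => F CF.
by apply: finite_elt_tgt; exact: Cc_finite_elt.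
Qed.
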